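(* Let $\alpha\in(0,1)$ and let $\Omega\subset\mathbb{R}^n$ be an open set. If $f\in BV^\alpha(\mathbb{R}^n)$ and either $\Omega$ is bounded or $\Omega=\mathbb{R}^n$, then $$\limsup_{\beta\to\alpha^-}|D^\beta f|(\Omega)\le|D^\alpha f|(\overline{\Omega}).$$
   Context: Here $n\in\mathbb{N}$, $n\ge1$. For $\alpha\in(0,1)$ let $\mu_{n,\alpha}:=2^\alpha\pi^{-n/2}\,\Gamma\big(\tfrac{n+\alpha+1}{2}\big)/\Gamma\big(\tfrac{1-\alpha}{2}\big)$, and for $\varphi\in C^\infty_c(\mathbb{R}^n;\mathbb{R}^n)$ let $$\mathrm{div}^\alpha\varphi(x):=\mu_{n,\alpha}\int_{\mathbb{R}^n}\frac{(y-x)\cdot(\varphi(y)-\varphi(x))}{|y-x|^{n+\alpha+1}}\,dy,\qquad x\in\mathbb{R}^n,$$ which belongs to $L^1(\mathbb{R}^n)\cap L^\infty(\mathbb{R}^n)$. $BV^\alpha(\mathbb{R}^n)$ is the space of $f\in L^1(\mathbb{R}^n)$ such that $$\sup\Big\{\int_{\mathbb{R}^n} f\,\mathrm{div}^\alpha\varphi\,dx:\ \varphi\in C^\infty_c(\mathbb{R}^n;\mathbb{R}^n),\ \|\varphi\|_{L^\infty}\le1\Big\}<+\infty;$$ equivalently, there is a (unique) finite $\mathbb{R}^n$-valued Radon measure $D^\alpha f$ on $\mathbb{R}^n$ with $\int f\,\mathrm{div}^\alpha\varphi\,dx=-\int\varphi\cdot dD^\alpha f$ for all $\varphi\in C^\infty_c(\mathbb{R}^n;\mathbb{R}^n)$.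 $|D^\alpha f|$ is its total variation measure. If $f\in BV^\alpha(\mathbb{R}^n)$ then $f\in BV^\beta(\mathbb{R}^n)$ for every $\beta\in(0,\alpha)$. *)

(* Defs.v *)
From HB Require Import structures.
From mathcomp Require Import all_boot all_order all_algebra.
From mathcomp Require Import all_classical all_reals all_analysis.
From mathcomp Require Import measurable_realfun.
Set Implicit Arguments.
Unset Strict Implicit.
Unset Printing Implicit Defensive.
Import Order.TTheory GRing.Theory Num.Theory.
Import numFieldNormedType.Exports.
Local Open Scope classical_set_scope.
Local Open Scope ring_scope.

(* 'rV[R]_n carries its Borel sigma-algebra. *)
HB.instance Definition _ (R : realType) (n : nat) :=
  @isMeasurable.Build (sigma_display (@open 'rV[R]_n)) 'rV[R]_n
    <<s @open 'rV[R]_n >> (@sigma_algebra0 _ setT _)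
    (@sigma_algebraC _ _) (@sigma_algebra_bigcup _ setT _).

Section borel_rV.
Context {R : realType} {n : nat}.

Lemma measurable_rVE :
  @measurable _ 'rV[R]_n = <<s @open 'rV[R]_n >>.
Proof. by []. Qed.


Lemma continuous_measurable_rV (f : 'rV[R]_n -> R) :
  continuous f -> measurable_fun setT f.
Proof.
move=> /continuousP cf.
apply: (measurability _ (RGenOpens.measurableE R)).
move=> _ [_ [a [b ->] <-]]; rewrite setTI.
by apply: sub_sigma_algebra; exact: cf (interval_open _ _).
Qed.

Lemma measurable_coord (i : 'I_n) :
  measurable_fun [set: 'rV[R]_n] (fun x : 'rV[R]_n => x ord0 i).
Proof. by apply: continuous_measurable_rV => x; exact: coord_continuous. Qed.

Lemma measurable_fun_rV d (T : measurableType d) (f : T -> 'rV[R]_n) :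
  (forall i, measurable_fun setT (fun t => f t ord0 i)) ->
  measurable_fun setT f.
Proof.
move=> mf; apply: (measurability (@open 'rV[R]_n)) => //.
move=> _ [U oU <-]; rewrite setTI.
pose B (p : 'rV[rat]_n * rat) : set 'rV[R]_n :=
  [set x | forall i, ball (ratr (p.1 ord0 i) : R) (ratr p.2) (x ord0 i)].
pose F p := if `[< B p `<=` U >] then f @^-1` B p else set0.
have -> : f @^-1` U = \bigcup_p F p.
  apply/seteqP; split => [t /= Ut|t [p _]]; last first.
    by rewrite /F; case: asboolP => // BU /BU.
  have /nbhs_ballP[e /= e0 eU] : nbhs (f t) U by exact: open_nbhs_nbhs.
  have e20 : 0 < e / 2 by rewrite divr_gt0.
  have [r /= re] : exists r : rat, 0 < (ratr r : R) < e / 2.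
    by have [r /itvP re] := rat_in_itvoo e20; exists r; rewrite !re.
  have [q qf] : exists q : 'rV[rat]_n,
      forall i, ball (ratr (q ord0 i) : R) (ratr r) (f t ord0 i).
    have H i : exists q : rat, ball (ratr q : R) (ratr r) (f t ord0 i).
      have [q /itvP qi] : exists q : rat,
          ratr q \in `](f t ord0 i - ratr r), (f t ord0 i + ratr r)[.
        by apply: rat_in_itvoo; rewrite ltrBlDr -addrA ltrDl; case/andP: re => r0 _; rewrite addr_gt0.
      exists q; rewrite /ball/= ltr_distlC.
      by rewrite ltrBlDr qi/= -ltrBlDr qi.
    by exists (\row_i projT1 (cid (H i))) => i; rewrite mxE; case: cid.
  exists (q, r) => //; rewrite /F; case: asboolP => //; case; move=> y /= By.
  apply: eU; split => // i j; rewrite ord1.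
  apply: (@le_ball _ _ _ (ratr r + ratr r)).
    by rewrite [e]splitr; case/andP: re => _ /ltW re; rewrite lerD.
  by apply: ball_triangle (By j); exact/ball_sym/qf.
apply: countable_bigcupT_measurable => // p; rewrite /F; case: ifP => // _.
have -> : f @^-1` B p = \bigcap_i
    ((fun t => f t ord0 i) @^-1` ball (ratr (p.1 ord0 i) : R) (ratr p.2)).
  by apply/seteqP; split => t /= h i; [move=> _; exact: h|exact: h].
apply: fin_bigcap_measurable => // i _.
by rewrite -[X in measurable X]setTI; apply: mf => //; exact: measurable_ball.
Qed.

End borel_rV.

Section lebesgue_rV.
Context {R : realType}.

Section step.
Variables (n : nat) (mu : {sigma_finite_measure set 'rV[R]_n -> \bar R}).

Definition cons_rV (p : measurableTypeR R * 'rV[R]_n) : 'rV[R]_n.+1 :=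
  row_mx (p.1%:M : 'M[R]_1) p.2.

Lemma cons_rV0 a v : cons_rV (a, v) ord0 ord0 = a.
Proof.
have -> : (ord0 : 'I_n.+1) = lshift n (ord0 : 'I_1) by apply/val_inj.
by rewrite [LHS]row_mxEl mxE eqxx mulr1n.
Qed.

Lemma cons_rVS a v i : cons_rV (a, v) ord0 (lift ord0 i) = v ord0 i.
Proof.
have -> : lift ord0 i = rshift 1 i by apply/val_inj.
by rewrite [LHS]row_mxEr.
Qed.

Lemma measurable_cons_rV : measurable_fun setT cons_rV.
Proof.
apply: measurable_fun_rV => i.
case: (unliftP ord0 i) => [j ->|->]; last first.
  rewrite [X in measurable_fun _ X](_ : _ = fst); first exact: measurable_fst.
  by apply/funext => -[a v]; exact: cons_rV0.
rewrite [X in measurable_fun _ X](_ : _ = (fun v : 'rV[R]_n => v ord0 j) \o snd).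
  exact: measurableT_comp (measurable_coord j) measurable_snd.
by apply/funext => -[a v]; exact: cons_rVS.
Qed.

Let uncons (x : 'rV[R]_n.+1) : measurableTypeR R * 'rV[R]_n :=
  (x ord0 ord0, rsubmx (x : 'rV[R]_(1 + n))).

Let measurable_uncons : measurable_fun setT uncons.
Proof.
apply/measurable_fun_pair; first exact: measurable_coord.
apply: measurable_fun_rV => i; under eq_fun do rewrite mxE.
exact: measurable_coord.
Qed.

Let cons_rVK : cancel cons_rV uncons.
Proof.
by move=> [a v]; rewrite /uncons cons_rV0 /cons_rV row_mxKr.
Qed.

Definition lebesgue_cons : set 'rV[R]_n.+1 -> \bar R :=
  pushforward (lebesgue_measure \x mu)%E cons_rV.

HB.instance Definition _ := Measure.copy lebesgue_cons
  (measure_function_pushforward__canonical__measure_function_Measure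
    (lebesgue_measure \x mu)%E measurable_cons_rV).

Let lebesgue_cons_sigma_finite : sigma_finite setT lebesgue_cons.
Proof.
have /sigma_finiteP[F [UF ndF Foo]] := sigma_finiteT (@lebesgue_measure R).
have /sigma_finiteP[G [UG ndG Goo]] := sigma_finiteT mu.
exists (fun k => uncons @^-1` (F k `*` G k)).
  rewrite -preimage_bigcup; apply/esym/seteqP; split => // x _ /=.
  have [k _ Fk] : (\bigcup_k F k) (uncons x).1 by rewrite -UF.
  have [l _ Gl] : (\bigcup_k G k) (uncons x).2 by rewrite -UG.
  exists (maxn k l) => //; split.
  - by move: Fk; exact/subsetPset/ndF/leq_maxl.
  - by move: Gl; exact/subsetPset/ndG/leq_maxr.
move=> k; have [mF Fk] := Foo k; have [mG Gk] := Goo k.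
have mFG : measurable (F k `*` G k) by exact: measurableX.
split; first by rewrite -[X in measurable X]setTI; exact: measurable_uncons.
rewrite /lebesgue_cons /pushforward -comp_preimage.
rewrite (_ : uncons \o cons_rV = id); last first.
  by apply/funext => x; exact: cons_rVK.
by rewrite preimage_id product_measure1E// lte_mul_pinfty// ge0_fin_numE.
Qed.

HB.instance Definition _ := Measure_isSigmaFinite.Build _ _ _ lebesgue_cons
  lebesgue_cons_sigma_finite.

End step.

(* Lebesgue measure on R^n as an iterated product; see lebesgue_rV_box. *)
Fixpoint lebesgue_rV (n : nat) : {sigma_finite_measure set 'rV[R]_n -> \bar R} :=
  if n is m.+1 then lebesgue_cons (lebesgue_rV m) else dirac (0 : 'rV[R]_0).

Lemma lebesgue_rV_box (n : nat) (A : 'I_n -> set (measurableTypeR R)) :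
  (forall i, measurable (A i)) ->
  lebesgue_rV n [set x | forall i, A i (x ord0 i)] =
  (\prod_(i < n) lebesgue_measure (A i))%E.
Proof.
elim: n A => [|n IHn] A mA.
  rewrite big_ord0 /= diracE mem_set//= => i; by case: i.
rewrite big_ord_recl /= /lebesgue_cons /pushforward.
rewrite -(IHn (fun i => A (lift ord0 i))); last by move=> i.
set B := [set x : 'rV[R]_n | forall i, A (lift ord0 i) (x ord0 i)].
have mB : measurable B.
  rewrite (_ : B = \bigcap_i
    ((fun x : 'rV[R]_n => x ord0 i) @^-1` A (lift ord0 i))); last first.
    by apply/seteqP; split => x /= h i; [move=> _; exact: h|exact: h].
  apply: fin_bigcap_measurable => // i _.
  by rewrite -[X in measurable X]setTI; exact: (measurable_coord i measurableT (mA _)).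
rewrite -(product_measure1E lebesgue_measure (lebesgue_rV n) (mA ord0) mB).
congr (_ _); apply/seteqP; split => -[a v] /=.
  move=> h; split => /= [|i].
    by have := h ord0; rewrite (cons_rV0 a v).
  by have := h (lift ord0 i); rewrite (cons_rVS a v).
move=> [/= a0 av] i; case: (unliftP ord0 i) => [j ->|->].
  by rewrite cons_rVS; exact: av.
by rewrite cons_rV0.
Qed.

End lebesgue_rV.

Section frac_variation.
Context {R : realType} {n : nat}.
Local Notation Rn := 'rV[R]_n.
Local Notation leb := (@lebesgue_rV R n).

Definition edot (x y : Rn) : R := \sum_(i < n) x ord0 i * y ord0 i.

Definition enorm (x : Rn) : R := Num.sqrt (edot x x).

(* C^k: all iterated partial derivatives of order at most k exist everywhere
   and are continuous. *)
Fixpoint Ck {W : normedModType R} (k : nat) (f : Rn -> W) : Prop :=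
  continuous f /\
  if k is m.+1 then
    forall i : 'I_n, (forall x, derivable f x (delta_mx ord0 i)) /\
      Ck m (fun x => 'D_(delta_mx ord0 i) f x)
  else True.

Definition smooth {W : normedModType R} (f : Rn -> W) : Prop :=
  forall k, Ck k f.

Definition test_field (phi : Rn -> Rn) : Prop :=
  smooth phi /\ compact (closure [set x | phi x != 0]).

Definition Gamma (s : R) : R :=
  \int[lebesgue_measure]_(t in `]0, +oo[) (t `^ (s - 1) * expR (- t)).

Definition frac_const (alpha : R) : R :=
  2 `^ alpha * pi `^ (- (n%:R / 2)) *
  Gamma ((n%:R + alpha + 1) / 2) / Gamma ((1 - alpha) / 2).

(* The norms of the definition are Euclidean, whereas the library norm on
   'rV[R]_n is the sup norm. At y = x the quotient evaluates to 0. *)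
Definition frac_div (alpha : R) (phi : Rn -> Rn) (x : Rn) : R :=
  frac_const alpha *
  \int[leb]_y
    (edot (y - x) (phi y - phi x) / enorm (y - x) `^ (n%:R + alpha + 1)).

Definition BVfrac (alpha : R) (f : Rn -> R) : Prop :=
  leb.-integrable setT (EFin \o f) /\
  (ereal_sup [set \int[leb]_x (f x * frac_div alpha phi x)%:E | phi in
     [set phi | test_field phi /\
                (Lnorm leb +oo (fun x => (enorm (phi x))%:E) <= 1)%E]] < +oo)%E.

(* Integral against a signed measure, via its Jordan decomposition (which does
   not depend on the chosen Hahn decomposition). *)
Definition charge_integral d (T : measurableType d)
    (nu : {charge set T -> \bar R}) (g : T -> \bar R) : \bar R :=
  let P := cid (Hahn_decomposition nu) in
  let N := cid (projT2 P) in
  (\int[jordan_pos (projT2 N)]_x g x - \int[jordan_neg (projT2 N)]_x g x)%E.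

(* Finite R^n-valued Borel measures, given by their components. *)
Definition vector_measure := 'I_n -> {charge set Rn -> \bar R}.

(* The total variation |D|, for the Euclidean norm on R^n. *)
Definition vector_variation (D : vector_measure) (A : set Rn) : \bar R :=
  ereal_sup
    [set (\sum_(k <oo) (enorm (\row_i fine (D i (E k))))%:E)%E | E in
      [set E : (set Rn)^nat | [/\ forall k, measurable (E k),
        trivIset setT E & \bigcup_k E k = A]]].

Definition is_frac_variation (alpha : R) (f : Rn -> R) (D : vector_measure) :
    Prop :=
  forall phi, test_field phi ->
    (\int[leb]_x (f x * frac_div alpha phi x)%:E =
     - \sum_(i < n) charge_integral (D i) (fun x => (phi x ord0 i)%:E))%E.

(* D^alpha f; such a measure exists and is unique when f is in BV^alpha.
   The value is the zero measure when there is none. *)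
Definition frac_variation (alpha : R) (f : Rn -> R) : vector_measure :=
  if pselect (exists D, is_frac_variation alpha f D) is left exD
  then projT1 (cid exD) else fun=> czero.

End frac_variation.

(* Main.v *)
(* Let s = (alpha - beta) / 2 and let P_t be the heat semigroup.  Subordination
   gives div^alpha phi = Gamma(a)^-1 int_0^oo t^(a-1) div (P_t phi) dt with
   a = (1 - alpha) / 2, and the convolution of the powers t^(a-1) and t^(s-1) is
   a multiple of t^(a+s-1).  So div^beta phi is, up to a uniform error
   O(1 / Gamma(s)) = O(s), the Bessel average A_s (div^alpha phi), where A_s
   averages P_r with the probability density r^(s-1) e^(-r) / Gamma(s).
   Translates of test fields are test fields, hence Fubini yields
   int f A_s(div^alpha phi) = - int A_s(phi) . dD^alpha f.  If |phi| <= 1 and phi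
   vanishes off Omega, then |A_s(phi)| <= 1, and A_s(phi) = O(s / delta^2) at
   distance delta from Omega, because A_s has second moment O(s).  Thus
   |D^beta f|(Omega) <= |D^alpha f|(Omega_delta) + O(s) for every delta > 0, and
   Omega_delta decreases to the closure of Omega.
   The measure D^alpha f exists by a Riesz theorem: sampling the functional on
   finer and finer partitions of unity, and taking a limit along an ultrafilter
   of the positive and negative parts of the sampled masses, gives two positive
   functionals on all bounded functions; the inner content of each of them on
   open sets induces a Borel measure. *)
Require Import Defs.
From HB Require Import structures.
From mathcomp Require Import all_boot all_order all_algebra.
From mathcomp Require Import all_classical all_reals all_analysis.
From mathcomp Require Import measurable_realfun ring lra.
Set Implicit Arguments.
Unset Strict Implicit.
Unset Printing Implicit Defensive.
Import Order.TTheory GRing.Theory Num.Theory.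
Import numFieldNormedType.Exports.
Local Open Scope classical_set_scope.
Local Open Scope ring_scope.

(** * Integration on R^n *)

(** Formally, D^beta f is the Riesz potential of order 2s = alpha - beta of D^alpha f. That kernel
    is not integrable at infinity and gives no comparison of masses. The factor e^(-r) makes it a
    probability density, which is why |D^alpha f| enters with constant 1; the part lost, of weight 1
    - e^(-r), vanishes at r = 0, carries 1 / Gamma(s), and is controlled at large times by the decay
    of the heat flow. The error must be uniform over all test fields with |phi| <= 1, whose
    derivatives are not controlled: the derivative is therefore put on the heat kernel, and
    Lipschitz constants serve only to make integrals converge. The restriction beta >= 3 alpha / 4
    keeps s <= alpha / 8, so that one integrable majorant serves all s. Total variation is defined
    by partitions and is linked to test fields in both directions: step fields are smoothed in one,
    fields are discretised in the other. The ultrafilter in the Riesz theorem is there because the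
    limit functional must be defined on indicators of all sets, whereas a diagonal subsequence
    handles only countably many. *)

Section lebesgue_rV_invariance.
Context {R : realType}.
Local Open Scope ereal_scope.

(** Tonelli along the first coordinate. As [lebesgue_rV] is an iterated product, this is the
    induction step for the computations with it. *)
Lemma ge0_integral_lebS (n : nat) (h : 'rV[R]_n.+1 -> \bar R) :
  measurable_fun setT h -> (forall x, 0 <= h x) ->
  \int[lebesgue_rV n.+1]_x h x =
  \int[lebesgue_measure]_a \int[lebesgue_rV n]_u h (cons_rV (a, u)).
Proof.
move=> mh h0; rewrite /= /lebesgue_cons.
rewrite (ge0_integral_pushforward (@measurable_cons_rV R n))//.
rewrite preimage_setT (fubini_tonelli1 (h \o @cons_rV R n))//.
- by apply: measurableT_comp => //; exact: measurable_cons_rV.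
- by move=> x /=.
Qed.

Lemma cons_rVD (n : nat) (a b : R) (u v : 'rV[R]_n) :
  (cons_rV (a, u) + cons_rV (b, v) = cons_rV (a + b, u + v) :> 'rV[R]_n.+1)%R.
Proof.
apply/rowP => i; rewrite mxE; case: (unliftP ord0 i) => [j ->|->].
  by rewrite !cons_rVS mxE.
by rewrite !cons_rV0.
Qed.

Lemma cons_rVN (n : nat) (a : R) (u : 'rV[R]_n) :
  (- cons_rV (a, u) = cons_rV (- a, - u) :> 'rV[R]_n.+1)%R.
Proof.
apply/rowP => i; rewrite mxE; case: (unliftP ord0 i) => [j ->|->].
  by rewrite !cons_rVS mxE.
by rewrite !cons_rV0.
Qed.

Lemma cons_rV_surj (n : nat) (x : 'rV[R]_n.+1) :
  x = cons_rV (x ord0 ord0, \row_i x ord0 (lift ord0 i)).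
Proof.
apply/rowP => i; case: (unliftP ord0 i) => [j ->|->].
  by rewrite cons_rVS mxE.
by rewrite cons_rV0.
Qed.

(** Lebesgue measure is determined by its values on half-open intervals, so only lengths of
    translated intervals have to be compared. The scaling lemma below rests on the same uniqueness,
    applied to [c] times the pushforward. *)
Lemma lebesgue_measure_shift (c : R) (A : set R) : measurable A ->
  pushforward lebesgue_measure ((fun x => x + c)%R : _ -> measurableTypeR R) A =
  lebesgue_measure A.
Proof.
move=> mA.
have mf : measurable_fun [set: measurableTypeR R]
    ((fun x => x + c)%R : _ -> measurableTypeR R).
  exact: measurable_funD.
apply/esym/(lebesgue_measure_unique
  (mu := pushforward lebesgue_measure ((fun x => x + c)%R : _ -> measurableTypeR R))) => //.
move=> _ [[a b]] _ <-; rewrite /pushforward/=.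
rewrite [X in _ = lebesgue_measure X](_ : _ = `](a - c)%R, (b - c)%R]%classic); last first.
  by apply/seteqP; split => x; rewrite /= !in_itv/= ltrBlDr lerBrDr.
rewrite !lebesgue_measure_itv/= !lte_fin ltrD2r.
by case: ifP => // _; rewrite -!EFinD; congr EFin; lra.
Qed.

Lemma ge0_integral_shift (c : R) (h : R -> \bar R) :
  measurable_fun setT h -> (forall x, 0 <= h x) ->
  \int[lebesgue_measure]_x h (x + c)%R = \int[lebesgue_measure]_x h x.
Proof.
move=> mh h0.
have mf : measurable_fun [set: measurableTypeR R]
    ((fun x => x + c)%R : _ -> measurableTypeR R).
  exact: measurable_funD.
rewrite -[LHS](ge0_integral_pushforward mf lebesgue_measure measurableT)//.
by apply: eq_measure_integral => A mA _; exact: lebesgue_measure_shift.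
Qed.

Lemma ge0_integral_opp (h : R -> \bar R) :
  measurable_fun setT h -> (forall x, 0 <= h x) ->
  \int[lebesgue_measure]_x h (- x)%R = \int[lebesgue_measure]_x h x.
Proof.
move=> mh h0.
have mf : measurable_fun [set: measurableTypeR R]
    ((fun x => - x)%R : _ -> measurableTypeR R).
  exact: measurable_funN.
rewrite -[LHS](ge0_integral_pushforward mf lebesgue_measure measurableT)//.
by apply: eq_measure_integral => A mA _; exact: lebesgue_measureN.
Qed.

Lemma lebesgue_measure_scale (c : R) (c0 : (0 < c)%R) (A : set R) :
  measurable A ->
  pushforward lebesgue_measure ((fun x => c * x)%R : _ -> measurableTypeR R) A =
  (c^-1)%:E * lebesgue_measure A.
Proof.
move=> mA.
have mf : measurable_fun [set: measurableTypeR R]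
    ((fun x => c * x)%R : _ -> measurableTypeR R).
  exact: measurable_funM.
have ci0 : (0 <= c)%R by exact: ltW.
pose P : {measure set (measurableTypeR R) -> \bar R} :=
  measure_function_pushforward__canonical__measure_function_Measure
    lebesgue_measure mf.
suff H : lebesgue_measure A = mscale (NngNum ci0) P A.
  by rewrite H /mscale/= muleA -EFinM mulVf ?mul1e// gt_eqF.
apply: (lebesgue_measure_unique (mu := mscale (NngNum ci0) P)) => //.
move=> _ [[a b]] _ <-; rewrite /mscale/= /pushforward/=.
rewrite [X in _ = _ * lebesgue_measure X](_ : _ = `](a / c)%R, (b / c)%R]%classic); last first.
  apply/seteqP; split => x; rewrite /= !in_itv/=;
    by rewrite ltr_pdivrMr// ler_pdivlMr// ![(x * c)%R]mulrC.
rewrite !lebesgue_measure_itv/= !lte_fin ltr_pM2r ?invr_gt0//.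
case: ifP => _; rewrite ?mule0// -!EFinD -EFinM; congr EFin.
by field; rewrite gt_eqF.
Qed.

Lemma ge0_integral_scale (c : R) (h : R -> \bar R) : (0 < c)%R ->
  measurable_fun setT h -> (forall x, 0 <= h x) ->
  \int[lebesgue_measure]_x h (c * x)%R =
  (c^-1)%:E * \int[lebesgue_measure]_x h x.
Proof.
move=> c0 mh h0.
have mf : measurable_fun [set: measurableTypeR R]
    ((fun x => c * x)%R : _ -> measurableTypeR R).
  exact: measurable_funM.
rewrite -[LHS](ge0_integral_pushforward mf lebesgue_measure measurableT)//.
have ci0 : (0 <= c^-1)%R by rewrite invr_ge0 ltW.
rewrite -(ge0_integral_mscale lebesgue_measure measurableT (NngNum ci0))//.
apply: eq_measure_integral => A mA _ /=.
exact: lebesgue_measure_scale.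
Qed.

Lemma measurable_rVD d (T : measurableType d) (n : nat)
    (g1 g2 : T -> 'rV[R]_n) :
  measurable_fun setT g1 -> measurable_fun setT g2 ->
  measurable_fun setT (fun x => g1 x + g2 x)%R.
Proof.
move=> m1 m2; apply: measurable_fun_rV => i.
under eq_fun do rewrite mxE.
by apply: measurable_funD; apply: (measurableT_comp (measurable_coord i)).
Qed.

Lemma measurable_rVN d (T : measurableType d) (n : nat) (g : T -> 'rV[R]_n) :
  measurable_fun setT g -> measurable_fun setT (fun x => - g x)%R.
Proof.
move=> m1; apply: measurable_fun_rV => i.
under eq_fun do rewrite mxE.
by apply: measurable_funN; apply: (measurableT_comp (measurable_coord i)).
Qed.

Lemma rV0E (x : 'rV[R]_0) : x = 0%R.
Proof. by apply/rowP => -[]. Qed.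

Lemma ge0_integral_lebD (n : nat) (v : 'rV[R]_n) (h : 'rV[R]_n -> \bar R) :
  measurable_fun setT h -> (forall x, 0 <= h x) ->
  \int[lebesgue_rV n]_x h (x + v)%R = \int[lebesgue_rV n]_x h x.
Proof.
elim: n v h => [|n IHn] v h mh h0.
  by apply: eq_integral => x _; rewrite (rV0E v) addr0.
rewrite !ge0_integral_lebS//; last first.
  by apply: (measurableT_comp mh); apply: measurable_rVD.
have mcons a : measurable_fun setT (fun u : 'rV[R]_n => cons_rV (a, u)).
  by apply: (measurableT_comp (@measurable_cons_rV R n)); exact: measurable_pair1.
rewrite [v]cons_rV_surj.
set b := v _ _; set w := \row_i _.
transitivity (\int[lebesgue_measure]_a
  (fun a => \int[lebesgue_rV n]_u h (cons_rV (a, u))) (a + b)%R).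
  apply: eq_integral => a _ /=.
  under eq_integral do rewrite cons_rVD.
  rewrite (IHn w (fun u => h (cons_rV (a + b, u)%R)))//.
  exact: (measurableT_comp mh).
apply: (ge0_integral_shift b) => [|a].
  apply: (measurable_fun_fubini_tonelli_F (h \o @cons_rV R n)) => //=.
  by apply: (measurableT_comp mh); exact: measurable_cons_rV.
by apply: integral_ge0.
Qed.

Lemma ge0_integral_lebN (n : nat) (h : 'rV[R]_n -> \bar R) :
  measurable_fun setT h -> (forall x, 0 <= h x) ->
  \int[lebesgue_rV n]_x h (- x)%R = \int[lebesgue_rV n]_x h x.
Proof.
elim: n h => [|n IHn] h mh h0.
  by apply: eq_integral => x _; rewrite (rV0E (- x)) (rV0E x).
rewrite !ge0_integral_lebS//; last first.
  by apply: (measurableT_comp mh); apply: measurable_rVN.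
have mcons a : measurable_fun setT (fun u : 'rV[R]_n => cons_rV (a, u)).
  by apply: (measurableT_comp (@measurable_cons_rV R n)); exact: measurable_pair1.
transitivity (\int[lebesgue_measure]_a
  (fun a => \int[lebesgue_rV n]_u h (cons_rV (a, u))) (- a)%R).
  apply: eq_integral => a _ /=.
  under eq_integral do rewrite cons_rVN.
  rewrite (IHn (fun u => h (cons_rV (- a, u)%R)))//.
  exact: (measurableT_comp mh).
apply: ge0_integral_opp => [|a].
  apply: (measurable_fun_fubini_tonelli_F (h \o @cons_rV R n)) => //=.
  by apply: (measurableT_comp mh); exact: measurable_cons_rV.
by apply: integral_ge0.
Qed.

End lebesgue_rV_invariance.

Section integral_invariance.
Context {R : realType} {n : nat}.
Local Notation leb := (@lebesgue_rV R n).

Lemma integral_lebD (v : 'rV[R]_n) (h : 'rV[R]_n -> \bar R) :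
  measurable_fun setT h ->
  (\int[leb]_x h (x + v)%R = \int[leb]_x h x)%E.
Proof.
move=> mh; rewrite integralE [RHS]integralE; congr (_ - _)%E.
- rewrite -(ge0_integral_lebD v (h := (h^\+)%E))//.
    by apply: eq_integral => x _; rewrite !(funeposE,funenegE).
  exact: measurable_funepos.
- rewrite -(ge0_integral_lebD v (h := (h^\-)%E))//.
    by apply: eq_integral => x _; rewrite !(funeposE,funenegE).
  exact: measurable_funeneg.
Qed.

Lemma integral_lebN (h : 'rV[R]_n -> \bar R) :
  measurable_fun setT h ->
  (\int[leb]_x h (- x)%R = \int[leb]_x h x)%E.
Proof.
move=> mh; rewrite integralE [RHS]integralE; congr (_ - _)%E.
- rewrite -(ge0_integral_lebN (h := (h^\+)%E))//.
    by apply: eq_integral => x _; rewrite !(funeposE,funenegE).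
  exact: measurable_funepos.
- rewrite -(ge0_integral_lebN (h := (h^\-)%E))//.
    by apply: eq_integral => x _; rewrite !(funeposE,funenegE).
  exact: measurable_funeneg.
Qed.

Lemma Rintegral_lebD (v : 'rV[R]_n) (h : 'rV[R]_n -> R) :
  measurable_fun setT h ->
  \int[leb]_x h (x + v) = \int[leb]_x h x.
Proof.
move=> mh; congr fine; rewrite -(integral_lebD v (h := EFin \o h))//.
exact/measurable_EFinP.
Qed.

Lemma Rintegral_lebN (h : 'rV[R]_n -> R) :
  measurable_fun setT h ->
  \int[leb]_x h (- x) = \int[leb]_x h x.
Proof.
move=> mh; congr fine; rewrite -(integral_lebN (h := EFin \o h))//.
exact/measurable_EFinP.
Qed.

Lemma integrable_lebD (v : 'rV[R]_n) (h : 'rV[R]_n -> R) :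
  leb.-integrable setT (EFin \o h) ->
  leb.-integrable setT (EFin \o (fun x => h (x + v))).
Proof.
move=> ih; have mh := measurable_int _ ih.
have mv : measurable_fun setT (fun x : 'rV[R]_n => x + v) by exact: measurable_rVD.
apply/integrableP; split; first exact: (measurableT_comp mh mv).
rewrite (integral_lebD v (h := fun x => `|(h x)%:E|%E)).
  by case/integrableP : ih.
exact: measurableT_comp.
Qed.

End integral_invariance.

(** * Real-valued integrals and Fubini's theorem for them *)

Section real_integrals.
Context d (T : measurableType d) {R : realType} (mu : {measure set T -> \bar R}).

Lemma integrable_le (f g : T -> R) : measurable_fun setT f ->
  mu.-integrable setT (EFin \o g) -> (forall x, `|f x| <= g x) ->
  mu.-integrable setT (EFin \o f).
Proof.
move=> mf ig fg; apply: (le_integrable measurableT _ _ ig).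
  exact/measurable_EFinP.
by move=> x _ /=; rewrite lee_fin (le_trans (fg x))// ler_norm.
Qed.

Lemma Rintegral_le_bound (f g : T -> R) : measurable_fun setT f ->
  mu.-integrable setT (EFin \o g) -> (forall x, `|f x| <= g x) ->
  `|\int[mu]_x f x| <= \int[mu]_x g x.
Proof.
move=> mf ig fg.
have jf := integrable_le mf ig fg.
apply: le_trans (le_normr_Rintegral measurableT jf) _.
apply: le_Rintegral => //; first exact: integrable_norm.
Qed.

Lemma integral_fineK (f : T -> R) : mu.-integrable setT (EFin \o f) ->
  (\int[mu]_x (f x)%:E = (\int[mu]_x f x)%:E)%E.
Proof. by move=> jf; rewrite /Rintegral fineK//; exact: integrable_fin_num. Qed.

Lemma RintegralZ (f : T -> R) (r : R) : mu.-integrable setT (EFin \o f) ->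
  \int[mu]_x (r * f x) = r * \int[mu]_x f x.
Proof. by move=> jf; rewrite RintegralZl. Qed.

Lemma integrable_Zl (f : T -> R) (r : R) : mu.-integrable setT (EFin \o f) ->
  mu.-integrable setT (EFin \o (fun x => r * f x)).
Proof. by move=> jf; exact: (integrableZl measurableT r jf). Qed.

Lemma integrable_Radd (f g : T -> R) : mu.-integrable setT (EFin \o f) ->
  mu.-integrable setT (EFin \o g) ->
  mu.-integrable setT (EFin \o (fun x => f x + g x)).
Proof. by move=> jf jg; exact: (integrableD measurableT jf jg). Qed.

Lemma integrable_Rsum (I : Type) (s : seq I) (f : I -> T -> R) :
  (forall i, mu.-integrable setT (EFin \o f i)) ->
  mu.-integrable setT (EFin \o (fun x => \sum_(i <- s) f i x)).
Proof.
move=> jf.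
rewrite (_ : EFin \o _ = fun x => (\sum_(i <- s) (EFin \o f i) x)%E).
  exact: integrable_sum.
by apply/funext => x /=; rewrite sumEFin.
Qed.

Lemma Rintegral_sum (I : Type) (s : seq I) (f : I -> T -> R) :
  (forall i, mu.-integrable setT (EFin \o f i)) ->
  \int[mu]_x (\sum_(i <- s) f i x) = \sum_(i <- s) \int[mu]_x f i x.
Proof.
move=> jf; elim: s => [|i s IH].
  under eq_Rintegral do rewrite big_nil; rewrite big_nil.
  by rewrite Rintegral_cst// mul0r.
under eq_Rintegral do rewrite big_cons.
rewrite big_cons RintegralD//; first by rewrite IH.
exact: integrable_Rsum.
Qed.

End real_integrals.

Section real_fubini.
Context d1 d2 (T1 : measurableType d1) (T2 : measurableType d2) {R : realType}.
Variable m1 : {sigma_finite_measure set T1 -> \bar R}.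
Variable m2 : {sigma_finite_measure set T2 -> \bar R}.
Implicit Type F : T1 * T2 -> R.

(** The real integral is [fine] of a difference of two Tonelli integrals, hence measurable in the
    parameter even where the section is not integrable. *)
Lemma measurable_Rintegral2 F : measurable_fun setT F ->
  measurable_fun setT (fun x => \int[m2]_y F (x, y)).
Proof.
move=> mF; have mE : measurable_fun setT (EFin \o F) by exact/measurable_EFinP.
apply: measurableT_comp => //.
rewrite (_ : (fun x => _) = (fun x => \int[m2]_y (((EFin \o F)^\+)%E (x, y)) -
   \int[m2]_y (((EFin \o F)^\-)%E (x, y)))%E); last first.
  by apply/funext => x; rewrite integralE; congr (_ - _)%E;
    apply: eq_integral => y _; rewrite !(funeposE,funenegE).
apply: emeasurable_funB.
- apply: (measurable_fun_fubini_tonelli_F ((EFin \o F)^\+)%E) => //.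
  exact: measurable_funepos.
- apply: (measurable_fun_fubini_tonelli_F ((EFin \o F)^\-)%E) => //.
  exact: measurable_funeneg.
Qed.

Lemma measurable_Rintegral1 F : measurable_fun setT F ->
  measurable_fun setT (fun y => \int[m1]_x F (x, y)).
Proof.
move=> mF; have mE : measurable_fun setT (EFin \o F) by exact/measurable_EFinP.
apply: measurableT_comp => //.
rewrite (_ : (fun y => _) = (fun y => \int[m1]_x (((EFin \o F)^\+)%E (x, y)) -
   \int[m1]_x (((EFin \o F)^\-)%E (x, y)))%E); last first.
  by apply/funext => x; rewrite integralE; congr (_ - _)%E;
    apply: eq_integral => y _; rewrite !(funeposE,funenegE).
apply: emeasurable_funB.
- apply: (measurable_fun_fubini_tonelli_G ((EFin \o F)^\+)%E) => //.
  exact: measurable_funepos.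
- apply: (measurable_fun_fubini_tonelli_G ((EFin \o F)^\-)%E) => //.
  exact: measurable_funeneg.
Qed.

Lemma integrable_prodl F (g : T1 -> R) : measurable_fun setT F ->
  m1.-integrable setT (EFin \o g) ->
  (forall x, (\int[m2]_y `|F (x, y)|%:E <= (g x)%:E)%E) ->
  (m1 \x m2)%E.-integrable setT (EFin \o F).
Proof.
move=> mF ig Fg; apply/integrable12ltyP; first exact/measurable_EFinP.
have [mg gy] := integrableP _ _ _ ig.
apply: le_lt_trans gy; apply: ge0_le_integral => //.
- by move=> x _; exact: integral_ge0.
- apply: (measurable_fun_fubini_tonelli_F (fun z => `|(F z)%:E|%E)) => //.
  by apply: measurableT_comp => //; exact/measurable_EFinP.
- exact: measurableT_comp.
- by move=> x _; apply: le_trans (Fg x) _; rewrite lee_fin ler_norm.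
Qed.

(** Sections are integrable only almost everywhere. Elsewhere the real integral takes the default
    value of [fine], so it is first identified with [fubini_F] outside a null set. *)
Lemma integrable_Rintegral2 F : (m1 \x m2)%E.-integrable setT (EFin \o F) ->
  m1.-integrable setT (EFin \o (fun x => \int[m2]_y F (x, y))) /\
  \int[m1]_x (\int[m2]_y F (x, y)) = \int[(m1 \x m2)%E]_z F z.
Proof.
move=> iF; have mF : measurable_fun setT F.
  by apply/measurable_EFinP; exact: measurable_int iF.
have jF := integrable_fubini_F iF.
have ae : ae_eq m1 setT (fubini_F m2 (EFin \o F))
    (EFin \o (fun x => \int[m2]_y F (x, y))).
  apply: filterS (ae_integrable1 iF) => x jx _.
  by rewrite /fubini_F/= /Rintegral fineK//; apply: integrable_fin_num.
have mI : measurable_fun setT (EFin \o (fun x => \int[m2]_y F (x, y))).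
  by apply/measurable_EFinP; exact: measurable_Rintegral2.
split; last first.
  rewrite [LHS]/Rintegral -(ae_eq_integral _ _ measurableT _ _ ae)//.
    by rewrite /fubini_F integral12_prod_meas1.
  exact: measurable_int jF.
apply/integrableP; split=> //.
rewrite (ae_eq_integral (abse \o fubini_F m2 (EFin \o F)))//.
- by have [] := integrableP _ _ _ jF.
- exact: measurableT_comp.
- by apply: measurableT_comp => //; exact: measurable_int jF.
- by apply: filterS ae => x + _ => /(_ I) /= ->.
Qed.

Lemma integrable_Rintegral1 F : (m1 \x m2)%E.-integrable setT (EFin \o F) ->
  m2.-integrable setT (EFin \o (fun y => \int[m1]_x F (x, y))) /\
  \int[m2]_y (\int[m1]_x F (x, y)) = \int[(m1 \x m2)%E]_z F z.
Proof.
move=> iF; have mF : measurable_fun setT F.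
  by apply/measurable_EFinP; exact: measurable_int iF.
have mEF : measurable_fun setT (EFin \o F) by exact/measurable_EFinP.
have mG : measurable_fun setT (fubini_G m1 (EFin \o F)) by exact: (measurable_fubini_G iF).
have jF : m2.-integrable setT (fubini_G m1 (EFin \o F)).
  apply/integrableP; split => //.
  apply: le_lt_trans ((integrable21ltyP m1 m2 mEF).1 iF).
  apply: ge0_le_integral => //.
  - exact: measurableT_comp.
  - apply: (measurable_fun_fubini_tonelli_G (fun z => `|(F z)%:E|%E)) => //.
    exact: measurableT_comp.
  - move=> y _; apply: le_abse_integral => //.
    by apply: (measurableT_comp mEF); exact: measurable_pair2.
have ae : ae_eq m2 setT (fubini_G m1 (EFin \o F))
    (EFin \o (fun y => \int[m1]_x F (x, y))).
  apply: filterS (ae_integrable2 iF) => x jx _.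
  by rewrite /fubini_G/= /Rintegral fineK//; apply: integrable_fin_num.
have mI : measurable_fun setT (EFin \o (fun y => \int[m1]_x F (x, y))).
  by apply/measurable_EFinP; exact: measurable_Rintegral1.
split; last first.
  rewrite [LHS]/Rintegral -(ae_eq_integral _ _ measurableT _ _ ae)//.
  by rewrite /fubini_G integral21_prod_meas1.
apply/integrableP; split=> //.
rewrite (ae_eq_integral (abse \o fubini_G m1 (EFin \o F)))//.
- by have [] := integrableP _ _ _ jF.
- exact: measurableT_comp.
- exact: measurableT_comp.
- by apply: filterS ae => x + _ => /(_ I) /= ->.
Qed.

Lemma Rfubini F : (m1 \x m2)%E.-integrable setT (EFin \o F) ->
  \int[m1]_x (\int[m2]_y F (x, y)) = \int[m2]_y (\int[m1]_x F (x, y)).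
Proof.
move=> iF; rewrite (proj2 (integrable_Rintegral2 iF)).
by rewrite (proj2 (integrable_Rintegral1 iF)).
Qed.

End real_fubini.

(** * The Euclidean inner product and norm on row vectors *)

Section euclidean.
Context {R : realType} {n : nat}.
Implicit Types x y z : 'rV[R]_n.

Lemma edotC x y : edot x y = edot y x.
Proof. by apply: eq_bigr => i _; rewrite mulrC. Qed.

Lemma edotDl x y z : edot (x + y) z = edot x z + edot y z.
Proof. by rewrite -big_split; apply: eq_bigr => i _; rewrite mxE mulrDl. Qed.

Lemma edotDr x y z : edot z (x + y) = edot z x + edot z y.
Proof. by rewrite edotC edotDl !(edotC z). Qed.

Lemma edotZl a x y : edot (a *: x) y = a * edot x y.
Proof. by rewrite mulr_sumr; apply: eq_bigr => i _; rewrite mxE mulrA. Qed.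

Lemma edotZr a x y : edot x (a *: y) = a * edot x y.
Proof. by rewrite edotC edotZl edotC. Qed.

Lemma edotNl x y : edot (- x) y = - edot x y.
Proof. by rewrite -scaleN1r edotZl mulN1r. Qed.

Lemma edotNr x y : edot x (- y) = - edot x y.
Proof. by rewrite edotC edotNl edotC. Qed.

Lemma edot0l y : edot 0 y = 0.
Proof. by rewrite -(scale0r 0) edotZl mul0r. Qed.

Lemma edot_ge0 x : 0 <= edot x x.
Proof. by apply: sumr_ge0 => i _; rewrite -expr2 sqr_ge0. Qed.

Lemma enorm_ge0 x : 0 <= enorm x.
Proof. exact: sqrtr_ge0. Qed.

Lemma sqr_enorm x : enorm x ^+ 2 = edot x x.
Proof. by rewrite sqr_sqrtr// edot_ge0. Qed.

Lemma enormZ a x : enorm (a *: x) = `|a| * enorm x.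
Proof. by rewrite /enorm edotZl edotZr mulrA -expr2 sqrtrM ?sqr_ge0// sqrtr_sqr. Qed.

Lemma enormN x : enorm (- x) = enorm x.
Proof. by rewrite /enorm edotNl edotNr opprK. Qed.

Lemma enorm0 : enorm (0 : 'rV[R]_n) = 0.
Proof. by rewrite /enorm edot0l sqrtr0. Qed.

Lemma normr_coord_le_enorm x i : `|x ord0 i| <= enorm x.
Proof.
rewrite -sqrtr_sqr ler_wsqrtr// /edot (bigD1 i)//= expr2 lerDl.
by apply: sumr_ge0 => j _; rewrite -expr2 sqr_ge0.
Qed.

Lemma enorm_eq0 x : enorm x = 0 -> x = 0.
Proof.
move=> x0; apply/rowP => i; rewrite mxE; apply/eqP.
by rewrite -normr_eq0 eq_le normr_ge0 andbT -x0 normr_coord_le_enorm.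
Qed.

Lemma enorm_gt0 x : x != 0 -> 0 < enorm x.
Proof.
move=> x0; rewrite lt_neqAle enorm_ge0 andbT eq_sym.
by apply: contra x0 => /eqP/enorm_eq0 ->.
Qed.

(** Cauchy-Schwarz, from the nonnegative square of [enorm y *: x - enorm x *: y], which equals 2 |x|
    |y| (|x| |y| - x.y). *)
Lemma edot_le x y : edot x y <= enorm x * enorm y.
Proof.
have [->|/enorm_gt0 x0] := eqVneq x 0; first by rewrite edot0l enorm0 mul0r.
have [->|/enorm_gt0 y0] := eqVneq y 0; first by rewrite edotC edot0l enorm0 mulr0.
have := edot_ge0 (enorm y *: x - enorm x *: y).
rewrite edotDl !edotDr !edotNl !edotNr !edotZl !edotZr opprK -!sqr_enorm.
rewrite (edotC y x) => h.
have : 0 <= (enorm x * enorm y) * (enorm x * enorm y - edot x y) by nra.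
by rewrite pmulr_rge0 ?mulr_gt0// subr_ge0.
Qed.

Lemma normr_edot_le x y : `|edot x y| <= enorm x * enorm y.
Proof.
by rewrite ler_norml edot_le andbT lerNl -edotNl (le_trans (edot_le _ _))// enormN.
Qed.

(** Duality, with the unit vector x / |x| as witness. It yields the triangle inequality here and,
    later, the bound on vector-valued averages. *)
Lemma enorm_le_dot x (M : R) : 0 <= M ->
  (forall e, enorm e <= 1 -> edot e x <= M) -> enorm x <= M.
Proof.
move=> M0 h; have [->|x0] := eqVneq x 0; first by rewrite enorm0.
have e0 := enorm_gt0 x0.
have := h ((enorm x)^-1 *: x).
rewrite edotZl -sqr_enorm enormZ gtr0_norm ?invr_gt0// mulVf ?gt_eqF// lexx.
by rewrite expr2 mulrA mulVf ?gt_eqF// mul1r; apply.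
Qed.

Lemma enormD x y : enorm (x + y) <= enorm x + enorm y.
Proof.
apply: enorm_le_dot; first by rewrite addr_ge0 ?enorm_ge0.
move=> e e1; rewrite edotDr lerD//.
  by rewrite (le_trans (edot_le _ _))// ler_piMl// enorm_ge0.
by rewrite (le_trans (edot_le _ _))// ler_piMl// enorm_ge0.
Qed.

Lemma enorm_sum (I : Type) (s : seq I) (P : pred I) (F : I -> 'rV[R]_n) :
  enorm (\sum_(i <- s | P i) F i) <= \sum_(i <- s | P i) enorm (F i).
Proof.
elim/big_ind2 : _ => //; first by rewrite enorm0.
by move=> x a y b xa yb; rewrite (le_trans (enormD _ _))// lerD.
Qed.

Lemma enorm_le_sum x : enorm x <= \sum_i `|x ord0 i|.
Proof.
rewrite {1}[x]row_sum_delta (le_trans (enorm_sum _ _ _))//.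
apply: ler_sum => i _; rewrite enormZ -[leRHS]mulr1 ler_wpM2l//.
rewrite /enorm -sqrtr1 ler_wsqrtr// /edot (bigD1 i)//= big1 ?addr0.
  by rewrite mxE !eqxx mul1r.
by move=> j ji; rewrite mxE (negbTE ji) andbF mul0r.
Qed.

Lemma enorm_le_norm x : enorm x <= n%:R * `|x|.
Proof.
apply: le_trans (enorm_le_sum _) _.
rewrite (le_trans (ler_sum _ (G := fun=> `|x|) _))//.
  by move=> i _; rewrite [`|x|]mx_normrE (le_trans _ (le_bigmax _ _ (ord0, i))).
by rewrite sumr_const card_ord mulr_natl.
Qed.

Lemma norm_le_enorm x : `|x| <= enorm x.
Proof.
rewrite [`|x|]mx_normrE bigmax_le ?enorm_ge0// => -[i j] _ /=.
by rewrite ord1 normr_coord_le_enorm.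
Qed.

Lemma measurable_edot d (T : measurableType d) (g1 g2 : T -> 'rV[R]_n) :
  measurable_fun setT g1 -> measurable_fun setT g2 ->
  measurable_fun setT (fun t => edot (g1 t) (g2 t)).
Proof.
move=> m1 m2; apply: measurable_sum => i.
by apply: measurable_funM; apply: (measurableT_comp (measurable_coord i)).
Qed.

Lemma measurable_enorm d (T : measurableType d) (g : T -> 'rV[R]_n) :
  measurable_fun setT g -> measurable_fun setT (fun t => enorm (g t)).
Proof.
move=> m1; rewrite (_ : (fun t => _) = fun t => edot (g t) (g t) `^ 2^-1).
  apply: (measurableT_comp (measurable_powR _)).
  exact: measurable_edot.
by apply/funext => t; rewrite powR12_sqrt// edot_ge0.
Qed.

End euclidean.

(** * The substitution x -> 1/x on the positive half-line *)

Lemma near_neq0 (R : realType) (x : R) : x != 0 -> \forall y \near x, y != 0.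
Proof.
move=> x0; have : open_nbhs x [set y : R | y != 0] by split => //; exact: open_neq.
by move=> /open_nbhs_nbhs.
Qed.
Lemma is_derive_inv (R : realType) (x : R) : x != 0 ->
  is_derive x 1 (@GRing.inv R) (- x ^- 2).
Proof.
move=> x0.
by have := @is_deriveV R id x 1 1 x0 (is_derive_id _ _); rewrite [_%:A]mulr1.
Qed.
Lemma derive1_inv (R : realType) (x : R) : x != 0 ->
  derive1 (@GRing.inv R) x = - x ^- 2.
Proof. by move=> x0; rewrite derive1E; have /@derive_val -> := is_derive_inv x0. Qed.
Lemma continuous_derive1_inv (R : realType) (x : R) : x != 0 ->
  {for x, continuous (derive1 (@GRing.inv R))}.
Proof.
move=> x0.
have c : {for x, continuous (fun y : R => - y ^- 2)}.
  apply: continuousN; apply: continuousV; first by rewrite expf_neq0.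
  exact: exprn_continuous.
have e : \forall y \near x, - y ^- 2 = derive1 (@GRing.inv R) y.
  by apply: filterS (near_neq0 x0) => y y0; rewrite derive1_inv.
have : derive1 (@GRing.inv R) y @[y --> x] --> - x ^- 2.
 apply: cvg_trans c. exact: (near_eq_cvg e).
by rewrite -(derive1_inv x0).
Qed.

Section inversion.
Context {R : realType}.

(** Writing 1/x = x (x^2)^(-1) brings the claim back to [powR]; both sides are 0 at x = 0. *)
Lemma measurable_inv : measurable_fun [set: R] (fun x : R => x^-1).
Proof.
rewrite (_ : (fun x => _) = fun x : R => x * (x ^+ 2) `^ (-1)).
  apply: measurable_funM => //.
  by apply: (measurableT_comp (measurable_powR _)); exact: measurable_funX.
apply/funext => x; rewrite powR_inv1 ?sqr_ge0//.
have [->|x0] := eqVneq x 0; first by rewrite invr0 mul0r.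
by rewrite expr2 invfM mulrA mulfV// mul1r.
Qed.

Lemma measurable_funV d (T : measurableType d) (g : T -> R) :
  measurable_fun setT g -> measurable_fun setT (fun x => (g x)^-1).
Proof. by move=> mg; exact: (measurableT_comp measurable_inv). Qed.

Let inv_itv (k : nat) : set R := `[(k.+1%:R)^-1, k.+1%:R]%classic.

Let bigcup_inv_itv : \bigcup_k inv_itv k = `]0, +oo[%classic.
Proof.
apply/seteqP; split => [x [k _] /=|x /=]; rewrite /inv_itv/= !in_itv/= ?andbT.
  by move=> /andP[+ _]; apply: lt_le_trans; rewrite invr_gt0.
move=> x0; exists (maxn (Num.truncn x) (Num.truncn x^-1)) => //=; rewrite in_itv/=.
apply/andP; split.
  rewrite -[leRHS]invrK lef_pV2 ?posrE ?invr_gt0//.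
  apply/ltW/(lt_le_trans (Num.Theory.truncnS_gt _)).
  by rewrite ler_nat ltnS leq_maxr.
apply/ltW/(lt_le_trans (Num.Theory.truncnS_gt _)).
by rewrite ler_nat ltnS leq_maxl.
Qed.

Let inv_itv_nd : nondecreasing_seq inv_itv.
Proof.
apply/nondecreasing_seqP => k; apply/subsetPset => x; rewrite /inv_itv/= !in_itv/=.
move=> /andP[a b]; apply/andP; split.
  apply: le_trans a; rewrite lef_pV2 ?posrE// ler_nat//.
by apply: (le_trans b); rewrite ler_nat.
Qed.

Let ge0_itvy (G : R -> R) : (forall x : R, 0 < x -> {for x, continuous G}) ->
  (forall x : R, 0 < x -> 0 <= G x) ->
  ((\int[lebesgue_measure]_(x in inv_itv k) (G x)%:E) @[k --> \oo] -->
   \int[lebesgue_measure]_(x in `]0%R, +oo[) (G x)%:E)%E.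
Proof.
move=> cG G0; rewrite -bigcup_inv_itv.
apply: ge0_nondecreasing_set_cvg_integral => //.
- move=> k; exact: measurable_itv.
- move=> k; apply/measurable_EFinP.
  apply: (@measurable_funS _ _ _ _ (`]0, +oo[%classic : set (measurableTypeR R))) => //.
    by rewrite -bigcup_inv_itv; exact: bigcup_sup.
  apply: open_continuous_measurable_fun; first exact: interval_open.
  by move=> x; rewrite inE/= in_itv/= andbT => /cG.
- move=> k x kx; rewrite lee_fin G0//.
  have : (\bigcup_k inv_itv k) x by exists k.
  by rewrite bigcup_inv_itv/= in_itv/= andbT.
Qed.

(** The intervals [1/(k+1), k+1] exhaust the half-line and are mapped onto themselves by inversion.
    The decreasing change of variables applies on each of them, and monotone convergence passes to
    the limit on both sides. *)
Lemma ge0_integral_inv (G : R -> R) : (forall x : R, 0 < x -> {for x, continuous G}) ->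
  (forall x : R, 0 < x -> 0 <= G x) ->
  (\int[lebesgue_measure]_(x in `]0%R, +oo[) (G x)%:E =
   \int[lebesgue_measure]_(x in `]0%R, +oo[) (G x^-1 * x ^- 2)%:E)%E.
Proof.
move=> cG G0.
have H1 := ge0_itvy cG G0.
have H2 : ((\int[lebesgue_measure]_(x in inv_itv k) (G x^-1 * x ^- 2)%:E)
   @[k --> \oo] -->
   \int[lebesgue_measure]_(x in `]0%R, +oo[) (G x^-1 * x ^- 2)%:E)%E.
  apply: (@ge0_itvy (fun x => G x^-1 * x ^- 2)) => x x0; last first.
    by rewrite mulr_ge0// ?G0 ?invr_gt0// invr_ge0 exprn_ge0// ltW.
  have xn0 : x != 0 by rewrite gt_eqF.
  apply: continuousM.
    apply: continuous_comp; first exact: inv_continuous.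
    by apply: cG; rewrite invr_gt0.
  apply: continuousV; first by rewrite expf_neq0.
  exact: exprn_continuous.
apply: (cvg_unique _ H1); first exact: ereal_hausdorff.
apply: cvg_trans H2; apply: near_eq_cvg; near=> k.
have k0 : (0 : R) < k.+1%:R by [].
have kV0 : (0 : R) < k.+1%:R^-1 by rewrite invr_gt0.
have kk : k.+1%:R^-1 <= k.+1%:R :> R.
  by rewrite (@le_trans _ _ 1)// ?invf_le1// ler1n.
rewrite /inv_itv; have := @integration_by_substitution_decreasing _
  (@GRing.inv R) G k.+1%:R^-1 k.+1%:R kk.
rewrite invrK => E; rewrite /inv_itv; apply: etrans (esym (E _ _ _ _ _ _)).
- apply: eq_integral => x; rewrite inE/= in_itv/= => /andP[kx _].
  have x0 : x != 0 by rewrite gt_eqF// (lt_le_trans kV0).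
  by rewrite !fctE derive1_inv// opprK.
- move=> x y; rewrite !in_itv/= => /andP[x0 _] /andP[y0 _] xy.
  by rewrite ltf_pV2 ?posrE// (lt_le_trans kV0).
- move=> x; rewrite in_itv/= => /andP[x0 _].
  by apply: continuous_derive1_inv; rewrite gt_eqF// (lt_trans kV0).
- apply: cvgP; apply: cvg_at_right_filter; apply: continuous_derive1_inv.
  by rewrite gt_eqF.
- apply: cvgP; apply: cvg_at_left_filter; apply: continuous_derive1_inv.
  by rewrite gt_eqF.
- split.
  + move=> x; rewrite in_itv/= => /andP[x0 _].
    by apply: ex_derive; apply: is_derive_inv; rewrite gt_eqF// (lt_trans kV0).
  + apply: cvg_at_right_filter; apply: inv_continuous.
    by rewrite gt_eqF.
  + apply: cvg_at_left_filter; apply: inv_continuous.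
    by rewrite gt_eqF.
- apply: continuous_in_subspaceT => x; rewrite inE/= in_itv/= => /andP[x0 _].
  by apply: cG; rewrite (lt_le_trans kV0).
Unshelve. all: by end_near. Qed.

End inversion.

(** * The heat kernel *)

HB.lock Definition heat (R : realType) (n : nat) (t : R) (z : 'rV[R]_n) : R :=
  (4 * pi * t) `^ (- (n%:R / 2)) * expR (- (edot z z / (4 * t))).

Section heat_kernel.
Context {R : realType}.

Lemma heat_ge0 n t (z : 'rV[R]_n) : 0 <= heat t z.
Proof. by rewrite heat.unlock mulr_ge0 ?powR_ge0 ?expR_ge0. Qed.

Lemma heatN n t (z : 'rV[R]_n) : heat t (- z) = heat t z.
Proof. by rewrite heat.unlock edotNl edotNr opprK. Qed.

Lemma measurable_heat n d (T : measurableType d) (g1 : T -> R)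
    (g2 : T -> 'rV[R]_n) :
  measurable_fun setT g1 -> measurable_fun setT g2 ->
  measurable_fun setT (fun x => heat (g1 x) (g2 x)).
Proof.
move=> m1 m2; rewrite heat.unlock; apply: measurable_funM.
  by apply: (measurableT_comp (measurable_powR _)); exact: measurable_funM.
apply: measurableT_comp => //; apply: measurable_funN; apply: measurable_funM.
  exact: measurable_edot.
by apply: measurable_funV; exact: measurable_funM.
Qed.

Let edot_cons n (a b : R) (u v : 'rV[R]_n) :
  edot (cons_rV (a, u)) (cons_rV (b, v)) = a * b + edot u v.
Proof.
rewrite /edot big_ord_recl !cons_rV0; congr (_ + _).
by apply: eq_bigr => i _; rewrite !cons_rVS.
Qed.

Let heat1 (t a : R) : R := (4 * pi * t) `^ (- (1 / 2)) * expR (- (a * a / (4 * t))).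

Let heat_cons n t a (u : 'rV[R]_n) : 0 < t ->
  heat t (cons_rV (a, u)) = heat1 t a * heat t u.
Proof.
move=> t0; rewrite heat.unlock /heat1 edot_cons mulrACA -expRD -powRD; last first.
  have X : 4 * pi * t != 0 by rewrite gt_eqF// !mulr_gt0// pi_gt0.
  by rewrite X implybT.
congr (_ `^ _ * expR _); last by rewrite mulrDl opprD.
by rewrite -natr1; field.
Qed.

Let integral_heat1 t : 0 < t ->
  (\int[lebesgue_measure]_a (heat1 t a)%:E = 1)%E.
Proof.
move=> t0; have c0 : 0 < (2 * Num.sqrt t)^-1.
  by rewrite invr_gt0 mulr_gt0// sqrtr_gt0.
have s2 : Num.sqrt t ^+ 2 = t by rewrite sqr_sqrtr// ltW.
have sn : Num.sqrt t != 0 by rewrite gt_eqF// sqrtr_gt0.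
transitivity (\int[lebesgue_measure]_a (((4 * pi * t) `^ (- (1 / 2)))%:E *
    (gauss_fun ((2 * Num.sqrt t)^-1 * a))%:E)%E)%E.
  apply: eq_integral => a _; rewrite -EFinM; congr (_ * expR _)%:E.
  congr (- _); rewrite -{1}s2; by field.
have mg : measurable_fun [set: R] (fun x : R => (gauss_fun x)%:E).
  by apply/measurable_EFinP; exact: measurable_gauss_fun.
rewrite ge0_integralZl_EFin ?powR_ge0//; last 2 first.
- by move=> x _; rewrite lee_fin gauss_fun_ge0.
- apply/measurable_EFinP; apply: (measurableT_comp measurable_gauss_fun).
  exact: measurable_funM.
rewrite (@ge0_integral_scale _ _ (fun x => (gauss_fun x)%:E))//; last first.
  by move=> x; rewrite lee_fin gauss_fun_ge0.
rewrite integralT_gauss invrK -!EFinM mul1r powRN powR12_sqrt; last first.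
  by rewrite !mulr_ge0// ?pi_ge0// ltW.
congr EFin.
have -> : Num.sqrt (4 * pi * t) = 2 * Num.sqrt t * Num.sqrt (pi : R).
  rewrite (_ : 4 * pi * t = (2 ^+ 2 * t) * pi); last by ring.
  rewrite sqrtrM; last by rewrite mulr_ge0// ltW.
  by rewrite sqrtrM ?sqr_ge0// sqrtr_sqr ger0_norm.
by rewrite mulVf// !mulf_neq0// gt_eqF// sqrtr_gt0// pi_gt0.
Qed.

(** The kernel factors over coordinates, so induction on the dimension reduces the claim to the
    Gaussian integral. In dimension 0 the kernel is 1 and the measure is a Dirac mass. *)
Lemma integral_heat n t : 0 < t ->
  (\int[@lebesgue_rV R n]_z (heat t z)%:E = 1)%E.
Proof.
move=> t0; elim: n => [|n IHn].
  under eq_integral do rewrite heat.unlock mul0r oppr0 powRr0 /edot big_ord0 mul0r oppr0 expR0 mulr1.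
  by rewrite integral_cst//= diracT mule1.
have mh k : measurable_fun [set: 'rV[R]_k] (fun z => (heat t z)%:E).
  by apply/measurable_EFinP; exact: measurable_heat.
rewrite ge0_integral_lebS//; last by move=> x; rewrite lee_fin heat_ge0.
under eq_integral => a _.
  under eq_integral => u _ do rewrite heat_cons// EFinM.
  rewrite ge0_integralZl_EFin//; last 2 first.
  - by move=> u _; rewrite lee_fin heat_ge0.
  - by rewrite mulr_ge0 ?powR_ge0 ?expR_ge0.
  rewrite IHn mule1; over.
exact: integral_heat1.
Qed.

Section fixed_dim.
Context {n : nat}.
Local Notation leb := (@lebesgue_rV R n).
Implicit Types z w : 'rV[R]_n.

Lemma integrable_heat t : 0 < t -> leb.-integrable setT (EFin \o @heat R n t).
Proof.
move=> t0; apply/integrableP; split.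
  by apply/measurable_EFinP; exact: measurable_heat.
under eq_integral => z _ do rewrite /= ger0_norm ?heat_ge0//.
by rewrite integral_heat// ltry.
Qed.

Lemma Rintegral_heat t : 0 < t -> \int[leb]_z heat t z = 1.
Proof. by move=> t0; rewrite /Rintegral integral_heat. Qed.

(* completing the square *)
Lemma heat_mul (t r : R) z w : 0 < t -> 0 < r ->
  heat r (w - z) * heat t z =
  heat (t + r) w * heat (t * r / (t + r)) (z - (t / (t + r)) *: w).
Proof.
move=> t0 r0; have tr0 : 0 < t + r by rewrite addr_gt0.
have p0 : 0 < pi :> R by exact: pi_gt0.
rewrite heat.unlock mulrACA [RHS]mulrACA -!expRD; congr (_ * expR _).
  rewrite -!powRM; try by rewrite !mulr_ge0 ?invr_ge0// ltW// ?divr_gt0// ?mulr_gt0.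
  congr (_ `^ _); field; exact: lt0r_neq0.
rewrite !(edotDl, edotDr, edotNl, edotNr, edotZl, edotZr) (edotC w z).
field; rewrite !lt0r_neq0//.
Qed.

(** Doubling the time leaves a spare factor exp(|z|^2 / (8t)), which absorbs powers of |z| in the
    two moment bounds below. *)
Lemma heat_double t z : 0 < t ->
  heat (2 * t) z = 2 `^ (- (n%:R / 2)) * heat t z * expR (edot z z / (8 * t)).
Proof.
move=> t0; rewrite heat.unlock (_ : 4 * pi * (2 * t) = 2 * (4 * pi * t)); last by ring.
rewrite powRM//; last by rewrite !mulr_ge0 ?pi_ge0// ltW.
rewrite -!mulrA -expRD; congr (_ * (_ * expR _)).
by field; rewrite lt0r_neq0.
Qed.

Lemma enorm2_heat t z : 0 < t ->
  enorm z ^+ 2 * heat t z <= 8 * t * 2 `^ (n%:R / 2) * heat (2 * t) z.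
Proof.
move=> t0; rewrite heat_double// [leLHS]mulrC.
rewrite [X in _ <= X](_ : _ = heat t z * (8 * t * expR (edot z z / (8 * t)))).
  rewrite ler_wpM2l ?heat_ge0// sqr_enorm.
  rewrite -ler_pdivrMl ?mulr_gt0// mulrC.
  by apply: le_trans (expR_ge1Dx _); rewrite lerDr.
by rewrite powRN; field; rewrite gt_eqF// powR_gt0.
Qed.

Lemma enorm_heat t z : 0 < t ->
  enorm z * heat t z <= Num.sqrt (8 * t) * 2 `^ (n%:R / 2) * heat (2 * t) z.
Proof.
move=> t0; rewrite heat_double// [leLHS]mulrC.
rewrite [X in _ <= X](_ : _ =
  heat t z * (Num.sqrt (8 * t) * expR (edot z z / (8 * t)))).
  rewrite ler_wpM2l ?heat_ge0//.
  have s0 : 0 < Num.sqrt (8 * t) by rewrite sqrtr_gt0 mulr_gt0.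
  rewrite -ler_pdivrMl// mulrC; apply: le_trans (expR_ge1Dx _).
  (* The goal becomes u <= 1 + u^2 for u = |z| / sqrt (8t). *)
  have -> : edot z z / (8 * t) = (enorm z / Num.sqrt (8 * t)) ^+ 2.
    by rewrite expr_div_n sqr_enorm sqr_sqrtr// mulr_ge0// ltW.
  by set u := _ / _; nra.
by rewrite powRN; field; rewrite gt_eqF// powR_gt0.
Qed.

End fixed_dim.
End heat_kernel.

(** The constant of [enorm_heat] once sqrt t is taken out. *)
HB.lock Definition heat_cst (R : realType) (n : nat) : R :=
  Num.sqrt 8 * 2 `^ (n%:R / 2).

Lemma heat_cst_ge0 (R : realType) n : 0 <= heat_cst R n.
Proof. by rewrite heat_cst.unlock mulr_ge0 ?sqrtr_ge0 ?powR_ge0. Qed.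

Section heat_divergence.
Context {R : realType} {n : nat}.
Local Notation leb := (@lebesgue_rV R n).
Local Notation Rn := 'rV[R]_n.
Local Notation heat_cst := (heat_cst R n).

Lemma Rintegral_odd (h : Rn -> R) : leb.-integrable setT (EFin \o h) ->
  (forall z, h (- z) = - h z) -> \int[leb]_z h z = 0.
Proof.
move=> ih hN.
have mh : measurable_fun setT h.
  by apply/measurable_EFinP; exact: measurable_int ih.
have := Rintegral_lebN mh.
under eq_Rintegral do rewrite hN -mulN1r.
by rewrite RintegralZ// => e; lra.
Qed.

Lemma enorm_heat_le (t : R) (z : Rn) : 0 < t ->
  enorm z * heat t z <= heat_cst * Num.sqrt t * heat (2 * t) z.
Proof.
move=> t0; apply: le_trans (enorm_heat _ t0) _.
by rewrite sqrtrM// heat_cst.unlock [_ * _ * 2 `^ _]mulrAC.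
Qed.

Lemma integrable_cst_heat (c t : R) : 0 < t ->
  leb.-integrable setT (EFin \o (fun z => c * heat t z)).
Proof. by move=> t0; apply: integrable_Zl; exact: integrable_heat. Qed.

Lemma Rintegral_cst_heat (c t : R) : 0 < t -> \int[leb]_z (c * heat t z) = c.
Proof.
by move=> t0; rewrite RintegralZ ?Rintegral_heat ?mulr1//; exact: integrable_heat.
Qed.

Lemma integrable_edot_heat (t M : R) (g : Rn -> Rn) : 0 < t ->
  measurable_fun setT g -> (forall x, enorm (g x) <= M) ->
  leb.-integrable setT (EFin \o (fun z => edot z (g z) * heat t z)) /\
  `|\int[leb]_z (edot z (g z) * heat t z)| <= M * heat_cst * Num.sqrt t.
Proof.
move=> t0 mg gM.
have M0 : 0 <= M by apply: le_trans (gM 0); exact: enorm_ge0.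
have mF : measurable_fun setT (fun z => edot z (g z) * heat t z).
  by apply: measurable_funM; [exact: measurable_edot|exact: measurable_heat].
have le z : `|edot z (g z) * heat t z| <=
    M * heat_cst * Num.sqrt t * heat (2 * t) z.
  rewrite normrM [X in _ * X]ger0_norm ?heat_ge0//.
  apply: (@le_trans _ _ (M * (enorm z * heat t z))).
    rewrite mulrA ler_wpM2r ?heat_ge0//.
    by rewrite (le_trans (normr_edot_le _ _))// mulrC ler_wpM2r ?enorm_ge0.
  rewrite -!mulrA ler_wpM2l// !mulrA. by rewrite enorm_heat_le.
have t20 : 0 < 2 * t by rewrite mulr_gt0.
have i2 := integrable_cst_heat (M * heat_cst * Num.sqrt t) t20.
split; first exact: integrable_le mF i2 le.
by rewrite -[leRHS](Rintegral_cst_heat _ t20); exact: Rintegral_le_bound.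
Qed.

Lemma Rintegral_edot_heat0 (t : R) (v : Rn) : 0 < t ->
  \int[leb]_z (edot z v * heat t z) = 0.
Proof.
move=> t0; apply: Rintegral_odd => [|z].
  by have [] := integrable_edot_heat t0 (@measurable_cst _ _ _ _ _ v) (fun=> lexx (enorm v)).
by rewrite edotNl heatN mulNr.
Qed.

(* the divergence of the heat flow of phi: the derivatives are moved to the kernel *)
Definition heat_div (phi : Rn -> Rn) (t : R) (x : Rn) : R :=
  (2 * t)^-1 * \int[leb]_z (edot z (phi (x + z)) * heat t z).

Lemma measurable_heat_div (phi : Rn -> Rn) d (T : measurableType d)
    (g1 : T -> R) (g2 : T -> Rn) : measurable_fun setT phi ->
  measurable_fun setT g1 -> measurable_fun setT g2 ->
  measurable_fun setT (fun u => heat_div phi (g1 u) (g2 u)).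
Proof.
move=> mphi m1 m2; apply: measurable_funM.
  by apply: measurable_funV; exact: measurable_funM.
apply: (measurable_Rintegral2 leb
  (F := fun p : T * Rn => edot p.2 (phi (g2 p.1 + p.2)) * heat (g1 p.1) p.2)).
apply: measurable_funM.
  apply: measurable_edot => //; apply: (measurableT_comp mphi).
  by apply: measurable_rVD => //; exact: measurableT_comp.
by apply: measurable_heat => //; exact: measurableT_comp.
Qed.

Let mshift (phi : Rn -> Rn) (x : Rn) : measurable_fun setT phi ->
  measurable_fun setT (fun z : Rn => phi (x + z)).
Proof. by move=> mphi; apply: (measurableT_comp mphi); exact: measurable_rVD. Qed.

(** The first absolute moment of the kernel is O(sqrt t), and it is divided by 2t. Only the supremum
    of phi enters, which is what makes the final estimate uniform over test fields. *)
Lemma normr_heat_div (phi : Rn -> Rn) (M t : R) x : 0 < t ->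
  measurable_fun setT phi -> (forall x, enorm (phi x) <= M) ->
  `|heat_div phi t x| <= M * heat_cst * t `^ (- 2^-1).
Proof.
move=> t0 mphi phiM.
have M0 : 0 <= M by apply: le_trans (phiM 0); exact: enorm_ge0.
rewrite normrM gtr0_norm ?invr_gt0 ?mulr_gt0// mulrC ler_pdivrMr ?mulr_gt0//.
have [_ h] := integrable_edot_heat t0 (mshift x mphi) (fun z => phiM (x + z)).
apply: (le_trans h); rewrite -!mulrA !ler_wpM2l ?heat_cst_ge0//.
rewrite powRN (powR12_sqrt (ltW t0)) ler_pdivlMl ?sqrtr_gt0//.
by rewrite -expr2 sqr_sqrtr; [lra|exact: ltW].
Qed.

(** The kernel is even, so the constant [phi x] integrates to zero against z; subtracting it gains a
    factor |z| when phi is Lipschitz. *)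
Lemma heat_divE (phi : Rn -> Rn) (M t : R) x : 0 < t ->
  measurable_fun setT phi -> (forall x, enorm (phi x) <= M) ->
  heat_div phi t x =
  (2 * t)^-1 * \int[leb]_z (edot z (phi (x + z) - phi x) * heat t z).
Proof.
move=> t0 mphi phiM; congr (_ * _).
have [i1 _] := integrable_edot_heat t0 (mshift x mphi) (fun z => phiM (x + z)).
have [i2 _] := integrable_edot_heat t0 (@measurable_cst _ _ _ _ _ (- phi x)) (fun=> lexx (enorm (- phi x))).
under [RHS]eq_Rintegral do rewrite edotDr mulrDl.
by rewrite RintegralD// [X in _ + X]Rintegral_edot_heat0// addr0.
Qed.

(** Two bounds for two ranges of t. For small t the Lipschitz constant supplies a second factor |z|,
    and the second moment O(t) cancels 1/(2t); for large t the supremum of phi alone gives the decay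
    t^(-1/2). *)
Lemma integrable_edot_diff_heat (phi : Rn -> Rn) (M L t : R) x : 0 < t ->
  measurable_fun setT phi -> 0 <= L ->
  (forall x, enorm (phi x) <= M) ->
  (forall x y, enorm (phi y - phi x) <= L * enorm (y - x)) ->
  let F z := enorm z * enorm (phi (x + z) - phi x) * heat t z in
  [/\ leb.-integrable setT (EFin \o F),
    (2 * t)^-1 * \int[leb]_z F z <= 4 * L * 2 `^ (n%:R / 2) &
    (2 * t)^-1 * \int[leb]_z F z <= 2 * M * heat_cst * t `^ (- 2^-1)].
Proof.
move=> t0 mphi L0 phiM phiL F.
have M0 : 0 <= M by apply: le_trans (phiM 0); exact: enorm_ge0.
have t20 : 0 < 2 * t by rewrite mulr_gt0.
have mF : measurable_fun setT F.
  apply: measurable_funM; last exact: measurable_heat.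
  apply: measurable_funM; apply: measurable_enorm => //.
  by apply: measurable_rVD => //; exact: mshift.
have F0 z : 0 <= F z by rewrite !mulr_ge0 ?enorm_ge0 ?heat_ge0.
have le1 z : `|F z| <= 2 * M * heat_cst * Num.sqrt t * heat (2 * t) z.
  rewrite ger0_norm//.
  apply: (@le_trans _ _ (2 * M * (enorm z * heat t z))).
    rewrite mulrA ler_wpM2r ?heat_ge0// mulrC ler_wpM2r ?enorm_ge0//.
    by rewrite (le_trans (enormD _ _))// enormN mulr2n mulrDl mul1r lerD.
  by rewrite -!mulrA !ler_wpM2l// !mulrA enorm_heat_le.
have le2 z : `|F z| <= L * (8 * t * 2 `^ (n%:R / 2)) * heat (2 * t) z.
  rewrite ger0_norm//.
  apply: (@le_trans _ _ (L * (enorm z ^+ 2 * heat t z))).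
    rewrite /F mulrA ler_wpM2r ?heat_ge0// expr2 mulrCA ler_wpM2l ?enorm_ge0//.
    by rewrite (le_trans (phiL _ _))// addrAC subrr add0r.
  by rewrite -!mulrA ler_wpM2l// !mulrA enorm2_heat.
have i1 := integrable_cst_heat (2 * M * heat_cst * Num.sqrt t) t20.
have i2 := integrable_cst_heat (L * (8 * t * 2 `^ (n%:R / 2))) t20.
split; first exact: integrable_le mF i1 le1.
- rewrite mulrC ler_pdivrMr//.
  have := Rintegral_le_bound mF i2 le2.
  rewrite Rintegral_cst_heat// => /(le_trans (ler_norm _)) /le_trans; apply.
  by rewrite le_eqVlt; apply/orP; left; apply/eqP; ring.
- rewrite mulrC ler_pdivrMr//.
  have := Rintegral_le_bound mF i1 le1.
  rewrite Rintegral_cst_heat// => /(le_trans (ler_norm _)) /le_trans; apply.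
  rewrite -!mulrA !ler_wpM2l ?heat_cst_ge0//.
  rewrite powRN (powR12_sqrt (ltW t0)) ler_pdivlMl ?sqrtr_gt0//.
  by rewrite -expr2 sqr_sqrtr; [lra|exact: ltW].
Qed.

(** After Fubini the inner integral runs over the heat variable with z fixed. Completing the square
    turns it into a Gaussian centred at c z, with c = t / (t + r); the centred part is odd and
    vanishes, and the mean contributes c z.v, where c / (2t) = 1 / (2 (t + r)). *)
Lemma heat_div_semigroup (phi : Rn -> Rn) (M t r : R) x : 0 < t -> 0 < r ->
  measurable_fun setT phi -> (forall x, enorm (phi x) <= M) ->
  \int[leb]_w (heat r w * heat_div phi t (x + w)) = heat_div phi (t + r) x.
Proof.
move=> t0 r0 mphi phiM; have tr0 : 0 < t + r by rewrite addr_gt0.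
have M0 : 0 <= M by apply: le_trans (phiM 0); exact: enorm_ge0.
pose F (p : Rn * Rn) := (2 * t)^-1 *
  (heat r p.1 * (edot (p.2 - p.1) (phi (x + p.2)) * heat t (p.2 - p.1))).
have msub : measurable_fun setT (fun p : Rn * Rn => p.2 - p.1).
  by apply: measurable_rVD => //; exact: measurable_rVN.
have mF : measurable_fun setT F.
  apply: measurable_funM => //; apply: measurable_funM.
    exact: measurable_heat.
  apply: measurable_funM; last exact: measurable_heat.
  apply: measurable_edot => //; apply: (measurableT_comp mphi).
  exact: measurable_rVD.
pose C := (2 * t)^-1 * (M * heat_cst * Num.sqrt t).
have q0 : 0 < t * r / (t + r) by rewrite divr_gt0 ?mulr_gt0.
have t20 : 0 < 2 * t by rewrite mulr_gt0.
have iF : (leb \x leb)%E.-integrable setT (EFin \o F).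
  apply: (integrable_prodl mF (integrable_cst_heat C r0)) => w.
  have le z : `|F (w, z)| <= C * heat r w * heat (2 * t) (z - w).
    rewrite /F/= !normrM ![`|heat _ _|]ger0_norm ?heat_ge0//.
    rewrite [`|_^-1|]ger0_norm ?invr_ge0 ?(ltW t20)//.
    rewrite /C -!mulrA ler_wpM2l ?invr_ge0 ?(ltW t20)//.
    rewrite [leRHS](_ : _ = heat r w *
        (M * (heat_cst * Num.sqrt t * heat (2 * t) (z - w)))); last by ring.
    rewrite ler_wpM2l ?heat_ge0//.
    apply: (@le_trans _ _ (M * (enorm (z - w) * heat t (z - w)))).
      rewrite mulrA ler_wpM2r ?heat_ge0//.
      by rewrite (le_trans (normr_edot_le _ _))// mulrC ler_wpM2r ?enorm_ge0.
    by rewrite ler_wpM2l// enorm_heat_le.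
  have ih : leb.-integrable setT
      (EFin \o (fun z => C * heat r w * heat (2 * t) (z - w))).
    apply: integrable_Zl.
    exact: (integrable_lebD (- w) (integrable_heat t20)).
  apply: (@le_trans _ _ (\int[leb]_z (C * heat r w * heat (2 * t) (z - w))%:E)%E).
    apply: ge0_le_integral => //.
    - apply/measurable_EFinP; apply: measurableT_comp => //.
      by apply: (measurableT_comp mF); exact: measurable_pair1.
    - exact: measurable_int ih.
    - by move=> z _; rewrite lee_fin le.
  rewrite (integral_fineK ih) lee_fin RintegralZ; last first.
    exact: (integrable_lebD (- w) (integrable_heat t20)).
  by rewrite Rintegral_lebD ?Rintegral_heat ?mulr1//; exact: measurable_heat.
transitivity (\int[leb]_w \int[leb]_z F (w, z)).
  apply: eq_Rintegral => w _.
  rewrite -(Rintegral_lebD w (h := fun z => F (w, z))); last first.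
    by apply: (measurableT_comp mF); exact: measurable_pair1.
  rewrite /F/= /heat_div mulrCA -RintegralZ; last first.
    have [+ _] := integrable_edot_heat t0 (mshift (x + w) mphi) (fun z => phiM _).
    exact.
  rewrite -RintegralZ; last first.
    have [+ _] := integrable_edot_heat t0 (mshift (x + w) mphi) (fun z => phiM _).
    by move=> h; exact: (integrable_Zl _ h).
  by apply: eq_Rintegral => z _; rewrite addrK [z + w]addrC addrA.
rewrite Rfubini// /heat_div -RintegralZ; last first.
  by have [] := integrable_edot_heat tr0 (mshift x mphi) (fun z => phiM (x + z)).
apply: eq_Rintegral => z _; set v := phi (x + z).
have mH : measurable_fun setT (fun w => F (w, z)).
  by apply: (measurableT_comp mF); exact: measurable_pair2.
rewrite -(Rintegral_lebN mH) -(Rintegral_lebD (- z) (h := fun w => F (- w, z))); last first.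
  by apply: (measurableT_comp mH); exact: measurable_rVN.
set c := t / (t + r).
transitivity (\int[leb]_u ((2 * t)^-1 * heat (t + r) z *
    (edot u v * heat (t * r / (t + r)) (u - c *: z)))).
  apply: eq_Rintegral => u _; rewrite /F/= opprB.
  rewrite (_ : z - (z - u) = u); last by rewrite opprB addrC subrK.
  have := heat_mul u z t0 r0; rewrite -/c => e.
  transitivity ((2 * t)^-1 * edot u v * (heat r (z - u) * heat t u)); first by ring.
  by rewrite e; ring.
rewrite -(Rintegral_lebD (c *: z)); last first.
  apply: measurable_funM => //; apply: measurable_funM; first exact: measurable_edot.
  by apply: measurable_heat => //; exact: measurable_rVD.
under eq_Rintegral do rewrite addrK edotDl edotZl [(_ + _) * heat _ _]mulrDl.
have [i1 _] := integrable_edot_heat q0 (@measurable_cst _ _ _ _ _ v) (fun=> lexx (enorm v)).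
have i2 := integrable_cst_heat (c * edot z v) q0.
rewrite RintegralZ; last exact: integrable_Radd.
rewrite RintegralD// Rintegral_edot_heat0// add0r Rintegral_cst_heat//.
by rewrite /c; field; rewrite !gt_eqF.
Qed.

End heat_divergence.

(** * The Gamma function and power weights *)

Lemma measurable_EFin_restrict d (T : measurableType d) (R : realType)
    (D : set T) (h : T -> R) : measurable D -> measurable_fun setT h ->
  measurable_fun setT ((fun x => (h x)%:E) \_ D).
Proof.
move=> mD mh; apply: (iffLR (measurable_restrictT _ mD)).
by apply/measurable_EFinP; exact: measurable_funTS.
Qed.

Section power_integrals.
Context {R : realType}.
Local Notation lam := (@lebesgue_measure R).

Lemma powR_cvgy0 (c : R) : 0 < c -> x `^ (- c) @[x --> +oo] --> (0 : R).
Proof.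
move=> c0; apply/cvgrPdist_lt => e e0; near=> x.
have x0 : 0 < x by near: x; exact: nbhs_pinfty_gt.
rewrite sub0r normrN ger0_norm ?powR_ge0// powRN -[ltRHS]invrK ltf_pV2; last 2 first.
- by rewrite posrE powR_gt0.
- by rewrite posrE invr_gt0.
have -> : e^-1 = (e^-1 `^ c^-1) `^ c.
  by rewrite -powRrM mulVf ?gt_eqF// powRr1// invr_ge0 ltW.
rewrite gt0_ltr_powR// ?nnegrE ?powR_ge0 ?ltW//.
Unshelve. all: by end_near. Qed.

Lemma continuous_powR (c x : R) : 0 < x -> {for x, continuous (fun y : R => y `^ c)}.
Proof.
move=> x0; apply: differentiable_continuous; apply/derivable1_diffP.
by apply: derivable_powR; rewrite in_itv/= x0.
Qed.

Lemma integral_powR_tail (a d : R) : 0 < a -> 0 < d ->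
  (\int[lam]_(x in `[a, +oo[) (x `^ (- d - 1))%:E = (a `^ (- d) / d)%:E)%E.
Proof.
move=> a0 d0.
have dF (x : R) : 0 < x -> is_derive x 1 (fun y : R => - d^-1 * y `^ (- d)) (x `^ (- d - 1)).
  move=> x0; have h := is_derive1_powR (- d) x0.
  apply: is_derive_eq.
  by rewrite /GRing.scale/=; field; rewrite gt_eqF.
rewrite (@ge0_continuous_FTC2y _ _ (fun y => - d^-1 * y `^ (- d)) a 0).
- by rewrite -EFinB; congr EFin; ring.
- by move=> x ax; exact: powR_ge0.
- apply: continuous_in_subspaceT => x; rewrite inE/= in_itv/= andbT => ax.
  by apply: continuous_powR; exact: lt_le_trans ax.
- by rewrite -[0](mulr0 (- d^-1)); apply: cvgMr; exact: powR_cvgy0.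
- by move=> x ax; apply: ex_derive; apply: dF; exact: lt_trans ax.
- apply: cvg_at_right_filter; apply: cvgMr.
  exact: continuous_powR.
- move=> x; rewrite in_itv/= andbT => ax; rewrite derive1E.
  by have /@derive_val := dF _ (lt_trans a0 ax).
Qed.

(** A model integrable function on the half-line: c > 0 gives integrability at 0 and d > 0 at
    infinity. It serves as majorant in the time variables below. *)
Definition pmin (c d t : R) : R :=
  if 0 < t then Num.min (t `^ (c - 1)) (t `^ (- d - 1)) else 0.

Lemma pmin_ge0 c d t : 0 <= pmin c d t.
Proof. by rewrite /pmin; case: ifPn => // _; rewrite le_min !powR_ge0. Qed.

Lemma powR_le1 (t p q : R) : 0 < t -> t <= 1 -> q <= p -> t `^ p <= t `^ q.
Proof. by move=> t0 t1 pq; apply: ger_powR; rewrite ?t0. Qed.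

Lemma pminE c d t : 0 < c -> 0 < d -> 0 < t ->
  pmin c d t = if t <= 1 then t `^ (c - 1) else t `^ (- d - 1).
Proof.
move=> c0 d0 t0; rewrite /pmin t0; case: (leP t 1) => t1.
  by rewrite min_l// powR_le1//; lra.
by rewrite min_r// ler_powR ?ltW//; lra.
Qed.

Lemma measurable_pmin c d : measurable_fun setT (pmin c d).
Proof.
apply: measurable_fun_ifT => //; first exact: measurable_fun_ltr.
by apply: measurable_minr; exact: measurable_powR.
Qed.

(** The cutoff is 1 on ]0, 1], 0 beyond 2, and continuous, as [ge0_integral_inv] requires. Inversion
    turns the singularity at 0 into a power tail on [1/2, +oo[. *)
Let integral_near0 (c : R) : 0 < c ->
  (\int[lam]_(x in `]0%R, +oo[) (x `^ (c - 1) * Num.min 1 (Num.max 0 (2 - x)))%:E < +oo)%E.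
Proof.
move=> c0; set G := fun x : R => x `^ (c - 1) * Num.min 1 (Num.max 0 (2 - x)).
have G0 x : 0 <= G x.
  by rewrite mulr_ge0 ?powR_ge0// le_min ler01/= le_max lexx.
rewrite (@ge0_integral_inv _ G) => [|x x0|x x0//]; last first.
  apply: continuousM; first exact: continuous_powR.
  apply: continuous_min; first exact: cst_continuous.
  apply: continuous_max; first exact: cst_continuous.
  by apply: continuousB; [exact: cst_continuous|exact: cvg_id].
have h2 : 0 < 2^-1 :> R by [].
apply: (@le_lt_trans _ _ (\int[lam]_(x in `[2^-1%R, +oo[) (x `^ (- c - 1))%:E)%E);
  last by rewrite integral_powR_tail// ltry.
rewrite integral_mkcond [leRHS]integral_mkcond.
apply: ge0_le_integral => //.
- by move=> x _; apply: erestrict_ge0 => y _; rewrite lee_fin mulr_ge0// invr_ge0 sqr_ge0.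
- apply: measurable_EFin_restrict => //; apply: measurable_funM.
    apply: (measurableT_comp (f := G)); last exact: measurable_inv.
    apply: measurable_funM; first exact: measurable_powR.
    apply: measurable_minr => //; apply: measurable_maxr => //.
    exact: measurable_funB.
  by apply: measurable_funV; exact: measurable_funX.
- apply: measurable_EFin_restrict => //; exact: measurable_powR.
- move=> x _; rewrite !patchE/= !mem_setE/= !in_itv/= !andbT.
  case: ifPn => x0; last first.
    by case: ifPn => // _; rewrite lee_fin powR_ge0.
  case: ifPn => x2; rewrite lee_fin; last first.
    rewrite /G max_l ?min_r ?mulr0 ?mul0r//.
    rewrite subr_le0 -[leLHS]invrK lef_pV2 ?posrE ?invr_gt0//.
    by rewrite ltW// ltNge.
  apply: (@le_trans _ _ (x^-1 `^ (c - 1) * x ^- 2)).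
    rewrite ler_wpM2r ?invr_ge0 ?sqr_ge0// ler_piMr ?powR_ge0//.
    by rewrite ge_min lexx.
  suff -> : x^-1 `^ (c - 1) * x ^- 2 = x `^ (- c - 1) by [].
  rewrite -exprVn -(powR_inv1 (ltW x0)) -powR_mulrn ?powR_ge0// -!powRrM.
  by rewrite -powRD; [congr (_ `^ _); lra|rewrite (gt_eqF x0) implybT].
Qed.

Lemma integrable_pmin (c d : R) : 0 < c -> 0 < d ->
  lam.-integrable setT (EFin \o pmin c d).
Proof.
move=> c0 d0; have mp := @measurable_pmin c d.
apply/integrableP; split; first exact/measurable_EFinP.
pose G x := x `^ (c - 1) * Num.min 1 (Num.max 0 (2 - x)).
have mG : measurable_fun setT G.
  apply: measurable_funM; first exact: measurable_powR.
  apply: measurable_minr => //; apply: measurable_maxr => //.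
  exact: measurable_funB.
have G0 x : 0 <= G x.
  by rewrite mulr_ge0 ?powR_ge0// le_min ler01/= le_max lexx.
apply: (@le_lt_trans _ _ (\int[lam]_x (((EFin \o G) \_ `]0%R, +oo[) x +
   ((fun x => (x `^ (- d - 1))%:E) \_ `[1%R, +oo[) x))%E).
  apply: ge0_le_integral => //.
  - by apply: measurableT_comp => //; exact/measurable_EFinP.
  - apply: emeasurable_funD.
      exact: measurable_EFin_restrict.
    apply: measurable_EFin_restrict => //; exact: measurable_powR.
  - move=> x _; rewrite !patchE/= !mem_setE/= !in_itv/= !andbT.
    rewrite ger0_norm ?pmin_ge0//.
    case: ifPn => x0; last first.
      rewrite /pmin (negbTE x0) add0e; case: ifPn => // _.
      by rewrite lee_fin powR_ge0.
    rewrite pminE//; case: (leP x 1) => x1.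
      rewrite -[X in (X <= _)%E]adde0 leeD//.
        rewrite lee_fin /G min_l ?mulr1//.
        by rewrite le_max; apply/orP; right; lra.
      by case: ifPn => // _; rewrite lee_fin powR_ge0.
    by rewrite (ltW x1) -[X in (X <= _)%E]add0e leeD// lee_fin.
rewrite ge0_integralD//.
- rewrite -!integral_mkcond; apply: lte_add_pinfty.
    exact: integral_near0.
  by rewrite integral_powR_tail// ltry.
- by move=> x _; apply: erestrict_ge0 => y _; rewrite lee_fin.
- exact: measurable_EFin_restrict.
- by move=> x _; apply: erestrict_ge0 => y _; rewrite lee_fin powR_ge0.
- apply: measurable_EFin_restrict => //; exact: measurable_powR.
Qed.

End power_integrals.

Section gamma_function.
Context {R : realType}.
Local Notation lam := (@lebesgue_measure R).

(** The function t_+^(s-1). Extension by zero lets convolutions on the half-line be written over the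
    whole line, where translation invariance is available. *)
Definition hpow (s t : R) : R := if 0 < t then t `^ (s - 1) else 0.

Lemma hpow_ge0 s t : 0 <= hpow s t.
Proof. by rewrite /hpow; case: ifPn => // _; rewrite powR_ge0. Qed.

Lemma hpow_gt0E s t : 0 < t -> hpow s t = t `^ (s - 1).
Proof. by rewrite /hpow => ->. Qed.

Lemma hpow_le0 s t : t <= 0 -> hpow s t = 0.
Proof. by rewrite /hpow leNgt => /negbTE ->. Qed.

Lemma measurable_hpow s d (T : measurableType d) (g : T -> R) :
  measurable_fun setT g -> measurable_fun setT (fun x => hpow s (g x)).
Proof.
move=> mg; apply: measurable_fun_ifT => //; first exact: measurable_fun_ltr.
by apply: (measurableT_comp (measurable_powR _)).
Qed.

Lemma integral_itv0yE (h : R -> R) :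
  (\int[lam]_(t in `]0%R, +oo[) (h t)%:E =
   \int[lam]_t (if 0 < t then h t else 0)%:E)%E.
Proof.
rewrite integral_mkcond; apply: eq_integral => t _.
by rewrite patchE mem_setE/= in_itv/= andbT; case: ifP.
Qed.

Lemma GammaE s : Gamma s = \int[lam]_t (hpow s t * expR (- t)).
Proof.
congr fine; rewrite integral_itv0yE; apply: eq_integral => t _.
by rewrite /hpow; case: ifP; rewrite ?mul0r.
Qed.

(** The exponential series gives t^(m+1) <= (m+1)! e^t, and t >= 1 allows s to be replaced by an
    integer exponent above |s|. *)
Lemma powR_expR_le (s : R) : exists2 K, 0 <= K &
  forall t, 1 <= t -> t `^ s * expR (- t) <= K.
Proof.
pose m := (Num.truncn `|s|).+1.
exists (m.+1`!%:R) => // t t1; have t0 : 0 < t by apply: lt_le_trans t1.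
rewrite expRN ler_pdivrMr ?expR_gt0//.
apply: (@le_trans _ _ (t ^+ m.+1)).
  rewrite -(powR_mulrn _ (ltW t0)) ler_powR//.
  apply: (le_trans (ler_norm _)); apply/ltW/(lt_le_trans (Num.Theory.truncnS_gt _)).
  by rewrite ler_nat.
rewrite mulrC -ler_pdivrMr ?ltr0n ?fact_gt0//.
by apply: le_trans (expR_ge1Dxn m (ltW t0)); rewrite lerDr.
Qed.

Lemma integrable_Gamma s : 0 < s ->
  lam.-integrable setT (EFin \o (fun t => hpow s t * expR (- t))).
Proof.
move=> s0; have [K K0 hK] := powR_expR_le (s + 1).
have ip := integrable_Zl (Num.max 1 K) (integrable_pmin s0 ltr01).
apply: integrable_le ip _.
  apply: measurable_funM; first exact: measurable_hpow.
  by apply: measurableT_comp => //; exact: measurable_funN.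
move=> t; have [t0|t0] := leP t 0.
  rewrite hpow_le0// mul0r normr0 mulr_ge0 ?pmin_ge0//.
  by rewrite le_max ler01.
rewrite ger0_norm ?mulr_ge0 ?hpow_ge0 ?expR_ge0// hpow_gt0E// pminE//.
case: (leP t 1) => t1.
  rewrite mulrC ler_pM ?expR_ge0 ?powR_ge0//.
  by rewrite le_max -expR0 ler_expR oppr_le0 (ltW t0).
have -> : t `^ (s - 1) = t `^ (s + 1) * t `^ (- 1 - 1).
  by rewrite -powRD; [congr (_ `^ _); lra|rewrite (gt_eqF t0) implybT].
rewrite mulrAC ler_wpM2r ?powR_ge0// (le_trans (hK _ (ltW t1)))//.
by rewrite le_max lexx orbT.
Qed.

(** The cutoff lives in ]0, 2], where e^(-t) >= e^(-2), and its integral against t^(s-1) is at least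
    the one over ]0, 1], which is 1/s. Thus 1/Gamma(s) is at most of order s near 0. *)
Lemma Gamma_ge (s : R) : 0 < s -> expR (- 2) / s <= Gamma s.
Proof.
move=> s0; pose G (x : R) := x `^ (s - 1) * Num.min 1 (Num.max 0 (2 - x)).
have G0 x : 0 <= G x.
  by rewrite mulr_ge0 ?powR_ge0// le_min ler01/= le_max lexx.
have mG : measurable_fun setT G.
  apply: measurable_funM; first exact: measurable_powR.
  apply: measurable_minr => //; apply: measurable_maxr => //.
  exact: measurable_funB.
have mg : measurable_fun [set: R] (fun t => hpow s t * expR (- t)).
  apply: measurable_funM; first exact: measurable_hpow.
  by apply: measurableT_comp => //; exact: measurable_funN.
have E : ((s^-1)%:E <= \int[lam]_(x in `]0%R, +oo[) (G x)%:E)%E.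
  rewrite (@ge0_integral_inv _ G) => [|x x0|x x0//]; last first.
    apply: continuousM; first exact: continuous_powR.
    apply: continuous_min; first exact: cst_continuous.
    apply: continuous_max; first exact: cst_continuous.
    by apply: continuousB; [exact: cst_continuous|exact: cvg_id].
  rewrite (_ : s^-1 = 1 `^ (- s) / s); last by rewrite powR1 mul1r.
  rewrite -integral_powR_tail//.
  rewrite integral_mkcond [X in (_ <= X)%E]integral_mkcond.
  apply: ge0_le_integral => //.
  - by move=> x _; apply: erestrict_ge0 => y _; rewrite lee_fin powR_ge0.
  - by apply: measurable_EFin_restrict => //; exact: measurable_powR.
  - apply: measurable_EFin_restrict => //; apply: measurable_funM.
      exact: (measurableT_comp mG measurable_inv).
    by apply: measurable_funV; exact: measurable_funX.
  - move=> x _; rewrite !patchE/= !mem_setE/= !in_itv/= !andbT.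
    case: ifPn => x1; last first.
      case: ifPn => // _; rewrite lee_fin mulr_ge0// invr_ge0 sqr_ge0//.
    have x0 : 0 < x by apply: lt_le_trans x1.
    rewrite x0 lee_fin /G min_l; last first.
      by rewrite le_max; have := invf_le1 x0; rewrite x1 => h; apply/orP; right; lra.
    rewrite mulr1.
    suff -> : x^-1 `^ (s - 1) * x ^- 2 = x `^ (- s - 1) by [].
    rewrite -exprVn -(powR_inv1 (ltW x0)) -powR_mulrn ?powR_ge0// -!powRrM.
    by rewrite -powRD; [congr (_ `^ _); lra|rewrite (gt_eqF x0) implybT].
rewrite -lee_fin GammaE -(integral_fineK (integrable_Gamma s0)) EFinM.
apply: le_trans (lee_wpmul2l _ E) _; first by rewrite lee_fin expR_ge0.
rewrite integral_itv0yE -ge0_integralZl_EFin ?expR_ge0//; last 2 first.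
- by move=> x _; rewrite lee_fin; case: ifPn.
- apply/measurable_EFinP; apply: measurable_fun_ifT => //.
  exact: measurable_fun_ltr.
apply: ge0_le_integral => //.
- by move=> x _; rewrite -EFinM lee_fin mulr_ge0 ?expR_ge0//; case: ifPn.
- apply: emeasurable_funM => //; apply/measurable_EFinP.
  by apply: measurable_fun_ifT => //; exact: measurable_fun_ltr.
- exact/measurable_EFinP.
- move=> x _; rewrite -EFinM lee_fin /hpow; case: ifPn => x0; last by rewrite mulr0 mul0r.
  rewrite /G mulrCA ler_wpM2l ?powR_ge0//.
  have [x2|x2] := leP x 2.
    apply: (@le_trans _ _ (expR (- 2))); last by rewrite ler_expR lerN2.
    by rewrite ler_piMr ?expR_ge0// ge_min lexx.
  rewrite max_l; last by lra.
  by rewrite min_r// mulr0 expR_ge0.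
Qed.

Lemma Gamma_gt0 (s : R) : 0 < s -> 0 < Gamma s.
Proof.
by move=> s0; apply: lt_le_trans (Gamma_ge s0); rewrite divr_gt0 ?expR_gt0.
Qed.

Lemma Gamma_inv_le (s : R) : 0 < s -> (Gamma s)^-1 <= expR 2 * s.
Proof.
move=> s0; rewrite -[leRHS]invrK lef_pV2 ?posrE ?Gamma_gt0//; last first.
  by rewrite invr_gt0 mulr_gt0 ?expR_gt0.
by rewrite invfM -expRN Gamma_ge.
Qed.

(** Put x = t + r, then r = x u: by homogeneity the inner integral is x^(a+s-1) times the beta
    integral, which is left unevaluated here. *)
Let conv_hpow (a s : R) (g : R -> R) :
  measurable_fun setT g -> (forall x, 0 <= g x) ->
  (\int[lam]_t \int[lam]_r (hpow a t * hpow s r * g (t + r)%R)%:E =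
   (\int[lam]_u (hpow a (1 - u) * hpow s u)%:E) *
   \int[lam]_x (hpow (a + s) x * g x)%:E)%E.
Proof.
move=> mg g0.
have mh b := @measurable_hpow b.
pose F (p : R * R) := (hpow a p.1 * hpow s p.2 * g (p.1 + p.2))%:E.
have mF : measurable_fun setT F.
  apply/measurable_EFinP; apply: measurable_funM; last first.
    by apply: (measurableT_comp mg); exact: measurable_funD.
  by apply: measurable_funM; apply: mh.
have F0 p : (0 <= F p)%E by rewrite lee_fin !mulr_ge0 ?hpow_ge0.
rewrite [LHS](fubini_tonelli (m1 := lam) (m2 := lam) F)//.
transitivity (\int[lam]_r \int[lam]_x (hpow a (x - r) * hpow s r * g x)%:E)%E.
  apply: eq_integral => r _; rewrite /F/=.
  rewrite -(@ge0_integral_shift _ r (fun x => (hpow a (x - r) * hpow s r * g x)%:E)).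
  - by apply: eq_integral => x _; rewrite addrK.
  - apply/measurable_EFinP; apply: measurable_funM => //.
    by apply: measurable_funM => //; apply: mh; exact: measurable_funD.
  - by move=> x; rewrite lee_fin !mulr_ge0 ?hpow_ge0.
pose F' (p : R * R) := (hpow a (p.2 - p.1) * hpow s p.1 * g p.2)%:E.
have mF' : measurable_fun setT F'.
  apply/measurable_EFinP; apply: measurable_funM; last exact: (measurableT_comp mg).
  by apply: measurable_funM; apply: mh => //; exact: measurable_funB.
have F'0 p : (0 <= F' p)%E by rewrite lee_fin !mulr_ge0 ?hpow_ge0.
rewrite [LHS](fubini_tonelli (m1 := lam) (m2 := lam) F')//.
have mB : measurable_fun [set: R] (fun u => (hpow a (1 - u) * hpow s u)%:E).
  apply/measurable_EFinP; apply: measurable_funM; apply: mh => //.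
  exact: measurable_funB.
have B0 u : (0 <= (hpow a (1 - u) * hpow s u)%:E)%E.
  by rewrite lee_fin mulr_ge0 ?hpow_ge0.
rewrite -ge0_integralZl//; last 3 first.
- by apply/measurable_EFinP; apply: measurable_funM => //; apply: mh.
- by move=> x _; rewrite lee_fin mulr_ge0 ?hpow_ge0.
- exact: integral_ge0.
apply: eq_integral => x _; rewrite /F'/=.
have [x0|x0] := leP x 0.
  rewrite hpow_le0// mul0r mule0; apply: integral0_eq => r _.
  have [r0|r0] := leP r 0; first by rewrite [hpow s r]hpow_le0// mulr0 mul0r.
  rewrite [hpow a _]hpow_le0 ?mul0r//; lra.
have e (r : R) : hpow a (x - r) * hpow s r * g x =
    x `^ (a + s - 2) * g x * (hpow a (1 - x^-1 * r) * hpow s (x^-1 * r)).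
  have xn : x != 0 by rewrite gt_eqF.
  have -> : 1 - x^-1 * r = x^-1 * (x - r) by field.
  have sc b u : hpow b (x^-1 * u) = x `^ (1 - b) * hpow b u.
    rewrite /hpow pmulr_rgt0 ?invr_gt0//; case: ifPn => u0; last by rewrite mulr0.
    rewrite powRM ?invr_ge0 ?(ltW u0) ?(ltW x0)//; congr (_ * _).
    rewrite -(powR_inv1 (ltW x0)) -powRrM; congr (_ `^ _); ring.
  have d : x `^ (a + s - 2) * (x `^ (1 - a) * x `^ (1 - s)) = 1.
    rewrite -!powRD ?xn ?implybT//.
    by rewrite (_ : a + s - 2 + _ = 0) ?powRr0//; ring.
  rewrite !sc -[LHS]mul1r -[X in X * _ = _]d; ring.
under eq_integral do rewrite e EFinM.
rewrite ge0_integralZl_EFin//; last 2 first.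
- apply/measurable_EFinP; apply: measurable_funM; apply: mh.
    by apply: measurable_funB => //; exact: measurable_funM.
  exact: measurable_funM.
- by rewrite mulr_ge0 ?powR_ge0.
rewrite (@ge0_integral_scale _ x^-1 (fun u => (hpow a (1 - u) * hpow s u)%:E))//; last first.
  by rewrite invr_gt0.
rewrite invrK muleA -EFinM muleC; congr (_ * _%:E)%E.
rewrite hpow_gt0E// mulrAC; congr (_ * _).
rewrite -[X in _ * X](powRr1 (ltW x0)) -powRD; last by rewrite (gt_eqF x0) implybT.
by congr (_ `^ _); ring.
Qed.

(** The beta integral is found by taking g = e^(-x) in [conv_hpow]: the left-hand side then factors
    into Gamma(a) Gamma(s), and the last integral is Gamma(a + s). *)
Lemma integral_conv_hpow (a s : R) (g : R -> R) : 0 < a -> 0 < s ->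
  measurable_fun setT g -> (forall x, 0 <= g x) ->
  (\int[lam]_t \int[lam]_r (hpow a t * hpow s r * g (t + r)%R)%:E =
   (Gamma a * Gamma s / Gamma (a + s))%:E *
   \int[lam]_x (hpow (a + s) x * g x)%:E)%E.
Proof.
move=> a0 s0 mg g0; rewrite conv_hpow//; congr (_ * _)%E.
have as0 : 0 < a + s by rewrite addr_gt0.
have me : measurable_fun [set: R] (fun x : R => expR (- x)).
  by apply: measurableT_comp => //; exact: measurable_funN.
have := @conv_hpow a s (fun x => expR (- x)) me (fun x => expR_ge0 _).
rewrite (integral_fineK (integrable_Gamma as0)) -GammaE /=.
set B := integral _ _ _.
have E : (\int[lam]_t \int[lam]_r (hpow a t * hpow s r * expR (- (t + r)))%:E =
    (Gamma a * Gamma s)%:E)%E.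
  transitivity (\int[lam]_t ((Gamma s)%:E * (hpow a t * expR (- t))%:E))%E.
    apply: eq_integral => t _.
    transitivity (\int[lam]_r ((hpow a t * expR (- t))%:E *
       (hpow s r * expR (- r))%:E))%E.
      by apply: eq_integral => r _; rewrite -EFinM; congr EFin; rewrite opprD expRD; ring.
    rewrite ge0_integralZl_EFin//; last 3 first.
    - by move=> r _; rewrite lee_fin mulr_ge0 ?hpow_ge0 ?expR_ge0.
    - by apply/measurable_EFinP; apply: measurable_funM => //; exact: measurable_hpow.
    - by rewrite mulr_ge0 ?hpow_ge0 ?expR_ge0.
    by rewrite (integral_fineK (integrable_Gamma s0)) -GammaE muleC.
  rewrite ge0_integralZl_EFin ?(ltW (Gamma_gt0 s0))//; last 2 first.
  - by move=> r _; rewrite lee_fin mulr_ge0 ?hpow_ge0 ?expR_ge0.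
  - by apply/measurable_EFinP; apply: measurable_funM => //; exact: measurable_hpow.
  by rewrite (integral_fineK (integrable_Gamma a0)) -GammaE -EFinM mulrC.
move=> /(etrans (esym E)) /(congr1 (fun x => x * ((Gamma (a + s))^-1)%:E))%E.
rewrite -muleA -!EFinM divff ?mule1//.
by rewrite gt_eqF// Gamma_gt0.
Qed.

End gamma_function.

(** * The fractional divergence and the heat flow *)

Section subordination.
Context {R : realType} {n : nat}.
Local Notation leb := (@lebesgue_rV R n).
Local Notation lam := (@lebesgue_measure R).
Local Notation Rn := 'rV[R]_n.

(* the power kernel of frac_div is a mixture of heat kernels: substitute t = 1/u, then v = |z|^2 u / 4 *)
Lemma integral_hpow_heat (alpha : R) (z : Rn) : 0 < alpha < 1 -> z != 0 ->
  (\int[lam]_t (hpow ((1 - alpha) / 2) t * ((2 * t)^-1 * heat t z))%:E =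
   (2 `^ alpha * pi `^ (- (n%:R / 2)) * Gamma ((n%:R + alpha + 1) / 2) /
    enorm z `^ (n%:R + alpha + 1))%:E)%E.
Proof.
move=> /andP[alpha0 alpha1] z0; set a := (1 - alpha) / 2.
set q := (n%:R + alpha + 1) / 2.
have q0 : 0 < q.
  by rewrite /q; have : 0 <= n%:R :> R by []; lra.
have ez := enorm_gt0 z0.
pose c := enorm z ^+ 2 / 4.
have c0 : 0 < c by rewrite divr_gt0 ?exprn_gt0.
have p0 : 0 < pi :> R by exact: pi_gt0.
pose G t := t `^ (a - 1) * ((2 * t)^-1 * heat t z).
pose C0 : R := (4 * pi) `^ (- (n%:R / 2)) / 2.
have C00 : 0 <= C0 by rewrite divr_ge0 ?powR_ge0.
transitivity (\int[lam]_(t in `]0%R, +oo[) (G t)%:E)%E.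
  rewrite integral_itv0yE; apply: eq_integral => t _; congr EFin.
  by rewrite /hpow /G; case: ifP; rewrite ?mul0r.
rewrite (@ge0_integral_inv _ G); last 2 first.
- move=> t t0; apply: continuousM; first exact: continuous_powR.
  apply: continuousM.
    apply: continuousV; first by rewrite mulf_neq0// gt_eqF.
    by apply: continuousM; [exact: cst_continuous|exact: cvg_id].
  rewrite heat.unlock; apply: continuousM.
    apply: (@continuous_comp _ _ _ (fun t => 4 * pi * t) (fun y : R => y `^ _)).
      by apply: continuousM; [exact: cst_continuous|exact: cvg_id].
    by apply: continuous_powR; rewrite !mulr_gt0.
  apply: continuous_comp; last exact: continuous_expR.
  apply: continuousN; apply: continuousM; first exact: cst_continuous.
  apply: continuousV; first by rewrite mulf_neq0// gt_eqF.
  by apply: continuousM; [exact: cst_continuous|exact: cvg_id].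
- move=> t t0; rewrite !mulr_ge0 ?powR_ge0 ?heat_ge0// invr_ge0 mulr_ge0//.
  exact: ltW.
rewrite integral_itv0yE.
pose h v := (hpow q v * expR (- v))%:E.
have mh : measurable_fun [set: R] h.
  exact: measurable_int (integrable_Gamma q0).
have h0 v : (0 <= h v)%E by rewrite lee_fin mulr_ge0 ?hpow_ge0 ?expR_ge0.
transitivity (\int[lam]_u ((C0 * c `^ (1 - q))%:E * h (c * u)%R))%E.
  apply: eq_integral => u _; rewrite -EFinM; congr EFin.
  rewrite /hpow pmulr_rgt0//; case: ifPn => u0; last by rewrite mul0r mulr0.
  have un0 : u != 0 by rewrite gt_eqF.
  have E1 : G u^-1 * u ^- 2 = C0 * u `^ (q - 1) * expR (- (c * u)).
    rewrite /G heat.unlock.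
    have -> : edot z z / (4 * u^-1) = c * u.
      by rewrite /c sqr_enorm; field.
    have -> : u ^- 2 = u `^ (-1 * 2).
      by rewrite -exprVn -(powR_inv1 (ltW u0)) -powR_mulrn ?powR_ge0// -powRrM.
    have -> : (2 * u^-1)^-1 = 2^-1 * u `^ 1.
      by rewrite invfM invrK powRr1// ltW.
    have -> : u^-1 `^ (a - 1) = u `^ (-1 * (a - 1)).
      by rewrite -(powR_inv1 (ltW u0)) -powRrM.
    have -> : (4 * pi * u^-1) `^ (- (n%:R / 2)) =
        (4 * pi) `^ (- (n%:R / 2)) * u `^ (-1 * - (n%:R / 2)).
      rewrite -(powR_inv1 (ltW u0)) powRM ?powR_ge0// -?powRrM//.
      by rewrite mulr_ge0// ltW.
    have -> : u `^ (q - 1) = u `^ (-1 * (a - 1)) * u `^ 1 *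
        u `^ (-1 * - (n%:R / 2)) * u `^ (-1 * 2).
      by rewrite -!powRD ?un0 ?implybT//; congr (_ `^ _); rewrite /q /a; field.
    by rewrite /C0; field.
  rewrite E1 powRM ?(ltW c0) ?(ltW u0)//.
  have e : c `^ (1 - q) * c `^ (q - 1) = 1.
    rewrite -powRD; last by rewrite (gt_eqF c0) implybT.
    by rewrite (_ : 1 - q + (q - 1) = 0) ?powRr0//; ring.
  by rewrite -[LHS]mul1r -[X in X * _ = _]e; ring.
rewrite ge0_integralZl_EFin//; last 2 first.
- by apply: (measurableT_comp mh); exact: measurable_funM.
- by rewrite mulr_ge0// powR_ge0.
rewrite ge0_integral_scale// (integral_fineK (integrable_Gamma q0)) -GammaE.
rewrite -!EFinM; congr EFin.
set X := enorm z `^ (n%:R + alpha + 1).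
have e1 : c `^ (1 - q) * c^-1 = 2 `^ (2 * q) * X^-1.
  rewrite -(powR_inv1 (ltW c0)) -powRD; last by rewrite (gt_eqF c0) implybT.
  rewrite (_ : 1 - q + -1 = - q); last by ring.
  rewrite /c -(powR_mulrn 2 (ltW ez)) powRM ?powR_ge0// mulrC; congr (_ * _).
    rewrite (_ : 4 = 2 `^ 2 :> R); last by rewrite (powR_mulrn 2)//; ring.
    rewrite -powR_inv1 ?powR_ge0// -!powRrM; congr (_ `^ _); ring.
  by rewrite -powRrM /X -powRN; congr (_ `^ _); rewrite /q; field.
have e2 : C0 * 2 `^ (2 * q) = 2 `^ alpha * pi `^ (- (n%:R / 2)).
  rewrite /C0 powRM ?(ltW p0)// (_ : 4 = 2 `^ 2 :> R); last first.
    by rewrite (powR_mulrn 2)//; ring.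
  have e : 2 `^ (2 * - (n%:R / 2)) * 2 `^ (-1) * 2 `^ (2 * q) = 2 `^ alpha :> R.
    rewrite -!powRD; try by rewrite pnatr_eq0 implybT.
    by congr (_ `^ _); rewrite /q; field.
  by rewrite -powRrM -e powR_inv1//; ring.
transitivity (C0 * (c `^ (1 - q) * c^-1) * Gamma q); first by ring.
by rewrite e1 mulrA e2; ring.
Qed.

(** The size M and the Lipschitz constant L are separate parameters, because the comparison of the
    two fractional divergences must depend on M alone. *)
Definition bounded_lipschitz (phi : Rn -> Rn) (M L : R) : Prop :=
  [/\ measurable_fun setT phi, 0 <= L, forall x, enorm (phi x) <= M &
    forall x y, enorm (phi y - phi x) <= L * enorm (y - x)].

(** Subordination: [integral_hpow_heat] integrated against z.(phi(x+z) - phi(x)). With a = (1 -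
    alpha)/2, Fubini applies because the time integrand is O(t^(a-1)) for t <= 1, by the Lipschitz
    bound, and O(t^(a-1-1/2)) = O(t^(-alpha/2-1)) for t >= 1, by the sup bound. *)
Lemma frac_div_heat (alpha M L : R) (phi : Rn -> Rn) (x : Rn) :
  0 < alpha < 1 -> bounded_lipschitz phi M L ->
  lam.-integrable setT
    (EFin \o (fun t => hpow ((1 - alpha) / 2) t * heat_div phi t x)) /\
  frac_div alpha phi x = (Gamma ((1 - alpha) / 2))^-1 *
    \int[lam]_t (hpow ((1 - alpha) / 2) t * heat_div phi t x).
Proof.
move=> a01 [mphi L0 phiM phiL]; have /andP[alpha0 alpha1] := a01.
set a := (1 - alpha) / 2.
have a0 : 0 < a by rewrite /a; lra.
pose d z := phi (x + z) - phi x.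
have md : measurable_fun setT d.
  apply: measurable_rVD => //; apply: (measurableT_comp mphi).
  exact: measurable_rVD.
pose F (p : R * Rn) := hpow a p.1 * ((2 * p.1)^-1 *
   (edot p.2 (d p.2) * heat p.1 p.2)).
have mF : measurable_fun setT F.
  apply: measurable_funM; first exact: measurable_hpow.
  apply: measurable_funM; first by apply: measurable_funV; exact: measurable_funM.
  apply: measurable_funM; last exact: measurable_heat.
  by apply: measurable_edot => //; exact: (measurableT_comp md).
pose K := Num.max (4 * L * 2 `^ (n%:R / 2)) (2 * M * heat_cst R n).
have al2 : 0 < alpha / 2 by rewrite divr_gt0.
have iF : (lam \x leb)%E.-integrable setT (EFin \o F).
  refine (integrable_prodl (m1 := lam) (m2 := leb) (F := F) mF
    (integrable_Zl K (integrable_pmin a0 al2)) _) => t.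
  have [t0|t0] := leP t 0.
    under eq_integral do rewrite /F/= hpow_le0// mul0r normr0.
    by rewrite integral0 lee_fin mulr_ge0 ?pmin_ge0// le_max mulr_ge0// ?mulr_ge0// ?powR_ge0.
  have [i1 b1 b2] := integrable_edot_diff_heat x t0 mphi L0 phiM phiL.
  set H := (fun z => enorm z * enorm (phi (x + z) - phi x) * heat t z) in i1 b1 b2.
  have t20 : 0 < 2 * t by rewrite mulr_gt0.
  apply: (@le_trans _ _ (\int[leb]_z ((hpow a t * (2 * t)^-1 * H z))%:E)%E).
    apply: ge0_le_integral => //.
    - apply/measurable_EFinP; apply: measurableT_comp => //.
      by apply: (measurableT_comp mF); exact: measurable_pair1.
    - exact: measurable_int (integrable_Zl _ i1).
    - move=> z _; rewrite lee_fin /F/= !normrM ![`|heat _ _|]ger0_norm ?heat_ge0//.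
      rewrite [`|_^-1|]ger0_norm ?invr_ge0 ?(ltW t20)// [`|hpow _ _|]ger0_norm ?hpow_ge0//.
      rewrite -mulrA ler_wpM2l ?hpow_ge0// ler_wpM2l ?invr_ge0 ?(ltW t20)//.
      by rewrite ler_wpM2r ?heat_ge0// normr_edot_le.
  rewrite (integral_fineK (integrable_Zl _ i1)) lee_fin RintegralZ// -mulrA.
  rewrite pminE// hpow_gt0E//; case: (leP t 1) => t1.
    by rewrite mulrC ler_wpM2r ?powR_ge0// (le_trans b1)// le_max lexx.
  apply: (@le_trans _ _ (t `^ (a - 1) * (2 * M * heat_cst R n * t `^ (- 2^-1)))).
    by rewrite ler_wpM2l ?powR_ge0.
  rewrite mulrCA ler_pM ?powR_ge0//.
  - rewrite mulr_ge0 ?heat_cst_ge0// mulr_ge0//.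
    by apply: le_trans (phiM 0); exact: enorm_ge0.
  - by rewrite mulr_ge0 ?powR_ge0.
  - by rewrite le_max lexx orbT.
  - rewrite -powRD; last by rewrite (gt_eqF t0) implybT.
    by rewrite ler_powR ?(ltW t1)// /a; lra.
have eF t : \int[leb]_z F (t, z) = hpow a t * heat_div phi t x.
  have [t0|t0] := leP t 0.
    by under eq_Rintegral do rewrite /F/= hpow_le0// mul0r; rewrite Rintegral_cst// hpow_le0// !mul0r.
  rewrite (heat_divE x t0 mphi phiM) /F/=.
  have dM z : enorm (d z) <= M + M.
    by rewrite (le_trans (enormD _ _))// enormN lerD.
  have [i1 _] := integrable_edot_heat t0 md dM.
  by rewrite RintegralZ ?RintegralZ//; exact: integrable_Zl.
have [iF1 _] := integrable_Rintegral2 iF.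
split.
  by apply: eq_integrable iF1 => // t _ /=; rewrite eF.
under [in RHS]eq_Rintegral do rewrite -eF.
rewrite Rfubini// /frac_div.
have mi : measurable_fun setT (fun y : Rn => edot (y - x) (phi y - phi x) /
    enorm (y - x) `^ (n%:R + alpha + 1)).
  have ms : measurable_fun setT (fun y : Rn => y - x) by exact: measurable_rVD.
  apply: measurable_funM.
    by apply: measurable_edot => //; apply: measurable_rVD.
  apply: measurable_funV; apply: (measurableT_comp (measurable_powR _)).
  exact: measurable_enorm.
rewrite -(Rintegral_lebD x mi).
pose C := 2 `^ alpha * pi `^ (- (n%:R / 2)) * Gamma ((n%:R + alpha + 1) / 2).
have e z : \int[lam]_t F (t, z) =
    C * (edot z (d z) / enorm z `^ (n%:R + alpha + 1)).
  (* The kernel identity is stated for z <> 0; at 0 both sides vanish with the inner product. *)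
  rewrite /F/=; have [->|z0] := eqVneq z 0.
    under eq_Rintegral do rewrite edot0l mul0r mulr0 mulr0.
    by rewrite Rintegral_cst// edot0l !mul0r mulr0.
  have E := integral_hpow_heat a01 z0; rewrite -/a -/C in E.
  have iH : lam.-integrable setT (EFin \o (fun t => hpow a t * ((2 * t)^-1 * heat t z))).
    apply/integrableP; split.
      apply/measurable_EFinP; apply: measurable_funM; first exact: measurable_hpow.
      apply: measurable_funM; last exact: measurable_heat.
      by apply: measurable_funV; exact: measurable_funM.
    under eq_integral => t _.
      rewrite /= ger0_norm; last first.
        have [t0|t0] := leP t 0; first by rewrite hpow_le0// mul0r.
        by rewrite !mulr_ge0 ?hpow_ge0 ?heat_ge0// invr_ge0 mulr_ge0// ltW.
      over.
    by rewrite /= E ltry.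
  transitivity (\int[lam]_t (edot z (d z) * (hpow a t * ((2 * t)^-1 * heat t z)))).
    by apply: eq_Rintegral => t _; ring.
  by rewrite RintegralZ// /Rintegral E/=; ring.
under [in RHS]eq_Rintegral do rewrite e.
rewrite /frac_const -/a.
have iG : leb.-integrable setT (EFin \o (fun z => C * (edot z (d z) / enorm z `^ (n%:R + alpha + 1)))).
  have [iG _] := integrable_Rintegral1 iF.
  by apply: eq_integrable iG => // z _ /=; rewrite e.
(* Fubini gives integrability of [C] times the quotient; dividing by [C] transfers it to the
   integrand of [frac_div]. *)
have C0 : C != 0.
  rewrite !mulf_neq0// gt_eqF ?powR_gt0 ?pi_gt0// Gamma_gt0//.
  by have : 0 <= n%:R :> R by []; lra.
have iG' : leb.-integrable setT (EFin \o (fun z => edot z (d z) / enorm z `^ (n%:R + alpha + 1))).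
  have := integrable_Zl C^-1 iG; apply: eq_integrable => // z _ /=.
  by rewrite mulrA mulVf// mul1r.
rewrite (RintegralZ C iG').
set I2 := \int[leb]_x0 _; set I1 := \int[leb]_x0 _.
have -> : I2 = I1.
  by apply: eq_Rintegral => z _; rewrite addrK [z + x]addrC.
by rewrite mulrA [_^-1 * C]mulrC.
Qed.

End subordination.

(** * Comparison of div^beta with the Bessel average of div^alpha *)

Section bessel_average.
Context {R : realType} {n : nat}.
Local Notation leb := (@lebesgue_rV R n).
Local Notation lam := (@lebesgue_measure R).
Local Notation Rn := 'rV[R]_n.

(** The majorant used for subordination, now uniform in x, so that it survives integration in space
    against a heat kernel. *)
Lemma hpow_heat_div_le (alpha M L : R) (phi : Rn -> Rn) :
  0 < alpha < 1 -> bounded_lipschitz phi M L ->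
  exists2 K, 0 <= K & forall t x,
    `|hpow ((1 - alpha) / 2) t * heat_div phi t x| <=
    K * pmin ((1 - alpha) / 2) (alpha / 2) t.
Proof.
move=> /andP[alpha0 alpha1] [mphi L0 phiM phiL].
set a := (1 - alpha) / 2; have a0 : 0 < a by rewrite /a; lra.
have al2 : 0 < alpha / 2 by rewrite divr_gt0.
pose K := Num.max (4 * L * 2 `^ (n%:R / 2)) (2 * M * heat_cst R n).
have K0 : 0 <= K.
  by rewrite le_max; apply/orP; left; rewrite mulr_ge0 ?powR_ge0// mulr_ge0.
exists K => // t x; have [t0|t0] := leP t 0.
  by rewrite hpow_le0// mul0r normr0 mulr_ge0// pmin_ge0.
have t20 : 0 < 2 * t by rewrite mulr_gt0.
have [i1 b1 b2] := integrable_edot_diff_heat x t0 mphi L0 phiM phiL.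
set H := (fun z => enorm z * enorm (phi (x + z) - phi x) * heat t z) in i1 b1 b2.
have hH : `|heat_div phi t x| <= (2 * t)^-1 * \int[leb]_z H z.
  rewrite (heat_divE x t0 mphi phiM) normrM ger0_norm ?invr_ge0 ?(ltW t20)//.
  rewrite ler_wpM2l ?invr_ge0 ?(ltW t20)//; apply: Rintegral_le_bound => //.
    apply: measurable_funM; last exact: measurable_heat.
    apply: measurable_edot => //; apply: measurable_rVD => //.
    by apply: (measurableT_comp mphi); exact: measurable_rVD.
  move=> z; rewrite normrM [X in _ * X]ger0_norm ?heat_ge0//.
  by rewrite ler_wpM2r ?heat_ge0// normr_edot_le.
rewrite normrM ger0_norm ?hpow_ge0// pminE// hpow_gt0E//; case: (leP t 1) => t1.
  rewrite mulrC ler_wpM2r ?powR_ge0// (le_trans hH)// (le_trans b1)//.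
  by rewrite le_max lexx.
apply: (@le_trans _ _ (t `^ (a - 1) * (2 * M * heat_cst R n * t `^ (- 2^-1)))).
  by rewrite ler_wpM2l ?powR_ge0// (le_trans hH).
rewrite mulrCA ler_pM ?powR_ge0//.
- rewrite mulr_ge0 ?heat_cst_ge0// mulr_ge0//.
  by apply: le_trans (phiM 0); exact: enorm_ge0.
- by rewrite mulr_ge0 ?powR_ge0.
- by rewrite le_max lexx orbT.
- rewrite -powRD; last by rewrite (gt_eqF t0) implybT.
  by rewrite ler_powR ?(ltW t1)// /a; lra.
Qed.

Lemma measurable_hpow_heat_div (a : R) (phi : Rn -> Rn) d (T : measurableType d)
    (g1 : T -> R) (g2 : T -> Rn) : measurable_fun setT phi ->
  measurable_fun setT g1 -> measurable_fun setT g2 ->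
  measurable_fun setT (fun u => hpow a (g1 u) * heat_div phi (g1 u) (g2 u)).
Proof.
move=> mphi m1 m2; apply: measurable_funM; first exact: measurable_hpow.
exact: measurable_heat_div.
Qed.

Lemma frac_div_bounded (alpha M L : R) (phi : Rn -> Rn) :
  0 < alpha < 1 -> bounded_lipschitz phi M L ->
  measurable_fun setT (frac_div alpha phi) /\
  exists2 C, 0 <= C & forall x, `|frac_div alpha phi x| <= C.
Proof.
move=> a01 bl; have [K K0 hK] := hpow_heat_div_le a01 bl.
have [mphi _ _ _] := bl; have /andP[alpha0 alpha1] := a01.
set a := (1 - alpha) / 2 in hK.
have a0 : 0 < a by rewrite /a; lra.
have al2 : 0 < alpha / 2 by rewrite divr_gt0.
split.
  rewrite (_ : frac_div alpha phi = fun x => (Gamma a)^-1 *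
      \int[lam]_t (hpow a t * heat_div phi t x)); last first.
    by apply/funext => x; have [_ ->] := frac_div_heat x a01 bl.
  apply: measurable_funM => //.
  apply: (measurable_Rintegral2 lam (F := fun p : Rn * R =>
    hpow a p.2 * heat_div phi p.2 p.1)).
  exact: measurable_hpow_heat_div.
exists ((Gamma a)^-1 * \int[lam]_t (K * pmin a (alpha / 2) t)).
  rewrite mulr_ge0 ?invr_ge0 ?(ltW (Gamma_gt0 a0))//.
  by apply: Rintegral_ge0 => t _; rewrite mulr_ge0 ?pmin_ge0.
move=> x; have [i ->] := frac_div_heat x a01 bl.
rewrite normrM ger0_norm ?invr_ge0 ?(ltW (Gamma_gt0 a0))//.
rewrite ler_wpM2l ?invr_ge0 ?(ltW (Gamma_gt0 a0))//.
apply: Rintegral_le_bound => //.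
- by apply: measurable_hpow_heat_div.
- by apply: integrable_Zl; exact: integrable_pmin.
Qed.

(** By Fubini and the semigroup property, averaging at time r replaces t by t + r in the
    subordination integral, outside the power weight. *)
Lemma heat_frac_div (alpha M L r : R) (phi : Rn -> Rn) (x : Rn) :
  0 < alpha < 1 -> bounded_lipschitz phi M L -> 0 < r ->
  \int[leb]_w (heat r w * frac_div alpha phi (x + w)) =
  (Gamma ((1 - alpha) / 2))^-1 *
  \int[lam]_t (hpow ((1 - alpha) / 2) t * heat_div phi (t + r) x).
Proof.
move=> a01 bl r0; have [K K0 hK] := hpow_heat_div_le a01 bl.
have [mphi L0 phiM phiL] := bl; have /andP[alpha0 alpha1] := a01.
set a := (1 - alpha) / 2 in hK *.
have a0 : 0 < a by rewrite /a; lra.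
have al2 : 0 < alpha / 2 by rewrite divr_gt0.
pose F (p : Rn * R) := heat r p.1 * (hpow a p.2 * heat_div phi p.2 (x + p.1)).
have mF : measurable_fun setT F.
  apply: measurable_funM; first exact: measurable_heat.
  by apply: measurable_hpow_heat_div => //; exact: measurable_rVD.
have ip := integrable_pmin a0 al2.
have iF : (leb \x lam)%E.-integrable setT (EFin \o F).
  refine (integrable_prodl (m1 := leb) (m2 := lam) (F := F) mF
   (integrable_cst_heat (K * \int[lam]_t pmin a (alpha / 2) t) r0) _) => w.
  apply: (@le_trans _ _ (\int[lam]_t ((heat r w * K) * pmin a (alpha / 2) t)%:E)%E).
    apply: ge0_le_integral => //.
    - apply/measurable_EFinP; apply: measurableT_comp => //.
      by apply: (measurableT_comp mF); exact: measurable_pair1.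
    - exact: measurable_int (integrable_Zl _ ip).
    - move=> t _; rewrite lee_fin /F/= normrM [`|heat _ _|]ger0_norm ?heat_ge0//.
      by rewrite -mulrA ler_wpM2l ?heat_ge0.
  rewrite (integral_fineK (integrable_Zl _ ip)) lee_fin RintegralZ//.
  by rewrite le_eqVlt; apply/orP; left; apply/eqP; ring.
transitivity (\int[leb]_w ((Gamma a)^-1 * \int[lam]_t F (w, t))).
  apply: eq_Rintegral => w _.
  have [i ->] := frac_div_heat (x + w) a01 bl.
  by rewrite -/a /F/= RintegralZ//; ring.
have [iF1 _] := integrable_Rintegral2 iF.
rewrite RintegralZ// Rfubini//; congr (_ * _).
apply: eq_Rintegral => t _; rewrite /F/=.
have [t0|t0] := leP t 0.
  under eq_Rintegral do rewrite hpow_le0// mul0r mulr0.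
  by rewrite Rintegral_cst// hpow_le0// !mul0r.
rewrite -(heat_div_semigroup x t0 r0 mphi phiM) -RintegralZ; last first.
  apply: (integrable_le _ (integrable_cst_heat (M * heat_cst R n * t `^ (- 2^-1)) r0)).
    apply: measurable_funM; first exact: measurable_heat.
    by apply: measurable_heat_div => //; exact: measurable_rVD.
  move=> w; rewrite normrM [`|heat _ _|]ger0_norm ?heat_ge0// mulrC.
  by rewrite ler_wpM2r ?heat_ge0// normr_heat_div.
by apply: eq_Rintegral => w _; ring.
Qed.

Lemma Rintegral_conv_hpow (a s : R) (g : R -> R) : 0 < a -> 0 < s ->
  measurable_fun setT g ->
  lam.-integrable setT (EFin \o (fun x => hpow (a + s) x * g x)) ->
  let F (p : R * R) := hpow a p.1 * hpow s p.2 * g (p.1 + p.2) in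
  (lam \x lam)%E.-integrable setT (EFin \o F) /\
  \int[(lam \x lam)%E]_p F p =
  Gamma a * Gamma s / Gamma (a + s) * \int[lam]_x (hpow (a + s) x * g x).
Proof.
move=> a0 s0.
have mFh (h : R -> R) : measurable_fun setT h ->
  measurable_fun setT (fun p : R * R => hpow a p.1 * hpow s p.2 * h (p.1 + p.2)).
  move=> mh; apply: measurable_funM; last first.
    by apply: (measurableT_comp mh); exact: measurable_funD.
  by apply: measurable_funM; exact: measurable_hpow.
have pos (h : R -> R) : measurable_fun setT h -> (forall x, 0 <= h x) ->
  lam.-integrable setT (EFin \o (fun x => hpow (a + s) x * h x)) ->
  let F (p : R * R) := hpow a p.1 * hpow s p.2 * h (p.1 + p.2) in
  (lam \x lam)%E.-integrable setT (EFin \o F) /\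
  \int[(lam \x lam)%E]_p F p =
  Gamma a * Gamma s / Gamma (a + s) * \int[lam]_x (hpow (a + s) x * h x).
  move=> mh h0 ih F.
  have mF : measurable_fun setT F by exact: mFh.
  have F0 p : 0 <= F p by rewrite !mulr_ge0 ?hpow_ge0.
  have E : (\int[lam \x lam]_p (F p)%:E = (Gamma a * Gamma s / Gamma (a + s) *
      \int[lam]_x (hpow (a + s) x * h x))%:E)%E.
    rewrite [LHS](fubini_tonelli1 (m1 := lam) (m2 := lam) (fun p => (F p)%:E))//; last first.
      exact/measurable_EFinP.
    by rewrite [LHS]integral_conv_hpow// (integral_fineK ih) EFinM.
  split; last by rewrite /Rintegral E.
  apply/integrableP; split; first exact/measurable_EFinP.
  by under eq_integral do rewrite /= ger0_norm//; rewrite E ltry.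
move=> mg ig F.
pose gp x := Num.max (g x) 0; pose gn x := Num.max (- g x) 0.
have mgp : measurable_fun setT gp by exact: measurable_maxr.
have mgn : measurable_fun setT gn by apply: measurable_maxr => //; exact: measurable_funN.
have gE x : g x = gp x - gn x.
  rewrite /gp /gn; case: (leP (g x) 0) => h.
    by rewrite max_l ?oppr_ge0// opprK add0r.
  by rewrite max_r ?subr0// oppr_le0 ltW.
have le0 x (y : R) : `|y| <= `|g x| -> `|hpow (a + s) x * y| <= `|hpow (a + s) x * g x|.
  by move=> yg; rewrite !normrM ler_wpM2l.
have igp : lam.-integrable setT (EFin \o (fun x => hpow (a + s) x * gp x)).
  apply: (integrable_le _ (integrable_norm ig)).
    by apply: measurable_funM => //; exact: measurable_hpow.
  move=> x; apply: le0; rewrite /gp; case: (leP (g x) 0) => // h.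
  by rewrite normr0.
have ign : lam.-integrable setT (EFin \o (fun x => hpow (a + s) x * gn x)).
  apply: (integrable_le _ (integrable_norm ig)).
    by apply: measurable_funM => //; exact: measurable_hpow.
  move=> x; apply: le0; rewrite /gn; case: (leP (- g x) 0) => // h.
    by rewrite normr0.
  by rewrite normrN.
have [ip ep] := pos gp mgp (fun x => ltac:(by rewrite /gp le_max lexx orbT)) igp.
have [jn en] := pos gn mgn (fun x => ltac:(by rewrite /gn le_max lexx orbT)) ign.
have FE p : F p = hpow a p.1 * hpow s p.2 * gp (p.1 + p.2) +
   (- 1) * (hpow a p.1 * hpow s p.2 * gn (p.1 + p.2)).
  by rewrite /F gE; ring.
split.
  apply: eq_integrable (integrable_Radd ip (integrable_Zl (- 1) jn)) => // p _.
  by rewrite /= FE.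
under eq_Rintegral do rewrite FE.
rewrite RintegralD//; last exact: (integrable_Zl (- 1) jn).
rewrite (RintegralZ (- 1) jn) ep en.
under [in RHS]eq_Rintegral do rewrite gE mulrBr.
by rewrite RintegralB//; ring.
Qed.

(** The density of the gamma distribution. The corresponding mixture of heat kernels is the kernel
    of (1 - Laplacian)^(-s). *)
Definition bessel_weight (s r : R) : R := (Gamma s)^-1 * (hpow s r * expR (- r)).

Lemma bessel_weight_ge0 s r : 0 < s -> 0 <= bessel_weight s r.
Proof.
by move=> s0; rewrite mulr_ge0 ?invr_ge0 ?(ltW (Gamma_gt0 s0)) ?mulr_ge0 ?hpow_ge0 ?expR_ge0.
Qed.

Lemma integrable_bessel_weight s : 0 < s ->
  lam.-integrable setT (EFin \o bessel_weight s).
Proof. by move=> s0; apply: integrable_Zl; exact: integrable_Gamma. Qed.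

Lemma Rintegral_bessel_weight s : 0 < s -> \int[lam]_r bessel_weight s r = 1.
Proof.
move=> s0; rewrite RintegralZ; last exact: integrable_Gamma.
by rewrite -GammaE mulVf// gt_eqF// Gamma_gt0.
Qed.

(** A majorant with separated variables and independent of s. The factor (t + r)^(-1/2) is split as
    t^(-th) r^(-(1/2 - th)), with th = a/2 for t <= 1 and th = a + alpha/4 for t > 1, so that the
    power of t is integrable at both ends. For small r the singularity is compensated by 1 - e^(-r)
    <= r. *)
Let far_le (alpha s t r : R) : 0 < alpha < 1 -> 0 < s <= alpha / 8 ->
  hpow ((1 - alpha) / 2) t * hpow s r * (1 - expR (- r)) * (t + r) `^ (- 2^-1) <=
  2 * (pmin ((1 - alpha) / 4) (alpha / 4) t * pmin ((3 - alpha) / 4) (alpha / 8) r).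
Proof.
move=> /andP[alpha0 alpha1] /andP[s0 s8]; set a := (1 - alpha) / 2.
have R0 : 0 <= 2 * (pmin ((1 - alpha) / 4) (alpha / 4) t * pmin ((3 - alpha) / 4) (alpha / 8) r).
  by rewrite mulr_ge0// mulr_ge0 ?pmin_ge0.
have [t0|t0] := leP t 0; first by rewrite hpow_le0// !mul0r.
have [r0|r0] := leP r 0; first by rewrite [hpow s r]hpow_le0// !(mul0r, mulr0).
have tr0 : 0 < t + r by rewrite addr_gt0.
have wm th : 0 <= th <= 2^-1 ->
    (t + r) `^ (- 2^-1) <= t `^ (- th) * r `^ (- (2^-1 - th)).
  move=> /andP[th0 th2].
  rewrite (_ : - 2^-1 = - th + - (2^-1 - th)); last by ring.
  rewrite powRD; last by rewrite (gt_eqF tr0) implybT.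
  rewrite !powRN ler_pM ?invr_ge0 ?powR_ge0// lef_pV2 ?posrE ?powR_gt0//.
    by rewrite ge0_ler_powR// ?nnegrE ?(ltW t0) ?(ltW tr0)// lerDl ltW.
  by rewrite ge0_ler_powR ?nnegrE ?(ltW r0) ?(ltW tr0) ?subr_ge0// lerDr ltW.
have PD (x p q : R) : 0 < x -> x `^ p * x `^ q = x `^ (p + q).
  by move=> x0; rewrite powRD// (gt_eqF x0) implybT.
have step1 : hpow a t * (t + r) `^ (- 2^-1) <=
   pmin ((1 - alpha) / 4) (alpha / 4) t * (r `^ (- ((1 + alpha) / 4)) + r `^ (- (alpha / 4))).
  rewrite hpow_gt0E// pminE//; try lra.
  case: (leP t 1) => t1.
    apply: (@le_trans _ _ (t `^ (a - 1) * (t `^ (- (a / 2)) * r `^ (- (2^-1 - a / 2))))).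
      by rewrite ler_wpM2l ?powR_ge0// wm// /a; apply/andP; split; lra.
    rewrite mulrA PD// (_ : a - 1 + - (a / 2) = (1 - alpha) / 4 - 1); last by rewrite /a; field.
    rewrite (_ : 2^-1 - a / 2 = (1 + alpha) / 4); last by rewrite /a; field.
    by rewrite ler_wpM2l ?powR_ge0// lerDl powR_ge0.
  apply: (@le_trans _ _ (t `^ (a - 1) * (t `^ (- (a + alpha / 4)) * r `^ (- (2^-1 - (a + alpha / 4)))))).
    by rewrite ler_wpM2l ?powR_ge0// wm// /a; apply/andP; split; lra.
  rewrite mulrA PD// (_ : a - 1 + - (a + alpha / 4) = - (alpha / 4) - 1); last by ring.
  rewrite (_ : 2^-1 - (a + alpha / 4) = alpha / 4); last by rewrite /a; field.
  by rewrite ler_wpM2l ?powR_ge0// lerDr powR_ge0.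
have e1 : 0 <= 1 - expR (- r) by rewrite subr_ge0 -expR0 ler_expR oppr_le0 ltW.
have er : 1 - expR (- r) <= r.
  by have := expR_ge1Dx (- r); lra.
have e2 : 1 - expR (- r) <= 1 by have := expR_ge0 (- r); lra.
have step2 : hpow s r * (1 - expR (- r)) *
   (r `^ (- ((1 + alpha) / 4)) + r `^ (- (alpha / 4))) <=
   2 * pmin ((3 - alpha) / 4) (alpha / 8) r.
  rewrite hpow_gt0E// pminE//; try lra.
  case: (leP r 1) => r1.
    apply: (@le_trans _ _ (r `^ (s - 1) * r `^ 1 * (2 * r `^ (- ((1 + alpha) / 4))))).
      rewrite powRr1 ?(ltW r0)// ler_pM ?addr_ge0 ?powR_ge0 ?mulr_ge0 ?powR_ge0//.
        by rewrite ler_wpM2l ?powR_ge0.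
      rewrite [leRHS]mulr_natl mulr2n lerD2l powR_le1//; lra.
    rewrite mulrCA ler_wpM2l// !PD// powR_le1//; lra.
  apply: (@le_trans _ _ (r `^ (s - 1) * 1 * (2 * r `^ (- (alpha / 4))))).
    rewrite ler_pM ?addr_ge0 ?powR_ge0 ?mulr_ge0 ?powR_ge0//.
      by rewrite ler_wpM2l ?powR_ge0.
    by rewrite [leRHS]mulr_natl mulr2n lerD2r ler_powR ?(ltW r1)//; lra.
  (* Here s <= alpha / 8 enters: s - 1 - alpha / 4 <= - alpha / 8 - 1. *)
  rewrite mulr1 mulrCA ler_wpM2l// PD// ler_powR ?(ltW r1)//; lra.
rewrite [leLHS](_ : _ = (hpow a t * (t + r) `^ (- 2^-1)) * (hpow s r * (1 - expR (- r)))); last by ring.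
apply: (@le_trans _ _ (pmin ((1 - alpha) / 4) (alpha / 4) t *
   (r `^ (- ((1 + alpha) / 4)) + r `^ (- (alpha / 4))) * (hpow s r * (1 - expR (- r))))).
  by rewrite ler_wpM2r// mulr_ge0 ?hpow_ge0.
by rewrite -mulrA [leRHS]mulrCA ler_wpM2l ?pmin_ge0// mulrC.
Qed.

Definition far_cst (alpha : R) : R := heat_cst R n * (Gamma ((1 - alpha) / 2))^-1 *
  (2 * ((\int[lam]_t pmin ((1 - alpha) / 4) (alpha / 4) t) *
        (\int[lam]_r pmin ((3 - alpha) / 4) (alpha / 8) r))).

(** Both terms are double integrals over (t, r) with the same constant 1 / (Gamma(a) Gamma(s)): of
    [F1] for div^beta, because a + s = (1 - beta) / 2, and of e^(-r) [F1] for the average. The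
    difference carries 1 - e^(-r) and is dominated through [far_le], uniformly in s; phi enters the
    bound through M only. *)
Lemma bessel_frac_div (alpha beta s M L : R) (phi : Rn -> Rn) (x : Rn) :
  0 < alpha < 1 -> 0 < beta -> alpha * (3 / 4) <= beta < alpha ->
  bounded_lipschitz phi M L ->
  s = (alpha - beta) / 2 ->
  `|frac_div beta phi x -
    \int[lam]_r (bessel_weight s r * \int[leb]_w (heat r w * frac_div alpha phi (x + w)))|
  <= M * far_cst alpha * (Gamma s)^-1.
Proof.
move=> a01 beta0 /andP[ab3 ba] bl sE.
have /andP[alpha0 alpha1] := a01; have [mphi L0 phiM phiL] := bl.
set a := (1 - alpha) / 2; have a0 : 0 < a by rewrite /a; lra.
have s0 : 0 < s by rewrite sE; lra.
have s8 : 0 < s <= alpha / 8 by rewrite s0/= sE; lra.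
have b01 : 0 < beta < 1 by rewrite beta0/=; lra.
have M0 : 0 <= M by apply: le_trans (phiM 0); exact: enorm_ge0.
have Ga := Gamma_gt0 a0; have Gs := Gamma_gt0 s0.
pose g t := heat_div phi t x.
have mg : measurable_fun setT g by exact: measurable_heat_div.
have [ib ->] := frac_div_heat x b01 bl.
have as_ : (1 - beta) / 2 = a + s by rewrite /a sE; field.
rewrite as_ in ib *.
have [iF EF] := Rintegral_conv_hpow a0 s0 mg ib.
pose F1 (p : R * R) := hpow a p.1 * hpow s p.2 * g (p.1 + p.2).
rewrite -/F1 in iF EF.
pose F2 (p : R * R) := expR (- p.2) * F1 p.
have mF1 : measurable_fun setT F1.
  by apply/measurable_EFinP; exact: measurable_int iF.
have mF2 : measurable_fun setT F2.
  apply: measurable_funM => //; apply: measurableT_comp => //.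
  exact: measurable_funN.
have iF2 : (lam \x lam)%E.-integrable setT (EFin \o F2).
  refine (integrable_le (mu := (lam \x lam)%E) (f := F2) mF2
    (integrable_norm iF) _) => -[t r]; rewrite /F2/=.
  have [r0|r0] := leP r 0.
    by rewrite /F1/= [hpow s r]hpow_le0// !(mulr0, mul0r) normr0.
  rewrite normrM ger0_norm ?expR_ge0// ler_piMl//.
  by rewrite -expR0 ler_expR oppr_le0 ltW.
have EA : \int[lam]_r (bessel_weight s r * \int[leb]_w (heat r w * frac_div alpha phi (x + w)))
   = (Gamma a)^-1 * (Gamma s)^-1 * \int[(lam \x lam)%E]_p F2 p.
  have [i2 <-] := integrable_Rintegral1 iF2.
  rewrite -RintegralZ//; apply: eq_Rintegral => r _.
  have [r0|r0] := leP r 0.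
    rewrite /bessel_weight /F2 /F1/= [hpow s r]hpow_le0// mul0r mulr0 mul0r.
    under eq_Rintegral do rewrite !(mulr0, mul0r).
    by rewrite Rintegral_cst// mul0r mulr0.
  rewrite (heat_frac_div x a01 bl r0) -/a /bessel_weight.
  (* For r > 0 the time t + r stays away from 0, so the sup bound alone gives integrability. *)
  have ig : lam.-integrable setT (EFin \o (fun t => hpow a t * heat_div phi (t + r) x)).
    have al2 : 0 < alpha / 2 by rewrite divr_gt0.
    have ic := integrable_Zl (M * heat_cst R n * (1 + r `^ (- 2^-1))) (integrable_pmin a0 al2).
    apply: (integrable_le _ ic).
      apply: measurable_funM; first exact: measurable_hpow.
      by apply: measurable_heat_div => //; exact: measurable_funD.
    move=> t; have [t0|t0] := leP t 0.
      by rewrite hpow_le0// mul0r normr0 mulr_ge0 ?pmin_ge0// !mulr_ge0 ?heat_cst_ge0 ?addr_ge0 ?powR_ge0.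
    have tr0 : 0 < t + r by rewrite addr_gt0.
    rewrite normrM ger0_norm ?hpow_ge0//.
    apply: (@le_trans _ _ (hpow a t * (M * heat_cst R n * (t + r) `^ (- 2^-1)))).
      by rewrite ler_wpM2l ?hpow_ge0// normr_heat_div.
    rewrite mulrCA -!mulrA ler_wpM2l// ler_wpM2l ?heat_cst_ge0//.
    rewrite hpow_gt0E// pminE//.
    have hm (u v : R) : 0 < u -> u <= v -> v `^ (- 2^-1) <= u `^ (- 2^-1).
      move=> u0 uv; have v0 : 0 < v by exact: lt_le_trans uv.
      rewrite !powRN lef_pV2 ?posrE ?powR_gt0//.
      by rewrite ge0_ler_powR ?nnegrE ?(ltW u0) ?(ltW v0).
    case: (leP t 1) => t1.
      rewrite mulrC ler_wpM2r ?powR_ge0// (le_trans (hm r _ r0 _)) ?lerDr ?(ltW t0)//.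
    apply: (@le_trans _ _ (t `^ (a - 1) * t `^ (- 2^-1))).
      by rewrite ler_wpM2l ?powR_ge0// hm// lerDl (ltW r0).
    rewrite -powRD; last by rewrite (gt_eqF t0) implybT.
    rewrite (_ : a - 1 - 2^-1 = - (alpha / 2) - 1); last by rewrite /a; field.
    by rewrite ler_peMl ?powR_ge0// lerDl powR_ge0.
  transitivity ((Gamma a)^-1 * (Gamma s)^-1 * (expR (- r) * hpow s r *
     \int[lam]_t (hpow a t * heat_div phi (t + r) x))); first by ring.
  congr (_ * _); rewrite -RintegralZ//; apply: eq_Rintegral => t _.
  by rewrite /F2 /F1/= /g; ring.
rewrite EA.
have -> : (Gamma (a + s))^-1 * \int[lam]_t (hpow (a + s) t * heat_div phi t x) =
  (Gamma a)^-1 * (Gamma s)^-1 * \int[(lam \x lam)%E]_p F1 p.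
  rewrite EF /g; field; rewrite !gt_eqF// Gamma_gt0// addr_gt0//.
rewrite -mulrBr -RintegralB// normrM ger0_norm; last first.
  by rewrite mulr_ge0 ?invr_ge0 ?(ltW Ga) ?(ltW Gs).
have p1 : 0 < (1 - alpha) / 4 by lra.
have p2 : 0 < alpha / 4 by lra.
have p3 : 0 < (3 - alpha) / 4 by lra.
have p4 : 0 < alpha / 8 by lra.
have i1 := integrable_pmin p1 p2; have i2 := integrable_pmin p3 p4.
pose Q (p : R * R) := M * heat_cst R n *
  (2 * (pmin ((1 - alpha) / 4) (alpha / 4) p.1 * pmin ((3 - alpha) / 4) (alpha / 8) p.2)).
set J1 := \int[lam]_t pmin ((1 - alpha) / 4) (alpha / 4) t.
set J2 := \int[lam]_r pmin ((3 - alpha) / 4) (alpha / 8) r.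
have mQ : measurable_fun setT Q.
  apply: measurable_funM => //; apply: measurable_funM => //; apply: measurable_funM.
    by apply: (measurableT_comp (measurable_pmin _ _)).
  by apply: (measurableT_comp (measurable_pmin _ _)).
have Q0 p : 0 <= Q p.
  by rewrite !mulr_ge0 ?heat_cst_ge0 ?pmin_ge0.
have QE t : \int[lam]_r Q (t, r) = M * heat_cst R n * 2 * J2 * pmin ((1 - alpha) / 4) (alpha / 4) t.
  transitivity (\int[lam]_r ((M * heat_cst R n * 2 * pmin ((1 - alpha) / 4) (alpha / 4) t) *
     pmin ((3 - alpha) / 4) (alpha / 8) r)).
    by apply: eq_Rintegral => r _; rewrite /Q/=; ring.
  by rewrite RintegralZ// -/J2; ring.
have iQr t : lam.-integrable setT (EFin \o (fun r => Q (t, r))).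
  have := integrable_Zl (M * heat_cst R n * 2 * pmin ((1 - alpha) / 4) (alpha / 4) t) i2.
  by apply: eq_integrable => // r _; rewrite /Q/=; congr EFin; ring.
have iQ : (lam \x lam)%E.-integrable setT (EFin \o Q).
  refine (integrable_prodl (m1 := lam) (m2 := lam) (F := Q) mQ
    (integrable_Zl (M * heat_cst R n * 2 * J2) i1) _) => t.
  under eq_integral do rewrite ger0_norm//.
  by rewrite (integral_fineK (iQr t)) QE.
have le12 p : `|F1 p - F2 p| <= Q p.
  case: p => t r; rewrite /F2 /F1 /Q/=.
  have [t0|t0] := leP t 0.
    by rewrite hpow_le0// !(mul0r, mulr0) subr0 normr0 -[X in _ <= X]/(Q (t, r)).
  have [r0|r0] := leP r 0.
    by rewrite [hpow s r]hpow_le0// !(mul0r, mulr0) subr0 normr0 -[X in _ <= X]/(Q (t, r)).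
  have tr0 : 0 < t + r by rewrite addr_gt0.
  have e1 : 0 <= 1 - expR (- r) by rewrite subr_ge0 -expR0 ler_expR oppr_le0 ltW.
  rewrite (_ : _ - _ = hpow a t * hpow s r * (1 - expR (- r)) * g (t + r)); last by ring.
  rewrite normrM ger0_norm; last by rewrite !mulr_ge0 ?hpow_ge0.
  apply: (@le_trans _ _ (hpow a t * hpow s r * (1 - expR (- r)) *
      (M * heat_cst R n * (t + r) `^ (- 2^-1)))).
    by rewrite ler_wpM2l ?normr_heat_div// !mulr_ge0 ?hpow_ge0.
  rewrite mulrCA; apply: ler_wpM2l; first by rewrite mulr_ge0 ?heat_cst_ge0.
  exact: far_le.
have B := Rintegral_le_bound (mu := (lam \x lam)%E)
  (f := fun p => F1 p - F2 p) (g := Q) (measurable_funB mF1 mF2) iQ le12.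
have [_ EQ] := integrable_Rintegral2 iQ.
have E : \int[(lam \x lam)%E]_p Q p = M * heat_cst R n * 2 * J2 * J1.
  rewrite -EQ; under eq_Rintegral do rewrite QE.
  by rewrite RintegralZ.
apply: (le_trans (ler_wpM2l _ B)).
  by rewrite mulr_ge0 ?invr_ge0 ?(ltW Ga) ?(ltW Gs).
rewrite E /far_cst -/a -/J1 -/J2.
by rewrite le_eqVlt; apply/orP; left; apply/eqP; ring.
Qed.

End bessel_average.

(** * Test functions *)

Section flat_functions.
Context {R : realType}.

(** The functions x^(-k) e^(-1/x) extended by 0. The index k makes the family closed under
    differentiation, up to linear combinations. *)
Definition flat (k : nat) (x : R) : R :=
  if 0 < x then x^-1 ^+ k * expR (- x^-1) else 0.

Lemma flat_le0 k x : x <= 0 -> flat k x = 0.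
Proof. by rewrite /flat leNgt => /negbTE ->. Qed.

Lemma flat_ge0 k x : 0 <= flat k x.
Proof.
by rewrite /flat; case: ifPn => // x0; rewrite mulr_ge0 ?expR_ge0 ?exprn_ge0 ?invr_ge0 ?ltW.
Qed.

Lemma flat_le k x : flat k x <= k`!%:R.
Proof.
rewrite /flat; case: ifPn => [x0|_]; last by rewrite ler0n.
rewrite expRN ler_pdivrMr ?expR_gt0//.
case: k => [|k]; first by rewrite expr0 mul1r -[leLHS]expR0 ler_expR invr_ge0 ltW.
rewrite mulrC -ler_pdivrMr ?ltr0n ?fact_gt0//.
apply: le_trans (expR_ge1Dxn k _); first by rewrite lerDr.
by rewrite invr_ge0 ltW.
Qed.

Lemma flat_mul k x : flat k x = x * flat k.+1 x.
Proof.
rewrite /flat; case: ifPn => [x0|_]; last by rewrite mulr0.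
by rewrite exprS !mulrA mulfV ?gt_eqF// mul1r.
Qed.

Lemma normr_flat_le k x : `|flat k x| <= (k.+1)`!%:R * `|x|.
Proof.
rewrite flat_mul normrM mulrC ler_wpM2r// ger0_norm ?flat_ge0//.
exact: flat_le.
Qed.

Lemma flat0_gt0 x : 0 < x -> 0 < flat 0 x.
Proof. by move=> x0; rewrite /flat x0 expr0 mul1r expR_gt0. Qed.

(** At 0 the difference quotient of [flat k] is exactly [flat k.+1], which tends to 0 by the linear
    bound [normr_flat_le]; elsewhere the function is locally elementary. *)
Lemma is_derive_flat (k : nat) (x : R) :
  is_derive x 1 (flat k) (flat k.+2 x - k%:R * flat k.+1 x).
Proof.
have [x0|x0|->] := ltgtP x 0.
- rewrite !(flat_le0 _ (ltW x0)) mulr0 subr0.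
  apply: (@near_eq_is_derive _ _ _ (cst 0)).
  by near=> y; rewrite flat_le0//; apply: ltW; near: y; exact: lt_nbhsl.
- have e : \forall y \near x, y^-1 ^+ k * expR (- y^-1) = flat k y.
    by near=> y; rewrite /flat ifT//; near: y; exact: lt_nbhsr.
  suff D : is_derive x 1 (fun y : R => y^-1 ^+ k * expR (- y^-1))
      (flat k.+2 x - k%:R * flat k.+1 x) by exact: (near_eq_is_derive e D).
  have xn : x != 0 by rewrite gt_eqF.
  have d1 := is_derive_inv xn.
  have d2 : is_derive x 1 (fun y : R => expR (- y^-1)) (expR (- x^-1) * x ^- 2).
    apply: is_derive1_comp.
    by apply: is_derive_eq; rewrite opprK.
  have eX : (@GRing.inv R) ^+ k = (fun y : R => y^-1 ^+ k).
    by apply/funext => y; elim: (k) => [|m IH]; rewrite ?expr0// !exprS -IH.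
  have d3 := is_deriveX k d1; rewrite eX in d3.
  apply: (is_derive_eq (is_deriveM d3 d2)).
  rewrite /flat x0 /GRing.scale/= -exprVn.
  case: (k) => [|m]; first by rewrite !exprS expr0; ring.
  by rewrite !exprS; ring.
- rewrite !flat_le0// mulr0 subr0.
  have c : (h^-1 *: ((flat k \o shift 0) (h *: 1) - flat k 0)) @[h --> 0^'] --> (0 : R).
    apply/cvgrPdist_le => e e0; near=> h.
    have h0 : h != 0 by near: h; exact: nbhs_dnbhs_neq.
    rewrite sub0r normrN [flat k 0]flat_le0// subr0/= addr0 [h *: 1]mulr1.
    have -> : h^-1 *: flat k h = flat k.+1 h.
      by rewrite [flat k h]flat_mul -[LHS]/(h^-1 * (h * flat k.+1 h)) mulKf.
    apply: (le_trans (normr_flat_le _ _)).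
    rewrite -ler_pdivlMl ?ltr0n ?fact_gt0//.
    near: h; apply: nbhs_dnbhs; apply: (@nbhs0_le _ R).
    by rewrite mulr_gt0// invr_gt0 ltr0n fact_gt0.
  by split; [exact: cvgP c|exact: (cvg_lim _ c)].
Unshelve. all: by end_near. Qed.

End flat_functions.

(** * Calculus of C^k functions on R^n *)

Section Ck_calculus.
Context {R : realType} {n : nat}.
Local Notation Rn := 'rV[R]_n.
Local Notation e_ i := (delta_mx ord0 i : Rn).

Lemma Ck_continuous (W : normedModType R) k (f : Rn -> W) : Ck k f -> continuous f.
Proof. by case: k => [|k] []. Qed.

Lemma CkW (W : normedModType R) k (f : Rn -> W) : Ck k.+1 f -> Ck k f.
Proof.
elim: k f => [|k IH] f; first by case.
move=> [cf df]; split => // i; have [d1 d2] := df i.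
by split => //; apply: IH.
Qed.

Lemma Ck_cst (W : normedModType R) k (w : W) : Ck k (fun _ : Rn => w).
Proof.
elim: k w => [|k IH] w; split => //; try exact: cst_continuous.
move=> i; split; first by move=> x; exact: derivable_cst.
rewrite (_ : (fun x => _) = (fun=> (0 : W))); first exact: (IH 0).
by apply/funext => x; exact: derive_cst.
Qed.

Lemma CkD (W : normedModType R) k (f g : Rn -> W) :
  Ck k f -> Ck k g -> Ck k (fun x => f x + g x).
Proof.
elim: k f g => [|k IH] f g [cf df] [cg dg]; split => //;
  try by move=> x; apply: continuousD; [exact: cf|exact: cg].
move=> i; have [df1 df2] := df i; have [dg1 dg2] := dg i; split.
  by move=> x; exact: (derivableD (df1 x) (dg1 x)).
rewrite (_ : (fun x => _) = (fun x => 'D_(e_ i) f x + 'D_(e_ i) g x)).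
  exact: (IH _ _ df2 dg2).
by apply/funext => x; exact: (deriveD (df1 x) (dg1 x)).
Qed.

Lemma CkM k (f g : Rn -> R) : Ck k f -> Ck k g -> Ck k (fun x => f x * g x).
Proof.
elim: k f g => [|k IH] f g Hf Hg.
  by split => // x; apply: continuousM; [exact: Hf.1|exact: Hg.1].
have Wf := CkW Hf; have Wg := CkW Hg; case: Hf => cf df; case: Hg => cg dg.
split; first by move=> x; apply: continuousM; [exact: cf|exact: cg].
move=> i; have [df1 df2] := df i; have [dg1 dg2] := dg i; split.
  by move=> x; exact: (derivableM (df1 x) (dg1 x)).
rewrite (_ : (fun x => _) =
    (fun x => f x * 'D_(e_ i) g x + g x * 'D_(e_ i) f x)).
  exact: (CkD (IH _ _ Wf dg2) (IH _ _ Wg df2)).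
by apply/funext => x; exact: (deriveM (df1 x) (dg1 x)).
Qed.

Lemma Ck_prod k (I : Type) (s : seq I) (F : I -> Rn -> R) :
  (forall i, Ck k (F i)) -> Ck k (fun x => \prod_(i <- s) F i x).
Proof.
move=> H; elim: s => [|a s IH].
  by under eq_fun do rewrite big_nil; exact: Ck_cst.
by under eq_fun do rewrite big_cons; exact: CkM.
Qed.

Lemma Ck_exp k m (f : Rn -> R) : Ck k f -> Ck k (fun x => f x ^+ m).
Proof.
move=> H; elim: m => [|m IH].
  by under eq_fun do rewrite expr0; exact: Ck_cst.
by under eq_fun do rewrite exprS; exact: CkM.
Qed.

Lemma is_derive_linear (W1 W2 : normedModType R) (l : {linear W1 -> W2})
    (f : Rn -> W1) x v : continuous l -> derivable f x v ->
  is_derive x v (fun y => l (f y)) (l ('D_v f x)).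
Proof.
move=> cl df.
have c : h^-1 *: (((fun y => l (f y)) \o shift x) (h *: v) - l (f x)) @[h --> 0^'] -->
    l ('D_v f x).
  have := @cvg_comp _ _ _ _ l _ _ _ df (cl _).
  apply: cvg_trans; apply: near_eq_cvg; near=> h.
  by rewrite /= linearZ linearB.
by split; [exact: cvgP c|exact: cvg_lim c].
Unshelve. all: by end_near. Qed.

Lemma Ck_linear (W1 W2 : normedModType R) (l : {linear W1 -> W2}) k
    (f : Rn -> W1) : continuous l -> Ck k f -> Ck k (fun x => l (f x)).
Proof.
move=> cl; elim: k f => [|k IH] f [cf df].
  by split => // x; apply: continuous_comp; [exact: cf|exact: cl].
split; first by move=> x; apply: continuous_comp; [exact: cf|exact: cl].
move=> i; have [df1 df2] := df i; split.
  by move=> x; apply: ex_derive; exact: is_derive_linear.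
rewrite (_ : (fun x => _) = fun x => l ('D_(e_ i) f x)); first exact: (IH _ df2).
by apply/funext => x; have /@derive_val := is_derive_linear cl (df1 x).
Qed.

Lemma Ck_shift (W : normedModType R) k (f : Rn -> W) (z : Rn) :
  Ck k f -> Ck k (fun x => f (x + z)).
Proof.
elim: k f => [|k IH] f [cf df].
  split => // x; apply: (@continuous_comp _ _ _ (fun y : Rn => y + z) f); last exact: cf.
  by apply: continuousD; [exact: cvg_id|exact: cst_continuous].
split.
  move=> x; apply: (@continuous_comp _ _ _ (fun y : Rn => y + z) f); last exact: cf.
  by apply: continuousD; [exact: cvg_id|exact: cst_continuous].
have E i x : (fun h : R => h^-1 *: (((fun y => f (y + z)) \o shift x) (h *: e_ i) - f (x + z))) =
   (fun h : R => h^-1 *: ((f \o shift (x + z)) (h *: e_ i) - f (x + z))).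
  by apply/funext => h /=; rewrite addrA.
move=> i; have [df1 df2] := df i; split.
  by move=> x; rewrite /derivable E; exact: df1.
rewrite (_ : (fun x => _) = fun x => 'D_(e_ i) f (x + z)); first exact: (IH _ df2).
by apply/funext => x; rewrite /derive E.
Qed.

(** A partial derivative involves [flat m.+2] and [flat m.+1], so the induction on k is run for all
    m at once. *)
Lemma Ck_flat (c s : R) (j : 'I_n) k m :
  Ck k (fun x : Rn => flat m (c + s * x ord0 j)).
Proof.
have cc m' : continuous (fun x : Rn => flat m' (c + s * x ord0 j)).
  move=> x; apply: (@continuous_comp _ _ _ (fun y : Rn => c + s * y ord0 j) (flat m')).
    apply: continuousD; first exact: cst_continuous.
    by apply: continuousM; [exact: cst_continuous|exact: coord_continuous].
  apply: differentiable_continuous; apply/derivable1_diffP.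
  by apply: ex_derive; exact: is_derive_flat.
elim: k m => [|k IH] m; first by split.
split; first exact: cc.
move=> i.
have D x : is_derive x (e_ i) (fun x : Rn => flat m (c + s * x ord0 j))
   ((i == j)%:R * s * (flat m.+2 (c + s * x ord0 j) - m%:R * flat m.+1 (c + s * x ord0 j))).
  set y := c + s * x ord0 j.
  have d : is_derive (0 : R) 1 (fun h : R => flat m (((i == j)%:R * s) * h + y))
      ((i == j)%:R * s * (flat m.+2 y - m%:R * flat m.+1 y)).
    have d1 : is_derive (0 : R) 1 (fun h : R => ((i == j)%:R * s) * h + y) ((i == j)%:R * s).
      by apply: is_derive_eq; rewrite addr0 /GRing.scale/= mulr1.
    have d2 : is_derive (((i == j)%:R * s) * 0 + y) 1 (flat m) (flat m.+2 y - m%:R * flat m.+1 y).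
      by rewrite mulr0 add0r; exact: is_derive_flat.
    apply: (is_derive_eq (@is_derive1_comp R (flat m)
      (fun h : R => ((i == j)%:R * s) * h + y) 0 _ _ d2 d1)).
    by rewrite mulrC.
  (* The directional quotient at x is the quotient at 0 of a one-variable function, so derivability
     and the value of the derivative transfer directly. *)
  have E : (fun h : R => h^-1 *: (((fun x : Rn => flat m (c + s * x ord0 j)) \o shift x) (h *: e_ i)
       - flat m (c + s * x ord0 j))) =
     (fun h : R => h^-1 *: (((fun h : R => flat m (((i == j)%:R * s) * h + y)) \o shift 0) (h *: 1)
       - flat m (((i == j)%:R * s) * 0 + y))).
    apply/funext => h /=; rewrite mulr0 add0r addr0 !mxE eqxx/= [h *: 1]mulr1.
    congr (_ *: (flat m _ - _)); rewrite /y eq_sym; ring.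
  split; first by rewrite /derivable E; case: d.
  by rewrite /derive E; case: d => _ <-.
split; first by move=> x; exact: ex_derive.
rewrite (_ : (fun x => _) = (fun x : Rn => (i == j)%:R * s * (flat m.+2 (c + s * x ord0 j) +
    (- m%:R) * flat m.+1 (c + s * x ord0 j)))).
  apply: CkM; first exact: Ck_cst.
  apply: CkD; first exact: IH.
  by apply: CkM; [exact: Ck_cst|exact: IH].
by apply/funext => x; have /@derive_val -> := D x; rewrite mulNr.
Qed.

Lemma smooth_scale_vec (g : Rn -> R) (v : Rn) :
  smooth g -> smooth (fun x => g x *: v).
Proof.
move=> sg k.
have lin : linear (fun r : R^o => r *: v : Rn).
  by move=> a u w; rewrite scalerDl scalerA.
pose l : {linear R^o -> Rn} := HB.pack (fun r : R^o => r *: v : Rn)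
  (GRing.isLinear.Build _ _ _ _ _ lin).
apply: (@Ck_linear R^o Rn l k g) => //.
by move=> r; apply: continuousZr_tmp; exact: cvg_id.
Qed.

Lemma smooth_coord (phi : Rn -> Rn) j :
  smooth phi -> smooth (fun x => phi x ord0 j).
Proof.
move=> sphi k.
have ladd : linear (fun y : Rn => y ord0 j : R^o).
  by move=> a u v; rewrite !mxE.
pose l : {linear Rn -> R^o} := HB.pack (fun y : Rn => y ord0 j : R^o)
  (GRing.isLinear.Build _ _ _ _ _ ladd).
by apply: (@Ck_linear Rn R^o l k phi) => //; exact: coord_continuous.
Qed.

Lemma smoothM (f g : Rn -> R) : smooth f -> smooth g -> smooth (fun x => f x * g x).
Proof. by move=> sf sg k; exact: CkM. Qed.

Lemma smoothD (W : normedModType R) (f g : Rn -> W) :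
  smooth f -> smooth g -> smooth (fun x => f x + g x).
Proof. by move=> sf sg k; exact: CkD. Qed.

Lemma smooth_cst (W : normedModType R) (w : W) : smooth (fun _ : Rn => w).
Proof. by move=> k; exact: Ck_cst. Qed.

Lemma smooth_shift (W : normedModType R) (f : Rn -> W) z :
  smooth f -> smooth (fun x => f (x + z)).
Proof. by move=> sf k; exact: Ck_shift. Qed.

Lemma smooth_onem (f : Rn -> R) : smooth f -> smooth (fun x => 1 - f x).
Proof.
move=> sf; rewrite (_ : (fun x => _) = fun x => 1 + (- 1) * f x); last first.
  by apply/funext => x; rewrite mulN1r.
by apply: smoothD; [exact: smooth_cst|apply: smoothM => //; exact: smooth_cst].
Qed.

End Ck_calculus.

Lemma norm_gt_near (R : realType) (V : normedModType R) (x : V) (M : R) :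
  M < `|x| -> \forall y \near x, M < `|y|.
Proof.
move=> Mx; have h := @norm_continuous R V x.
exact: (@cvgr_gt _ _ _ _ (fun y : V => `|y|) _ h M Mx).
Qed.

(** * Compactly supported smooth functions: bounds and bumps *)

Section test_functions.
Context {R : realType} {n : nat}.
Local Notation Rn := 'rV[R]_n.
Local Notation e_ i := (delta_mx ord0 i : Rn).

Lemma bounded_rVP (A : set Rn) :
  bounded_set A <-> exists M : R, forall x, A x -> `|x| <= M.
Proof.
split => [[M [_ H]]|[M H]].
  by exists (M + 1) => x Ax; apply: H => //; rewrite ltrDl.
exists M; split; first exact: num_real.
by move=> y My x Ax; apply: le_trans (H _ Ax) (ltW My).
Qed.

(** Heine-Borel: compact support is handled from here on as a bound on the norm over the set where
    the function is nonzero. *)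
Lemma compact_closure_rVP (A : set Rn) :
  compact (closure A) <-> exists M : R, forall x, A x -> `|x| <= M.
Proof.
split => [/compact_bounded/bounded_rVP[M H]|[M H]].
  by exists M => x Ax; apply: H; exact: subset_closure.
apply: bounded_closed_compact; last exact: closed_closure.
apply/bounded_rVP; exists M => x.
have cM : closed [set y : Rn | `|y| <= M].
  apply: (@closed_comp _ _ (fun y : Rn => `|y|) [set r | r <= M]).
    by move=> y _; exact: norm_continuous.
  exact: closed_le.
by rewrite closureEbigcap => /(_ _ (conj cM H)).
Qed.

Lemma test_fieldP (phi : Rn -> Rn) : test_field phi <->
  smooth phi /\ exists M : R, forall x, phi x != 0 -> `|x| <= M.
Proof. by split => -[sphi /compact_closure_rVP H]; split. Qed.

Definition test_function (g : Rn -> R) : Prop :=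
  smooth g /\ exists M : R, forall x, g x != 0 -> `|x| <= M.

Lemma test_field_shift (phi : Rn -> Rn) z :
  test_field phi -> test_field (fun x => phi (x + z)).
Proof.
move=> /test_fieldP[sphi [M H]]; apply/test_fieldP; split; first exact: smooth_shift.
exists (M + `|z|) => x /H; rewrite -lerBlDr; apply: le_trans.
by rewrite -{1}[x](addrK z) lerBlDr; exact: ler_normB.
Qed.

Lemma test_field_coord (phi : Rn -> Rn) j :
  test_field phi -> test_function (fun x => phi x ord0 j).
Proof.
move=> /test_fieldP[sphi [M H]]; split; first exact: smooth_coord.
by exists M => x xj; apply: H; apply: contra xj => /eqP ->; rewrite mxE.
Qed.

Lemma test_function_vec (g : Rn -> R) (v : Rn) :
  test_function g -> test_field (fun x => g x *: v).
Proof.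
move=> [sg [M H]]; apply/test_fieldP; split; first exact: smooth_scale_vec.
by exists M => x xj; apply: H; apply: contra xj => /eqP ->; rewrite scale0r.
Qed.

Lemma test_fieldD (phi psi : Rn -> Rn) :
  test_field phi -> test_field psi -> test_field (fun x => phi x + psi x).
Proof.
move=> /test_fieldP[sphi [M H]] /test_fieldP[spsi [N K]]; apply/test_fieldP.
split; first exact: smoothD.
exists (Num.max M N) => x xj; rewrite le_max.
have [p0|/H ->//] := eqVneq (phi x) 0.
by rewrite K ?orbT//; apply: contra xj => /eqP ->; rewrite p0 addr0.
Qed.

Lemma test_field0 : test_field (fun _ : Rn => 0 : Rn).
Proof.
apply/test_fieldP; split; first exact: smooth_cst.
by exists 0 => x; rewrite eqxx.
Qed.

Lemma test_field_sum (I : Type) (s : seq I) (F : I -> Rn -> Rn) :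
  (forall i, test_field (F i)) -> test_field (fun x => \sum_(i <- s) F i x).
Proof.
move=> H; elim: s => [|a s IH].
  by under eq_fun do rewrite big_nil; exact: test_field0.
by under eq_fun do rewrite big_cons; exact: test_fieldD.
Qed.

Lemma test_fieldE (phi : Rn -> Rn) :
  phi = (fun x => \sum_(j <- enum 'I_n) phi x ord0 j *: e_ j).
Proof.
apply/funext => x; rewrite {1}[phi x]row_sum_delta big_enum/=.
by [].
Qed.

Lemma compact_support_bounded (W : normedModType R) (f : Rn -> W) (M : R) :
  continuous f -> (forall x, f x != 0 -> `|x| <= M) ->
  exists2 K, 0 <= K & forall x, `|f x| <= K.
Proof.
move=> cf H.
have cC : compact (closure [set x | f x != 0]) by apply/compact_closure_rVP; exists M.
have /continuous_compact/(_ cC)/compact_bounded[K0 [_ HK]] :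
    {within closure [set x | f x != 0], continuous f}.
  exact: continuous_subspaceT.
exists (`|K0| + 1) => [|x]; first by rewrite addr_ge0.
have [->|x0] := eqVneq (f x) 0; first by rewrite normr0 addr_ge0.
apply: HK; first by rewrite (le_lt_trans (ler_norm _))// ltrDl.
by exists x => //; apply: subset_closure.
Qed.

Lemma line_lipschitz (f : Rn -> R) (K : R) (i : 'I_n) :
  continuous f -> (forall x, derivable f x (e_ i)) ->
  (forall x, `|'D_(e_ i) f x| <= K) ->
  forall (x : Rn) (s : R), `|f (x + s *: e_ i) - f x| <= K * `|s|.
Proof.
move=> cf df dK.
have pos (x : Rn) (s : R) : 0 < s -> `|f (x + s *: e_ i) - f x| <= K * s.
  move=> s0.
  pose g (r : R) := f (x + r *: e_ i).
  have dg (r : R) : is_derive r 1 g ('D_(e_ i) f (x + r *: e_ i)).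
    have E : (fun h : R => h^-1 *: ((g \o shift r) (h *: 1) - g r)) =
       (fun h : R => h^-1 *: ((f \o shift (x + r *: e_ i)) (h *: e_ i) - f (x + r *: e_ i))).
      apply/funext => h /=; rewrite /g [h *: 1]mulr1 scalerDl.
      by rewrite addrCA.
    split; first by rewrite /derivable E; exact: df.
    by rewrite /derive E.
  have cg : {within `[0, s], continuous g}.
    apply: continuous_subspaceT => r.
    by apply: differentiable_continuous; apply/derivable1_diffP; exact: ex_derive.
  have [c _] := MVT s0 (fun r _ => dg r) cg.
  rewrite /g scale0r addr0 subr0 => ->.
  by rewrite normrM (gtr0_norm s0) ler_wpM2r// ltW.
move=> x s; have [s0|s0|->] := ltgtP s 0.
- have := pos (x + s *: e_ i) (- s); rewrite oppr_gt0 => /(_ s0).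
  rewrite scaleNr addrK distrC => h.
  by rewrite (ltr0_norm s0).
- by rewrite (gtr0_norm s0) pos.
- by rewrite scale0r addr0 subrr !normr0 mulr0.
Qed.

(** The path from x to y moves along one coordinate axis at a time, and [line_lipschitz] controls
    each move. *)
Lemma C1_lipschitz (f : Rn -> R) (K : R) : Ck 1 f ->
  (forall i x, `|'D_(e_ i) f x| <= K) ->
  forall x y, `|f y - f x| <= K * \sum_i `|(y - x) ord0 i|.
Proof.
move=> [cf df] dK x y.
have H (s : seq 'I_n) : `|f (x + \sum_(i <- s) (y - x) ord0 i *: e_ i) - f x| <=
    K * \sum_(i <- s) `|(y - x) ord0 i|.
  elim: s => [|i s IH]; first by rewrite !big_nil addr0 subrr normr0 mulr0.
  rewrite !big_cons mulrDr [x + _]addrCA [_ *: _ + (x + _)]addrC.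
  set w := x + _ in IH *; set c := (y - x) ord0 i in IH *.
  rewrite (_ : f _ - f x = (f (w + c *: e_ i) - f w) + (f w - f x)); last first.
    by ring.
  rewrite (le_trans (ler_normD _ _))// lerD//.
  apply: line_lipschitz => //; first by have [] := df i.
have := H (index_enum 'I_n).
by rewrite -row_sum_delta [x + _]addrC subrK.
Qed.

Lemma test_field_bounded (phi : Rn -> Rn) : test_field phi ->
  exists2 M, 0 <= M & forall x, enorm (phi x) <= M.
Proof.
move=> /test_fieldP[sphi [M H]].
have [K K0 HK] := compact_support_bounded (Ck_continuous (sphi 0)) H.
exists (n%:R * K) => [|x]; first by rewrite mulr_ge0.
by rewrite (le_trans (enorm_le_norm _))// ler_wpM2l.
Qed.

Lemma derive_support (f : Rn -> R) (M : R) i :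
  (forall x, f x != 0 -> `|x| <= M) ->
  forall x, 'D_(e_ i) f x != 0 -> `|x| <= M.
Proof.
move=> H x; apply: contraTT; rewrite -ltNge => Mx.
rewrite negbK; apply/eqP.
rewrite -(derive_cst (0 : R) x (e_ i)); apply: near_eq_derive.
have : \forall y \near x, M < `|y|.
  exact: norm_gt_near.
apply: filterS => y My; apply/eqP; apply: contraTT My => /H.
by rewrite -leNgt.
Qed.

Lemma test_field_continuous (phi : Rn -> Rn) : test_field phi -> continuous phi.
Proof. by move=> [sphi _]; exact: (Ck_continuous (sphi 0)). Qed.

Lemma measurable_continuous (phi : Rn -> Rn) : continuous phi -> measurable_fun setT phi.
Proof.
move=> cphi; apply: measurable_fun_rV => i; apply: continuous_measurable_rV => x.
apply: (@continuous_comp _ _ _ phi (fun v : Rn => v ord0 i)); first exact: cphi.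
exact: coord_continuous.
Qed.

Lemma test_field_lipschitz (phi : Rn -> Rn) : test_field phi ->
  exists2 L, 0 <= L & forall x y, enorm (phi y - phi x) <= L * enorm (y - x).
Proof.
move=> tphi.
have [K HK] : exists K, forall j i x, `|'D_(e_ i) (fun x => phi x ord0 j) x| <= K.
  have h (p : 'I_n * 'I_n) : exists K, forall x,
      `|'D_(e_ p.2) (fun x => phi x ord0 p.1) x| <= K.
    have [sg [M H]] := test_field_coord p.1 tphi.
    have [_ /(_ p.2)[_ cD]] := sg 1%N.
    have [K K0 HK] := compact_support_bounded cD.1 (derive_support (i := p.2) H).
    by exists K.
  exists (\sum_p `|projT1 (cid (h p))|) => j i x.
  rewrite (bigD1 (j, i))//= ler_wpDr ?sumr_ge0//.
  by case: cid => K /= HK; exact: le_trans (HK x) (ler_norm _).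
have K0 : 0 <= n%:R * (`|K| * n%:R) by rewrite !mulr_ge0.
exists (n%:R * (`|K| * n%:R)) => // x y.
apply: (le_trans (enorm_le_sum _)).
apply: (@le_trans _ _ (\sum_(j < n) (`|K| * (n%:R * enorm (y - x))))).
  apply: ler_sum => j _; rewrite !mxE.
  have [sg _] := test_field_coord j tphi.
  apply: le_trans (C1_lipschitz (sg 1%N) (HK j) x y) _.
  apply: ler_pM => //.
  - by apply: le_trans (HK j j 0); exact: normr_ge0.
  - by rewrite sumr_ge0.
  - exact: ler_norm.
  - apply: (@le_trans _ _ (\sum_(i < n) enorm (y - x))).
      by apply: ler_sum => i _; exact: normr_coord_le_enorm.
    by rewrite sumr_const card_ord mulr_natl.
by rewrite sumr_const card_ord -[leLHS]mulr_natl !mulrA.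
Qed.

Lemma test_field_bounded_lipschitz (phi : Rn -> Rn) (M : R) : test_field phi ->
  (forall x, enorm (phi x) <= M) -> exists L, bounded_lipschitz phi M L.
Proof.
move=> tphi pM; have [L L0 HL] := test_field_lipschitz tphi.
exists L; split => //; apply: measurable_continuous.
exact: test_field_continuous.
Qed.

(** Positive exactly on the open cube of centre c and half-side r, that is, on a ball of the library
    norm. The affine arguments are written in the form expected by [Ck_flat]. *)
Definition cube_bump (c : Rn) (r : R) (x : Rn) : R :=
  \prod_(i < n) (flat 0 ((r + c ord0 i) + (- 1) * x ord0 i) *
                 flat 0 ((r - c ord0 i) + 1 * x ord0 i)).

Lemma smooth_bump c r : smooth (cube_bump c r).
Proof.
move=> k; rewrite /cube_bump; apply: (@Ck_prod _ _ k _ (index_enum 'I_n)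
  (fun i x => flat 0 ((r + c ord0 i) + (- 1) * x ord0 i) *
                 flat 0 ((r - c ord0 i) + 1 * x ord0 i))) => i.
by apply: CkM; exact: Ck_flat.
Qed.

Let flat01 (y : R) : 0 <= flat 0 y <= 1.
Proof. by rewrite flat_ge0/= (le_trans (flat_le _ _)). Qed.

Lemma bump01 c r x : 0 <= cube_bump c r x <= 1.
Proof.
rewrite /cube_bump; elim/big_ind : _ => //; first by rewrite ler01 lexx.
  by move=> u v /andP[u0 u1] /andP[v0 v1]; rewrite mulr_ge0//= mulr_ile1.
move=> i _; have /andP[u0 u1] := flat01 (r + c ord0 i + -1 * x ord0 i).
have /andP[v0 v1] := flat01 (r - c ord0 i + 1 * x ord0 i).
by rewrite mulr_ge0//= mulr_ile1.
Qed.

Lemma bump_gt0 c r x : 0 < r -> (cube_bump c r x != 0) = (`|x - c| < r).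
Proof.
move=> r0.
have -> : (`|x - c| < r) = [forall i, `|(x - c) ord0 i| < r].
  rewrite [`|x - c|]mx_normrE; apply/idP/forallP => [h i|h].
    by apply: le_lt_trans h; exact: (le_bigmax _ _ (ord0, i)).
  by apply: bigmax_lt => // -[i j] _; rewrite ord1/=.
have flatE (y : R) : (flat 0 y != 0) = (0 < y).
  have [y0|y0] := leP y 0; first by rewrite flat_le0// eqxx.
  by rewrite gt_eqF ?flat0_gt0.
rewrite /cube_bump; apply/prodf_neq0/forallP => [h i|h i _].
  have := h i isT; rewrite mulf_eq0 negb_or !flatE !mxE ltr_norml => /andP[? ?].
  by apply/andP; split; lra.
have := h i; rewrite !mxE ltr_norml => /andP[? ?].
by rewrite mulf_neq0// flatE; lra.
Qed.

Lemma test_function_bump c r : 0 < r -> test_function (cube_bump c r).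
Proof.
move=> r0; split; first exact: smooth_bump.
exists (r + `|c|) => x; rewrite bump_gt0// => /ltW h.
by rewrite -[x](subrK c) (le_trans (ler_normD _ _))// lerD.
Qed.

End test_functions.

(** * Approximation by test functions *)

Section finite_measure_integrals.
Context d (T : measurableType d) {R : realType} (mu : {finite_measure set T -> \bar R}).

Lemma integrable_bounded (f : T -> R) (C : R) : measurable_fun setT f ->
  (forall x, `|f x| <= C) -> mu.-integrable setT (EFin \o f).
Proof.
move=> mf fC; apply: (integrable_le mf _ fC).
exact: finite_measure_integrable_cst.
Qed.

Lemma Rintegral_indic (A : set T) : measurable A ->
  \int[mu]_x (\1_A x) = fine (mu A).
Proof. by move=> mA; rewrite /Rintegral integral_indic// setIT. Qed.

Lemma integrable_indicator (A : set T) : measurable A ->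
  mu.-integrable setT (EFin \o (\1_A : T -> R)).
Proof.
move=> mA; apply: (@integrable_bounded _ 1); first exact: measurable_indic.
by move=> x; rewrite indicE; case: (_ \in _); rewrite ?normr1 ?normr0.
Qed.

Lemma le_Rintegral_mu (f g : T -> R) : mu.-integrable setT (EFin \o f) ->
  mu.-integrable setT (EFin \o g) -> (forall x, f x <= g x) ->
  \int[mu]_x f x <= \int[mu]_x g x.
Proof. by move=> jf jg fg; exact: le_Rintegral. Qed.

Lemma bounded_cvg_Rintegral (F : nat -> T -> R) (f : T -> R) (C : R) :
  (forall N, measurable_fun setT (F N)) -> measurable_fun setT f ->
  (forall N x, `|F N x| <= C) -> (forall x, F N x @[N --> \oo] --> f x) ->
  (\int[mu]_x F N x) @[N --> \oo] --> \int[mu]_x f x.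
Proof.
move=> mF mf FC Ff.
have fC x : `|f x| <= C.
  have /cvg_norm h := Ff x.
  rewrite -(cvg_lim _ h)//; apply: limr_le; first exact: cvgP h.
  exact: nearW.
have jf := integrable_bounded mf fC.
have h : (\int[mu]_x (F N x)%:E)%E @[N --> \oo] --> (\int[mu]_x (f x)%:E)%E.
  apply: (@dominated_cvg _ _ _ mu setT measurableT _ _ (fun=> C%:E)).
  - by move=> N; exact/measurable_EFinP.
  - by move=> x _; apply: cvg_EFin; [exact: nearW|exact: Ff].
  - by [].
  - exact: finite_measure_integrable_cst.
  - by move=> N x _; rewrite lee_fin.
apply: (@fine_cvg _ _ _ _ (fun N => \int[mu]_x (F N x)%:E)%E).
by rewrite (integral_fineK jf) in h *.
Qed.

End finite_measure_integrals.

Section approximation.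
Context {R : realType} {n : nat}.
Local Notation Rn := 'rV[R]_n.

Definition test01 (g : Rn -> R) : Prop :=
  test_function g /\ forall x, 0 <= g x <= 1.

Lemma measurable_smooth (g : Rn -> R) : smooth g -> measurable_fun setT g.
Proof. by move=> sg; apply: continuous_measurable_rV; exact: (Ck_continuous (sg 0%N)). Qed.

Lemma measurable_test01 g : test01 g -> measurable_fun setT g.
Proof. by move=> [[sg _] _]; exact: measurable_smooth. Qed.

Lemma test01_bump c r : 0 < r -> test01 (cube_bump c r).
Proof. by move=> r0; split; [exact: test_function_bump|exact: bump01]. Qed.

Lemma test01_0 : test01 (fun=> 0).
Proof.
split; last by move=> x; rewrite lexx ler01.
by split; [exact: smooth_cst|exists 0 => x; rewrite eqxx].
Qed.

Lemma test01_mull (f g : Rn -> R) : smooth f -> (forall x, 0 <= f x <= 1) ->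
  test01 g -> test01 (fun x => f x * g x).
Proof.
move=> sf f01 [[sg [M H]] g01]; split; last first.
  move=> x; have /andP[? ?] := f01 x; have /andP[? ?] := g01 x.
  by rewrite mulr_ge0//= mulr_ile1.
split; first exact: smoothM.
by exists M => x fg; apply: H; apply: contra fg => /eqP ->; rewrite mulr0.
Qed.

(** A smooth substitute for the indicator of the union of the sets {g_j > 0}: a large exponent m
    drives the value to 1 wherever some g_j is positive, and the value is 0 where all vanish. *)
Lemma test01_union (g : nat -> Rn -> R) (k m : nat) : (forall j, test01 (g j)) ->
  test01 (fun x => 1 - \prod_(j < k) (1 - g j x) ^+ m).
Proof.
move=> tg.
have P01 x : 0 <= \prod_(j < k) (1 - g j x) ^+ m <= 1.
  elim/big_ind : _ => //; first by rewrite ler01 lexx.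
    by move=> u v /andP[? ?] /andP[? ?]; rewrite mulr_ge0//= mulr_ile1.
  move=> j _; have [_ /(_ x)/andP[? ?]] := tg j.
  by rewrite exprn_ge0 ?subr_ge0//= exprn_ile1 ?subr_ge0// gerBl.
split; last by move=> x; have /andP[? ?] := P01 x; rewrite subr_ge0 gerBl; apply/andP.
split.
  apply: smooth_onem => l.
  apply: (@Ck_prod _ _ l _ (index_enum 'I_k) (fun j x => (1 - g j x) ^+ m)) => j.
  by apply: Ck_exp; apply: smooth_onem; have [[]] := tg j.
have h j : exists M : R, forall x, g j x != 0 -> `|x| <= M by have [[]] := tg j.
exists (\sum_(j < k) `|projT1 (cid (h j))|) => x; apply: contraTT; rewrite -ltNge negbK => xM.
have -> : \prod_(j < k) (1 - g j x) ^+ m = 1; last by rewrite subrr.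
apply: big1 => j _.
have -> : g j x = 0; last by rewrite subr0 expr1n.
apply/eqP; apply: contraTT xM => gj0; rewrite -leNgt.
apply: (@le_trans _ _ `|projT1 (cid (h j))|).
  by case: cid => M /= HM; rewrite (le_trans (HM _ gj0))// ler_norm.
by rewrite (bigD1 j)//= lerDl sumr_ge0.
Qed.

(** A countable family of bumps on rational cubes contained in U. Codes that do not describe such a
    cube give the zero function, so the family is indexed by all of nat. *)
Let rat_ball (U : set Rn) (k : nat) : Rn -> R :=
  if unpickle k is Some (q, r) then
    if `[< 0 < (ratr r : R) /\ ball (map_mx ratr (q : 'rV[rat]_n) : Rn) (ratr r : R) `<=` U >]
    then cube_bump (map_mx ratr q) (ratr r) else fun=> 0
  else fun=> 0.

Let test01_rat_ball U k : test01 (rat_ball U k).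
Proof.
rewrite /rat_ball; case: unpickle => [[q r]|]; last exact: test01_0.
case: asboolP => [[r0 _]|_]; [exact: test01_bump|exact: test01_0].
Qed.

Let rat_ball_out U k x : ~ U x -> rat_ball U k x = 0.
Proof.
rewrite /rat_ball; case: unpickle => [[q r]|//] Ux.
case: asboolP => [[r0 BU]|//]; apply: contrapT => /eqP h; apply: Ux; apply: BU.
by rewrite mx_norm_ball /ball_ /= distrC -bump_gt0.
Qed.

Let rat_ball_in U x : open U -> U x -> exists k, 0 < rat_ball U k x.
Proof.
move=> oU Ux.
have /nbhs_ballP[e /= e0 eU] : nbhs x U by exact: open_nbhs_nbhs.
have e20 : 0 < e / 2 by rewrite divr_gt0.
have [r /= /itvP re] := rat_in_itvoo e20.
have r0 : 0 < (ratr r : R) by rewrite re.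
have H i : exists q : rat, `|x ord0 i - ratr q| < ratr r.
  have [q /itvP qi] : exists q : rat,
      ratr q \in `](x ord0 i - ratr r), (x ord0 i + ratr r)[.
    by apply: rat_in_itvoo; rewrite ltrBlDr -addrA ltrDl addr_gt0.
  exists q; have h1 : x ord0 i - ratr r < ratr q by rewrite qi.
  have h2 : ratr q < x ord0 i + ratr r by rewrite qi.
  by rewrite ltr_norml; apply/andP; split; lra.
pose q : 'rV[rat]_n := \row_i projT1 (cid (H i)).
have xq : `|x - map_mx ratr q| < ratr r.
  rewrite [`|_|]mx_normrE; apply: bigmax_lt => // -[i j] _ /=.
  by rewrite !mxE ord1; case: cid.
exists (pickle (q, r)); rewrite /rat_ball pickleK; case: asboolP => [_|[]]; last first.
  split => // y; rewrite mx_norm_ball /ball_/= => qy.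
  apply: eU; rewrite mx_norm_ball /ball_/=.
  rewrite -(subrKA (map_mx ratr q)) (le_lt_trans (ler_normD _ _))//.
  rewrite [e]splitr ltrD//; first by rewrite (lt_trans xq)// re.
  by rewrite (lt_trans qy)// re.
have /andP[b0 _] := bump01 (map_mx ratr q) (ratr r) x.
by rewrite lt_neqAle b0 andbT eq_sym bump_gt0.
Qed.

Variable mu : {finite_measure set Rn -> \bar R}.

(** The index N is both the number of bumps, which exhausts U, and the exponent, which drives the
    approximant to 1 where one bump is positive. The conclusion follows by bounded convergence. *)
Lemma open_approx (U : set Rn) (e : R) : open U -> 0 < e ->
  exists g, [/\ test01 g, forall x, ~ U x -> g x = 0 &
    \int[mu]_x `|\1_U x - g x| < e].
Proof.
move=> oU e0.
pose g (N : nat) x := 1 - \prod_(j < N) (1 - rat_ball U j x) ^+ N.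
have tg N : test01 (g N) by apply: test01_union; exact: test01_rat_ball.
have g0 N x : ~ U x -> g N x = 0.
  move=> Ux; rewrite /g big1 ?subrr// => j _.
  by rewrite rat_ball_out// subr0 expr1n.
have mU : measurable U by exact: sub_sigma_algebra.
pose F N x := `|\1_U x - g N x|.
have mF N : measurable_fun setT (F N).
  apply: measurableT_comp => //; apply: measurable_funB; first exact: measurable_indic.
  exact: measurable_test01.
have F1 N x : F N x <= 1.
  have [_ /(_ x)/andP[h1 h2]] := tg N; rewrite /F indicE.
  by case: (_ \in _); rewrite ler_norml ?mulr1n ?mulr0n/=; apply/andP; split; lra.
have Fcvg x : F N x @[N --> \oo] --> (0 : R).
  have [Ux|Ux] := pselect (U x); last first.
    rewrite /F indicE memNset//.
    under eq_fun do rewrite g0// subrr normr0.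
    exact: cvg_cst.
  have [k k0] := rat_ball_in oU Ux.
  have /andP[_ k1] := (test01_rat_ball U k).2 x.
  pose q := 1 - rat_ball U k x.
  have q0 : 0 <= q by rewrite subr_ge0.
  have q1 : `|q| < 1 by rewrite ger0_norm// /q ltrBlDr ltrDl.
  apply: (squeeze_cvgr (f := fun=> 0) (h := fun N => q ^+ N)); last 2 first.
  - exact: cvg_cst.
  - exact: cvg_expr.
  near=> N; rewrite normr_ge0/= /F indicE mem_set//= /g opprB addrC subrK.
  have kN : (k < N)%N by near: N; exists k.+1.
  rewrite (bigD1 (Ordinal kN))//= ger0_norm; last first.
    rewrite mulr_ge0 ?exprn_ge0//; apply: prodr_ge0 => j _.
    by rewrite exprn_ge0// subr_ge0; have /andP[] := (test01_rat_ball U j).2 x.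
  rewrite ler_piMr ?exprn_ge0// prodr_ile1// => j _.
  have /andP[? ?] := (test01_rat_ball U j).2 x.
  by rewrite exprn_ge0 ?subr_ge0//= exprn_ile1 ?subr_ge0// gerBl.
have : (\int[mu]_x F N x) @[N --> \oo] --> (0 : R).
  rewrite (_ : 0 = \int[mu]_x (fun=> 0 : R) x); last by rewrite Rintegral_cst// mul0r.
  apply: (@bounded_cvg_Rintegral _ _ _ mu F (fun=> 0) 1) => // N x.
  by rewrite /F normr_id; exact: F1.
move=> /cvgrPdist_lt /(_ _ e0)[N _ /(_ N (leqnn N))].
rewrite sub0r normrN => h; exists (g N); split; [exact: tg|exact: g0|].
by apply: le_lt_trans h; exact: ler_norm.
Unshelve. all: by end_near. Qed.

Let dist (A : set Rn) (g : Rn -> R) x := `|\1_A x - g x|.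

Let measurable_dist A g : measurable A -> test01 g -> measurable_fun setT (dist A g).
Proof.
move=> mA tg; apply: measurableT_comp => //; apply: measurable_funB.
  exact: measurable_indic.
exact: measurable_test01.
Qed.

Let indic01 (A : set Rn) x : 0 <= (\1_A x : R) <= 1.
Proof. by rewrite indicE; case: (_ \in _); rewrite ?ler01 ?lexx. Qed.

Let dist_le1 A g x : test01 g -> `|dist A g x| <= 1.
Proof.
move=> tg; have /andP[? ?] := tg.2 x; have /andP[? ?] := indic01 A x.
by rewrite /dist normr_id ler_norml; apply/andP; split; lra.
Qed.

Let integrable_dist A g : measurable A -> test01 g ->
  mu.-integrable setT (EFin \o dist A g).
Proof.
move=> mA tg; apply: (integrable_bounded mu (measurable_dist mA tg)) => x.
exact: dist_le1.
Qed.

Let approximable (A : set Rn) : Prop := measurable A /\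
  forall e : R, 0 < e -> exists2 g, test01 g & \int[mu]_x dist A g x < e.

(** The natural candidate 1 - g has no compact support; it is multiplied by a test function [chi]
    that is close to 1 in mean. *)
Let approximableC A : approximable A -> approximable (~` A).
Proof.
move=> [mA H]; split; first exact: measurableC.
move=> e e0; have e2 : 0 < e / 2 by rewrite divr_gt0.
have [g tg gA] := H _ e2; have [chi [tchi _ chiT]] := open_approx openT e2.
have tf : test01 (fun x => (1 - g x) * chi x).
  apply: test01_mull => //; first by apply: smooth_onem; case: tg => -[].
  by move=> x; have /andP[? ?] := tg.2 x; rewrite subr_ge0 gerBl; apply/andP.
exists (fun x => (1 - g x) * chi x) => //.
have it := integrable_dist measurableT tchi; have ig := integrable_dist mA tg.
rewrite [e]splitr; apply: le_lt_trans (ltrD gA chiT).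
rewrite -RintegralD//; apply: le_Rintegral_mu.
- exact: integrable_dist (measurableC mA) tf.
- exact: integrable_Radd.
move=> x; rewrite /dist !indicE in_setC in_setT/=.
have /andP[g0 g1] := tg.2 x; have /andP[c0 c1] := tchi.2 x.
have gx : 0 <= 1 - g x by rewrite subr_ge0.
case: (x \in A) => /=; rewrite ?mulr1n ?mulr0n.
  rewrite sub0r normrN !ger0_norm ?subr_ge0 ?mulr_ge0//.
  by rewrite (@le_trans _ _ (1 - g x))// ?ler_piMr// lerDl subr_ge0.
rewrite sub0r normrN (ger0_norm g0) ger0_norm; last first.
  by rewrite subr_ge0 mulr_ile1// gerBl.
rewrite ger0_norm ?subr_ge0//; nra.
Qed.

Let approximableU A B : approximable A -> approximable B -> approximable (A `|` B).
Proof.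
move=> [mA HA] [mB HB]; split; first exact: measurableU.
move=> e e0; have e2 : 0 < e / 2 by rewrite divr_gt0.
have [g tg gA] := HA _ e2; have [h th hB] := HB _ e2.
pose F (k : nat) := if k is 0%N then g else h.
have tF k : test01 (F k) by case: k.
have := test01_union 2 1 tF => tu.
exists (fun x => 1 - \prod_(j < 2) (1 - F j x) ^+ 1) => //.
have ig := integrable_dist mA tg; have ih := integrable_dist mB th.
rewrite [e]splitr; apply: le_lt_trans (ltrD gA hB).
rewrite -RintegralD//; apply: le_Rintegral_mu.
- by apply: integrable_dist => //; exact: measurableU.
- exact: integrable_Radd.
move=> x; rewrite /dist big_ord_recl big_ord1/= !expr1 !indicE in_setU.
have /andP[u0 u1] := tg.2 x; have /andP[v0 v1] := th.2 x.
set u := g x in u0 u1 *; set v := h x in v0 v1 *.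
have E : 1 - (1 - u) * (1 - v) = u + v - u * v by ring.
rewrite E; case: (x \in A); case: (x \in B) => /=; rewrite ?mulr1n ?mulr0n.
- rewrite !ger0_norm; nra.
- rewrite sub0r normrN (@ger0_norm _ v)// !ger0_norm; nra.
- rewrite sub0r normrN (@ger0_norm _ u)// !ger0_norm; nra.
- rewrite !sub0r !normrN !ger0_norm//; nra.
Qed.

Let approximable_bigcup (A : nat -> set Rn) : (forall k, approximable (A k)) ->
  approximable (\bigcup_k A k).
Proof.
move=> HA; have mA k : measurable (A k) by case: (HA k).
split; first exact: bigcup_measurable.
move=> e e0; have e2 : 0 < e / 2 by rewrite divr_gt0.
pose B N := \big[setU/set0]_(k < N) A k.
have HB N : approximable (B N).
  rewrite /B; elim: N => [|N IH]; last by rewrite big_ord_recr; exact: approximableU.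
  rewrite big_ord0 -setCT; apply: approximableC; split => // e' e'0.
  by have [g [tg _ gT]] := open_approx openT e'0; exists g.
have mB N : measurable (B N) by case: (HB N).
have mU : measurable (\bigcup_k A k) by exact: bigcup_measurable.
pose F N x : R := \1_(\bigcup_k A k) x - \1_(B N) x.
have mF N : measurable_fun setT (F N).
  by apply: measurable_funB; exact: measurable_indic.
have BU N x : B N x -> (\bigcup_k A k) x.
  by rewrite /B -bigcup_mkord => -[k _ Ak]; exists k.
have F01 N x : 0 <= F N x <= 1.
  rewrite /F !indicE; case: (boolP (x \in B N)) => [/set_mem/BU/mem_set ->|_].
    by rewrite subrr ler01 lexx.
  by case: (x \in _); rewrite subr0 ?ler01 ?lexx.
have FN1 N x : `|F N x| <= 1.
  by have /andP[? ?] := F01 N x; rewrite ger0_norm.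
have Fcvg x : F N x @[N --> \oo] --> (0 : R).
  have [[k _ Akx]|nU] := pselect ((\bigcup_k A k) x); last first.
    apply: cvg_near_cst; apply: nearW => N; rewrite /F !indicE.
    by rewrite !memNset ?subrr// => /BU.
  apply: cvg_near_cst; exists k.+1 => // N /= kN; rewrite /F !indicE !mem_set ?subrr//.
    by rewrite /B -bigcup_mkord; exists k.
  by exists k.
have : (\int[mu]_x F N x) @[N --> \oo] --> (0 : R).
  rewrite (_ : 0 = \int[mu]_x (fun=> 0 : R) x); last by rewrite Rintegral_cst// mul0r.
  exact: (@bounded_cvg_Rintegral _ _ _ mu F (fun=> 0) 1).
move=> /cvgrPdist_lt /(_ _ e2)[N _ /(_ N (leqnn N))].
rewrite sub0r normrN => h; have [g tg gB] := (HB N).2 _ e2.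
exists g => //; rewrite [e]splitr.
have iF : mu.-integrable setT (EFin \o F N) by exact: integrable_bounded (FN1 N).
have ig := integrable_dist (mB N) tg.
apply: le_lt_trans (ltrD (le_lt_trans (ler_norm _) h) gB).
rewrite -RintegralD//; apply: le_Rintegral_mu.
- exact: integrable_dist.
- exact: integrable_Radd.
move=> x; have /andP[F0 _] := F01 N x; rewrite -{1}(ger0_norm F0) /F /dist.
by apply: le_trans (ler_normD _ _); rewrite addrA subrK.
Qed.

(** The approximable sets form a sigma-algebra that contains the open sets. *)
Lemma borel_approx (A : set Rn) (e : R) : measurable A -> 0 < e ->
  exists2 g, test01 g & \int[mu]_x `|\1_A x - g x| < e.
Proof.
suff H : measurable `<=` [set A | approximable A] by move=> /H[_]; apply.
rewrite measurable_rVE; apply: smallest_sub; last first.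
  move=> U oU; split; first exact: sub_sigma_algebra.
  by move=> e' e'0; have [g [tg _ gT]] := open_approx oU e'0; exists g.
split.
- rewrite /= -setCT; apply: approximableC; split => // e' e'0.
  by have [g [tg _ gT]] := open_approx openT e'0; exists g.
- by move=> B; rewrite setTD; exact: approximableC.
- by move=> F; exact: approximable_bigcup.
Qed.

Let diff_mul (a b c d : R) : 0 <= a <= 1 -> 0 <= b <= 1 -> 0 <= c <= 1 -> 0 <= d <= 1 ->
  `|a * b - c * d| <= `|a - c| + `|b - d|.
Proof.
move=> /andP[a0 a1] /andP[b0 b1] /andP[c0 c1] /andP[d0 d1].
rewrite (_ : a * b - c * d = (a - c) * b + c * (b - d)); last by ring.
rewrite (le_trans (ler_normD _ _))// lerD// normrM.
  by rewrite ler_piMr// ger0_norm.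
by rewrite ler_piMl// ger0_norm.
Qed.

(* the product with prod_(j < k) (1 - h j) makes the approximants subordinate to one another, so that their sum is at most 1 *)
Lemma disjoint_approx (U : set Rn) (E : nat -> set Rn) (N : nat) (e : R) :
  open U -> (forall k, measurable (E k)) -> (forall k, E k `<=` U) ->
  trivIset setT E -> 0 < e ->
  exists g : nat -> Rn -> R, [/\ forall k, test01 (g k),
    forall k x, ~ U x -> g k x = 0,
    forall x, \sum_(k < N) g k x <= 1 &
    forall k, (k < N)%N -> \int[mu]_x `|\1_(E k) x - g k x| <= e].
Proof.
move=> oU mE EU tE e0.
(* [N.+1] errors are added: those of the N sets and that of U. *)
pose e' := e / N.+1%:R; have e'0 : 0 < e' by rewrite divr_gt0.
have H k : exists h, test01 h /\ \int[mu]_x dist (E k) h x < e'.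
  by have [h th hE] := borel_approx (mE k) e'0; exists h.
pose h k := projT1 (cid (H k)).
have th k : test01 (h k) by rewrite /h; case: cid => ? [].
have hE k : \int[mu]_x dist (E k) (h k) x < e' by rewrite /h; case: cid => ? [].
have [chi [tchi chiU chiE]] := open_approx oU e'0.
pose p k x := \prod_(j < k) (1 - h j x).
have om (u : R) : 0 <= u <= 1 -> 0 <= 1 - u <= 1.
  by move=> /andP[? ?]; rewrite subr_ge0 gerBl; apply/andP.
have p01 k x : 0 <= p k x <= 1.
  rewrite /p; elim/big_ind : _ => //; first by rewrite ler01 lexx.
    by move=> u v /andP[? ?] /andP[? ?]; rewrite mulr_ge0//= mulr_ile1.
  by move=> j _; apply: om; exact: (th j).2.
have sp k : smooth (p k).
  move=> l; apply: (@Ck_prod _ _ l _ (index_enum 'I_k) (fun j x => 1 - h j x)) => j.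
  by apply: smooth_onem; have [[]] := th j.
pose g k x := (p k x * chi x) * h k x.
have pc01 k x : 0 <= p k x * chi x <= 1.
  have /andP[? ?] := p01 k x; have /andP[? ?] := tchi.2 x.
  by rewrite mulr_ge0//= mulr_ile1.
have tg k : test01 (g k).
  apply: (test01_mull _ (pc01 k) (th k)).
  by apply: smoothM => //; have [[]] := tchi.
exists g; split => //.
- by move=> k x Ux; rewrite /g chiU// mulr0 mul0r.
- move=> x; apply: (@le_trans _ _ (\sum_(k < N) p k x * h k x)).
    apply: ler_sum => k _; have /andP[? ?] := p01 k x; have /andP[? ?] := tchi.2 x.
    have /andP[? ?] := (th k).2 x.
    by rewrite /g ler_wpM2r// ler_piMr.
  (* The sum telescopes, since p k * h k = p k - p k.+1. *)
  have -> : \sum_(k < N) p k x * h k x = 1 - p N x.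
    elim: (N) => [|M IH]; first by rewrite /p !big_ord0 subrr.
    rewrite big_ord_recr/= IH /p big_ord_recr/=; ring.
  by have /andP[? ?] := p01 N x; rewrite gerBl.
move=> k kN.
pose P k x : R := \prod_(j < k) (1 - \1_(E j) x).
have P01 l x : 0 <= P l x <= 1.
  rewrite /P; elim/big_ind : _ => //; first by rewrite ler01 lexx.
    by move=> u v /andP[? ?] /andP[? ?]; rewrite mulr_ge0//= mulr_ile1.
  by move=> j _; apply: om; exact: indic01.
have dP l x : `|P l x - p l x| <= \sum_(j < l) dist (E j) (h j) x.
  elim: l => [|l IH]; first by rewrite /P /p !big_ord0 subrr normr0.
  rewrite /P /p !big_ord_recr/= -/(P l x) -/(p l x).
  apply: (le_trans (diff_mul (P01 l x) (om _ (indic01 _ x)) (p01 l x) (om _ ((th l).2 x)))).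
  rewrite lerD// /dist -[leRHS]normrN.
  by rewrite (_ : (1 - _) - _ = - (\1_(E l) x - h l x)); last by ring.
(* By disjointness P k = 1 on E k, so the indicator has the same product form as g k and the two can
   be compared factor by factor. *)
have Ek x : \1_(E k) x = P k x * \1_U x * \1_(E k) x :> R.
  rewrite !indicE; have [Ekx|nE] := pselect (E k x); last by rewrite (memNset nE) mulr0.
  rewrite (mem_set Ekx) (mem_set (EU k x Ekx)).
  rewrite /P big1 ?mul1r// => j _; rewrite indicE memNset ?subr0// => Ejx.
  have jk := tE j k I I (ex_intro _ x (conj Ejx Ekx)).
  by have := ltn_ord j; rewrite jk ltnn.
have le x : dist (E k) (g k) x <=
    dist U chi x + \sum_(j < N) dist (E j) (h j) x.
  rewrite /dist Ek /g.
  have Pc01 : 0 <= P k x * \1_U x <= 1.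
    have /andP[? ?] := P01 k x; have /andP[? ?] := indic01 U x.
    by rewrite mulr_ge0//= mulr_ile1.
  apply: (le_trans (diff_mul Pc01 (indic01 _ x) (pc01 k x) ((th k).2 x))).
  apply: (@le_trans _ _ ((\sum_(j < k) dist (E j) (h j) x + dist U chi x) + dist (E k) (h k) x)).
    rewrite lerD2r (le_trans (diff_mul (P01 k x) (indic01 U x) (p01 k x) (tchi.2 x)))//.
    by rewrite lerD2r dP.
  rewrite addrAC addrC lerD2l -(big_ord_recr k (fun j => dist (E j) (h j) x)).
  rewrite (big_ord_widen N (fun j => dist (E j) (h j) x) kN).
  rewrite [leRHS](bigID (fun i : 'I_N => (i < k.+1)%N))/=.
  by rewrite lerDl sumr_ge0// => j _; exact: normr_ge0.
have iS : mu.-integrable setT (EFin \o (fun x => \sum_(j < N) dist (E j) (h j) x)).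
  exact: (@integrable_Rsum _ _ _ mu _ (index_enum 'I_N) (fun j => dist (E j) (h j))
    (fun j => integrable_dist (mE j) (th j))).
have mU : measurable U by exact: sub_sigma_algebra.
have ic := integrable_dist mU tchi.
apply: (@le_trans _ _ (\int[mu]_x (dist U chi x + \sum_(j < N) dist (E j) (h j) x))).
  apply: le_Rintegral_mu => //; last exact: integrable_Radd.
  exact: integrable_dist (mE k) (tg k).
rewrite RintegralD// (@Rintegral_sum _ _ _ mu _ (index_enum 'I_N) (fun j => dist (E j) (h j))
    (fun j => integrable_dist (mE j) (th j))).
apply: (@le_trans _ _ (e' + \sum_(j < N) e')).
  by rewrite lerD// ?(ltW chiE)//; apply: ler_sum => j _; exact: ltW.
by rewrite sumr_const card_ord -mulrS -mulr_natr /e' divfK.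
Qed.

End approximation.

(** * Vector measures and total variation *)

Section charge_integrals.
Context d (T : measurableType d) {R : realType}.
Implicit Type nu : {charge set T -> \bar R}.

(** The same choices of Hahn sets as in [charge_integral], so that the real-valued integral below
    agrees with it without appeal to uniqueness of the decomposition. *)
Definition charge_pos nu : {finite_measure set T -> \bar R} :=
  jordan_pos (projT2 (cid (projT2 (cid (Hahn_decomposition nu))))).

Definition charge_neg nu : {finite_measure set T -> \bar R} :=
  jordan_neg (projT2 (cid (projT2 (cid (Hahn_decomposition nu))))).

Definition Rcharge_integral nu (g : T -> R) : R :=
  \int[charge_pos nu]_x g x - \int[charge_neg nu]_x g x.

Lemma charge_integralE nu (g : T -> R) (C : R) : measurable_fun setT g ->
  (forall x, `|g x| <= C) ->
  charge_integral nu (fun x => (g x)%:E) = (Rcharge_integral nu g)%:E.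
Proof.
move=> mg gC; rewrite /charge_integral /Rcharge_integral EFinB.
rewrite -(integral_fineK (integrable_bounded (charge_pos nu) mg gC)).
by rewrite -(integral_fineK (integrable_bounded (charge_neg nu) mg gC)).
Qed.

Lemma charge_fineE nu (A : set T) : measurable A ->
  fine (nu A) = fine (charge_pos nu A) - fine (charge_neg nu A).
Proof.
move=> mA; rewrite (jordan_decomp (projT2 (cid (projT2 (cid (Hahn_decomposition nu))))) mA).
rewrite /cadd/= cscaleN1 /= /copp fineD ?fin_num_measure// ?fineN//.
by rewrite fin_numN fin_num_measure.
Qed.

Lemma Rcharge_integral_indic nu (A : set T) : measurable A ->
  Rcharge_integral nu (\1_A) = fine (nu A).
Proof. by move=> mA; rewrite /Rcharge_integral !Rintegral_indic// charge_fineE. Qed.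

Lemma Rcharge_integralZ nu (r C : R) (g : T -> R) : measurable_fun setT g ->
  (forall x, `|g x| <= C) ->
  Rcharge_integral nu (fun x => r * g x) = r * Rcharge_integral nu g.
Proof.
move=> mg gC; rewrite /Rcharge_integral !RintegralZ; first by rewrite mulrBr.
- exact: integrable_bounded gC.
- exact: integrable_bounded gC.
Qed.

Lemma Rcharge_integral_sum nu (I : Type) (s : seq I) (C : R) (g : I -> T -> R) :
  (forall i, measurable_fun setT (g i)) -> (forall i x, `|g i x| <= C) ->
  Rcharge_integral nu (fun x => \sum_(i <- s) g i x) =
  \sum_(i <- s) Rcharge_integral nu (g i).
Proof.
move=> mg gC; rewrite /Rcharge_integral !Rintegral_sum ?sumrB//.
- by move=> i; exact: integrable_bounded (mg i) (gC i).
- by move=> i; exact: integrable_bounded (mg i) (gC i).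
Qed.

Lemma Rcharge_integral_dist nu (C : R) (f g : T -> R) :
  measurable_fun setT f -> measurable_fun setT g ->
  (forall x, `|f x| <= C) -> (forall x, `|g x| <= C) ->
  `|Rcharge_integral nu f - Rcharge_integral nu g| <=
  \int[charge_pos nu]_x `|f x - g x| + \int[charge_neg nu]_x `|f x - g x|.
Proof.
move=> mf mg fC gC; rewrite /Rcharge_integral.
have h (m : {finite_measure set T -> \bar R}) :
    `|\int[m]_x f x - \int[m]_x g x| <= \int[m]_x `|f x - g x|.
  have jf := integrable_bounded m mf fC; have jg := integrable_bounded m mg gC.
  rewrite -RintegralB//; apply: Rintegral_le_bound => //.
    exact: measurable_funB.
  apply: (@integrable_bounded _ _ _ m _ (C + C)).
    by apply: measurableT_comp => //; exact: measurable_funB.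
  by move=> x; rewrite normr_id (le_trans (ler_normB _ _))// lerD.
rewrite (_ : _ - _ - _ = (\int[charge_pos nu]_x f x - \int[charge_pos nu]_x g x) -
   (\int[charge_neg nu]_x f x - \int[charge_neg nu]_x g x)); last by ring.
by rewrite (le_trans (ler_normB _ _))// lerD.
Qed.

Lemma finite_measure_add (m1 m2 : {finite_measure set T -> \bar R}) :
  exists mu : {finite_measure set T -> \bar R},
    forall f : T -> R, measurable_fun setT f -> (forall x, 0 <= f x) ->
    (exists C, forall x, f x <= C) ->
    \int[mu]_x f x = \int[m1]_x f x + \int[m2]_x f x.
Proof.
have fm : fin_num_fun (measure_add m1 m2).
  by move=> A mA; rewrite measure_addE fin_numD !fin_num_measure.
pose mu : {finite_measure set T -> \bar R} :=
  HB.pack (measure_add m1 m2 : set T -> \bar R)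
   (Measure.on (measure_add m1 m2)) (Measure_isFinite.Build _ _ _ (measure_add m1 m2) fm).
exists mu => f mf f0 [C fC].
have fC' x : `|f x| <= C by rewrite ger0_norm.
apply: EFin_inj; rewrite EFinD.
rewrite -(integral_fineK (integrable_bounded mu mf fC')).
rewrite -(integral_fineK (integrable_bounded m1 mf fC')).
rewrite -(integral_fineK (integrable_bounded m2 mf fC')).
rewrite /mu /= ge0_integral_measure_add//; first by move=> x _; rewrite lee_fin.
exact/measurable_EFinP.
Qed.

Lemma dominating_measure (I : Type) (s : seq I) (m : I -> {finite_measure set T -> \bar R}) :
  exists mu : {finite_measure set T -> \bar R},
    forall f : T -> R, measurable_fun setT f -> (forall x, 0 <= f x) ->
    (exists C, forall x, f x <= C) ->
    \int[mu]_x f x = \sum_(i <- s) \int[m i]_x f x.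
Proof.
elim: s => [|i s [mu Hmu]].
  exists mzero => f mf f0 fC; rewrite big_nil /Rintegral integral_measure_zero//.
have [mu' Hmu'] := finite_measure_add (m i) mu.
exists mu' => f mf f0 fC.
by rewrite Hmu'// Hmu// big_cons.
Qed.

End charge_integrals.

Section vector_measures.
Context {R : realType} {n : nat}.
Local Notation Rn := 'rV[R]_n.
Implicit Type D : @vector_measure R n.

Definition vector_value D (A : set Rn) : Rn := \row_i fine (D i A).

Definition vector_pairing D (psi : Rn -> Rn) : R :=
  \sum_i Rcharge_integral (D i) (fun x => psi x ord0 i).

(** The sum of the positive and negative parts of all components. It is not the total variation,
    only a finite measure against which all approximation errors are estimated. *)
Lemma vector_dominating_measure D :
  exists mu : {finite_measure set Rn -> \bar R},
    forall f : Rn -> R, measurable_fun setT f -> (forall x, 0 <= f x) ->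
    (exists C, forall x, f x <= C) ->
    \sum_i (\int[charge_pos (D i)]_x f x + \int[charge_neg (D i)]_x f x) = \int[mu]_x f x.
Proof.
have H i := finite_measure_add (charge_pos (D i)) (charge_neg (D i)).
have [mu Hmu] := dominating_measure (index_enum 'I_n) (fun i => projT1 (cid (H i))).
exists mu => f mf f0 fC; rewrite Hmu//; apply: eq_bigr => i _.
by case: cid => m /= ->.
Qed.

Lemma vector_pairing_dist D (mu : {finite_measure set Rn -> \bar R}) (f g : Rn -> Rn)
    (h : Rn -> R) (C : R) :
  (forall f : Rn -> R, measurable_fun setT f -> (forall x, 0 <= f x) ->
    (exists C, forall x, f x <= C) ->
    \sum_i (\int[charge_pos (D i)]_x f x + \int[charge_neg (D i)]_x f x) = \int[mu]_x f x) ->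
  measurable_fun setT f -> measurable_fun setT g -> measurable_fun setT h ->
  (forall x, enorm (f x) <= C) -> (forall x, enorm (g x) <= C) ->
  (forall x, enorm (f x - g x) <= h x <= C) ->
  `|vector_pairing D f - vector_pairing D g| <= \int[mu]_x h x.
Proof.
move=> Hmu mf mg mh fC gC hC.
have h0 x : 0 <= h x by have /andP[+ _] := hC x; apply: le_trans; exact: enorm_ge0.
have hC' x : `|h x| <= C by rewrite ger0_norm//; have /andP[] := hC x.
rewrite -Hmu//; last by exists C => x; have /andP[] := hC x.
rewrite /vector_pairing -sumrB (le_trans (ler_norm_sum _ _ _))//.
apply: ler_sum => i _.
have mfi : measurable_fun setT (fun x => f x ord0 i) by exact: (measurableT_comp (measurable_coord i)).
have mgi : measurable_fun setT (fun x => g x ord0 i) by exact: (measurableT_comp (measurable_coord i)).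
have le x : `|f x ord0 i - g x ord0 i| <= h x.
  have /andP[+ _] := hC x; apply: le_trans.
  by have := normr_coord_le_enorm (f x - g x) i; rewrite !mxE.
apply: (le_trans (Rcharge_integral_dist _ mfi mgi _ _)).
- by move=> x; apply: le_trans (fC x); exact: normr_coord_le_enorm.
- by move=> x; apply: le_trans (gC x); exact: normr_coord_le_enorm.
have mm : measurable_fun setT (fun x => `|f x ord0 i - g x ord0 i|).
  by apply: measurableT_comp => //; exact: measurable_funB.
have jm (m : {finite_measure set Rn -> \bar R}) :
    \int[m]_x `|f x ord0 i - g x ord0 i| <= \int[m]_x h x.
  apply: le_Rintegral_mu => //; last exact: integrable_bounded hC'.
  by apply: (integrable_le mm (integrable_bounded m mh hC')) => x; rewrite normr_id.
by rewrite lerD.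
Qed.

Lemma vector_pairing_simple D (N : nat) (E : nat -> set Rn) (v : nat -> Rn) :
  (forall k, measurable (E k)) -> (forall k, enorm (v k) <= 1) ->
  vector_pairing D (fun x => \sum_(k < N) (\1_(E k) x : R) *: v k) =
  \sum_(k < N) edot (v k) (vector_value D (E k)).
Proof.
move=> mE v1; rewrite /vector_pairing.
have mi k : measurable_fun setT (\1_(E k) : Rn -> R) by exact: measurable_indic.
transitivity (\sum_i \sum_(k < N) v k ord0 i * fine (D i (E k))).
  apply: eq_bigr => i _.
  rewrite (_ : (fun x => _) = (fun x => \sum_(k < N) v k ord0 i * \1_(E k) x)); last first.
    by apply/funext => x; rewrite summxE; apply: eq_bigr => k _; rewrite mxE mulrC.
  rewrite (@Rcharge_integral_sum _ _ _ _ _ (index_enum 'I_N) 1 (fun k x => v k ord0 i * \1_(E k) x)).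
  - apply: eq_bigr => k _; rewrite (@Rcharge_integralZ _ _ _ _ _ 1)//.
      by rewrite Rcharge_integral_indic.
    by move=> x; rewrite indicE; case: (_ \in _); rewrite ?normr1 ?normr0.
  - by move=> k; exact: measurable_funM.
  - move=> k x; rewrite normrM mulr_ile1//.
      by apply: le_trans (v1 k); exact: normr_coord_le_enorm.
    by rewrite indicE; case: (_ \in _); rewrite ?normr1 ?normr0.
rewrite exchange_big/=; apply: eq_bigr => k _; rewrite /edot.
by apply: eq_bigr => i _; rewrite mxE.
Qed.

Lemma enorm_vector_value_dot D (A : set Rn) : exists e : Rn,
  enorm e <= 1 /\ edot e (vector_value D A) = enorm (vector_value D A).
Proof.
have [v0|v0] := eqVneq (vector_value D A) 0.
  by exists 0; rewrite v0 enorm0 ler01 edot0l.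
have e0 := enorm_gt0 v0; exists ((enorm (vector_value D A))^-1 *: vector_value D A).
rewrite enormZ gtr0_norm ?invr_gt0// mulVf ?gt_eqF// lexx edotZl -sqr_enorm.
by rewrite expr2 mulrA mulVf ?gt_eqF// mul1r.
Qed.

(** One half of the duality. A partial sum over a partition is the pairing of D with the step field
    of values v_k, the unit vectors aligned with D(E_k). Replacing the indicators by the functions
    of [disjoint_approx] keeps the field of norm at most 1 and zero off U, at a small cost. *)
Lemma vector_variation_le D (U : set Rn) (S : R) : open U ->
  (forall phi, test_field phi -> (forall x, enorm (phi x) <= 1) ->
    (forall x, ~ U x -> phi x = 0) -> vector_pairing D phi <= S) ->
  (vector_variation D U <= S%:E)%E.
Proof.
move=> oU HS; apply: ge_ereal_sup => _ [E [mE tE UE] <-].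
have [mu Hmu] := vector_dominating_measure D.
apply: lime_le.
  by apply: is_cvg_nneseries => k _ _; rewrite lee_fin enorm_ge0.
apply: nearW => N; rewrite sumEFin lee_fin big_mkord.
apply/ler_addgt0Pr => e e0.
pose e' := e / N.+1%:R; have e'0 : 0 < e' by rewrite divr_gt0.
have EU k : E k `<=` U by rewrite -UE; exact: bigcup_sup.
have [g [tg gU gs gE]] := @disjoint_approx R n mu U E N e' oU mE EU tE e'0.
pose v k := projT1 (cid (enorm_vector_value_dot D (E k))).
have [v1 vE] : (forall k, enorm (v k) <= 1) /\
    (forall k, edot (v k) (vector_value D (E k)) = enorm (vector_value D (E k))).
  by split => k; rewrite /v; case: cid => ? [].
pose phi x := \sum_(k < N) g k x *: v k.
pose chi x := \sum_(k < N) (\1_(E k) x : R) *: v k.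
have mg k : measurable_fun setT (g k) by exact: measurable_test01.
have mi k : measurable_fun setT (\1_(E k) : Rn -> R) by exact: measurable_indic.
have msum (F : nat -> Rn -> R) : (forall k, measurable_fun setT (F k)) ->
    measurable_fun setT (fun x => \sum_(k < N) F k x *: v k : Rn).
  move=> mF; apply: measurable_fun_rV => i.
  under eq_fun do rewrite summxE.
  apply: measurable_sum => k; under eq_fun do rewrite mxE.
  exact: measurable_funM.
have tphi : test_field phi.
  apply: (@test_field_sum _ _ _ (index_enum 'I_N) (fun k x => g k x *: v k)) => k.
  by apply: test_function_vec; have [] := tg k.
have phi1 x : enorm (phi x) <= 1.
  apply: le_trans (gs x); apply: (le_trans (enorm_sum _ _ _)).
  apply: ler_sum => k _; rewrite enormZ ger0_norm; last by have /andP[] := (tg k).2 x.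
  by rewrite ler_piMr//; have /andP[] := (tg k).2 x.
have phiU x : ~ U x -> phi x = 0.
  by move=> Ux; rewrite /phi big1// => k _; rewrite gU// scale0r.
have chiE : vector_pairing D chi = \sum_(k < N) enorm (vector_value D (E k)).
  by rewrite /chi vector_pairing_simple//; apply: eq_bigr => k _.
rewrite -chiE -lerBlDl.
apply: (@le_trans _ _ (`|vector_pairing D chi - vector_pairing D phi|)).
  apply: le_trans (ler_norm _); rewrite lerD2l lerN2.
  exact: HS.
pose h x := \sum_(k < N) `|\1_(E k) x - g k x|.
have h1 k x : `|\1_(E k) x - g k x| <= 1.
  have /andP[? ?] := (tg k).2 x.
  by rewrite indicE; case: (_ \in _); rewrite ler_norml ?mulr1n ?mulr0n/=; apply/andP; split; lra.
have hN x : h x <= N%:R.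
  apply: (@le_trans _ _ (\sum_(k < N) 1)); first by apply: ler_sum => k _; exact: h1.
  by rewrite sumr_const card_ord.
have mhk k : measurable_fun setT (fun x => `|\1_(E k) x - g k x|).
  by apply: measurableT_comp => //; exact: measurable_funB.
apply: (@le_trans _ _ (\int[mu]_x h x)).
  apply: (@vector_pairing_dist D mu chi phi h (N%:R + 1)) => //.
  - exact: (msum (fun k => \1_(E k))).
  - exact: (msum g).
  - exact: measurable_sum.
  - move=> x; apply: (@le_trans _ _ N%:R); last by rewrite lerDl.
    apply: (le_trans (enorm_sum _ _ _)).
    apply: (@le_trans _ _ (\sum_(k < N) 1)); last by rewrite sumr_const card_ord.
    apply: ler_sum => k _; rewrite enormZ mulr_ile1 ?enorm_ge0//.
    by rewrite indicE; case: (_ \in _); rewrite ?normr1 ?normr0.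
  - by move=> x; rewrite (le_trans (phi1 x))// lerDr.
  - move=> x; rewrite (le_trans (hN x)) ?lerDl// andbT.
    rewrite /chi /phi -sumrB (le_trans (enorm_sum _ _ _))//.
    apply: ler_sum => k _; rewrite -scalerBl enormZ ler_piMr//.
have jh k : mu.-integrable setT (EFin \o (fun x => `|\1_(E k) x - g k x|)).
  by apply: (@integrable_bounded _ _ _ mu _ 1 (mhk k)) => x; rewrite normr_id.
rewrite (@Rintegral_sum _ _ _ mu _ (index_enum 'I_N) (fun k x => `|\1_(E k) x - g k x|))//.
apply: (@le_trans _ _ (\sum_(k < N) e')); first by apply: ler_sum => k _; exact: gE.
rewrite sumr_const card_ord -[e' *+ N]mulr_natr /e' mulrAC ler_pdivrMr//.
by rewrite ler_wpM2l ?(ltW e0)// ler_nat.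
Qed.

End vector_measures.

(** * Pairings bounded by the variation, and shrinking neighbourhoods *)

Section vector_variations.
Context {R : realType} {n : nat}.
Local Notation Rn := 'rV[R]_n.
Implicit Type D : @vector_measure R n.

Lemma vector_variation_ge_sum D (A : set Rn) (E : nat -> set Rn) (K : nat) :
  (forall k, measurable (E k)) -> trivIset setT E -> \bigcup_k E k = A ->
  ((\sum_(k < K) enorm (vector_value D (E k)))%:E <= vector_variation D A)%E.
Proof.
move=> mE tE UE.
apply: (@le_trans _ _ (\sum_(k <oo) (enorm (vector_value D (E k)))%:E)%E); last first.
  by apply: ereal_sup_ubound; exists E.
rewrite -sumEFin -(big_mkord xpredT (fun k => (enorm (vector_value D (E k)))%:E)).
by apply: nneseries_lim_ge => k _ _; rewrite lee_fin enorm_ge0.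
Qed.

Lemma vector_variation_ge0 D (A : set Rn) : measurable A -> (0 <= vector_variation D A)%E.
Proof.
move=> mA; have := @vector_variation_ge_sum D A (fun k => if k is 0%N then A else set0) 0.
rewrite big_ord0; apply.
- by case.
- apply/trivIsetP => -[|i] [|j] _ _ //= _; by rewrite ?setI0 ?set0I.
- by apply/seteqP; split => [x [[|k]]//|x Ax]; exists 0%N.
Qed.

(** The other half of the duality, for Borel fields. Sorting the values of psi into a grid of mesh
    1/M cuts A into finitely many cells; a step field that is constant on the cells is within n/M of
    psi, and its pairing is bounded by a sum over a partition. *)
Lemma vector_pairing_le_inside D (psi : Rn -> Rn) (A : set Rn) : measurable A ->
  measurable_fun setT psi -> (forall x, enorm (psi x) <= 1) ->
  (forall x, ~ A x -> psi x = 0) ->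
  ((vector_pairing D psi)%:E <= vector_variation D A)%E.
Proof.
move=> mA mpsi psi1 psiA.
have [mu Hmu] := vector_dominating_measure D.
have mT : mu setT \is a fin_num by exact: fin_num_measure.
apply/lee_addgt0Pr => e e0.
have [m em] : exists m : nat, n%:R / m.+1%:R * fine (mu setT) <= e.
  have [m em] : exists m : nat, n%:R * fine (mu setT) / e <= m.+1%:R.
    exists (Num.truncn (n%:R * fine (mu setT) / e)); apply: ltW; exact: truncnS_gt.
  by exists m; rewrite mulrAC ler_pdivrMr// [leRHS]mulrC; move: em; rewrite ler_pdivrMr.
pose M : R := m.+1%:R; have M0 : 0 < M by rewrite ltr0n.
(* Coordinates satisfy 0 <= (psi_i + 1) M <= 2M, and the extra index accounts for the attained
   endpoint 2M. *)
pose c_ (c : {ffun 'I_n -> 'I_(2 * m.+1).+1}) : set Rn :=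
  [set x | A x /\ forall i, (c i)%:R <= (psi x ord0 i + 1) * M < (c i).+1%:R].
pose K := #|{ffun 'I_n -> 'I_(2 * m.+1).+1}|.
pose E k : set Rn := if insub k is Some k' then c_ (enum_val (k' : 'I_K)) else set0.
have mpsii i : measurable_fun setT (fun x => (psi x ord0 i + 1) * M).
  apply: measurable_funM => //; apply: measurable_funD => //.
  exact: (measurableT_comp (measurable_coord i)).
have mc c : measurable (c_ c).
  rewrite (_ : c_ c = A `&` \bigcap_(i in [set: 'I_n]) ((fun x => (psi x ord0 i + 1) * M) @^-1`
     `[(c i)%:R, (c i).+1%:R[%classic)); last first.
    apply/seteqP; split => [x [Ax H]|x [Ax H]]; split => // i.
      by move=> _ /=; rewrite in_itv/= H.
    by have := H i I; rewrite /= in_itv.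
  apply: measurableI => //; apply: fin_bigcap_measurable => // i _.
  by rewrite -[X in measurable X]setTI; exact: mpsii.
have mE k : measurable (E k) by rewrite /E; case: insub.
have tE : trivIset setT E.
  apply/trivIsetP => i j _ _ ij; rewrite /E.
  case: insubP => [i' _ iE|_]; last by rewrite set0I.
  case: insubP => [j' _ jE|_]; last by rewrite setI0.
  apply/seteqP; split => // x [[_ h1] [_ h2]]; move: ij; rewrite -iE -jE.
  suff -> : i' = j' by rewrite eqxx.
  apply: enum_val_inj; apply/ffunP => k; apply/val_inj => /=.
  by rewrite -(truncn_def (h1 k)) -(truncn_def (h2 k)).
have psib x i : 0 <= (psi x ord0 i + 1) * M <= (2 * m.+1)%:R.
  have := le_trans (normr_coord_le_enorm (psi x) i) (psi1 x); rewrite ler_norml => /andP[h1 h2].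
  rewrite mulr_ge0 ?(ltW M0)//=; last by rewrite -lerBlDr sub0r.
  rewrite natrM ler_wpM2r ?(ltW M0)//; lra.
have UE : \bigcup_k E k = A.
  apply/seteqP; split => [x [k _]|x Ax].
    by rewrite /E; case: insubP => // k' _ _ [].
  pose c : {ffun 'I_n -> 'I_(2 * m.+1).+1} := [ffun i => inord (Num.truncn ((psi x ord0 i + 1) * M))].
  exists (enum_rank c) => //; rewrite /E insubT// => ?.
  rewrite (_ : Sub _ _ = enum_rank c); last by apply/val_inj.
  rewrite enum_rankK; split => // i; rewrite ffunE.
  have /andP[p0 p1] := psib x i.
  rewrite inordK; first exact: truncn_itv.
  by rewrite ltnS -(@ler_nat R) (le_trans _ p1)// truncn_le.
(* A value actually taken by psi on the cell keeps the step field of norm at most 1; empty cells get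
   0. *)
pose v k : Rn := if pselect (exists x, E k x) is left H then psi (projT1 (cid H)) else 0.
have v1 k : enorm (v k) <= 1.
  by rewrite /v; case: pselect => // _; rewrite enorm0 ler01.
have vE k x : E k x -> enorm (psi x - v k) <= n%:R / M.
  move=> Ekx; rewrite /v; case: pselect => [H|[]]; last by exists x.
  case: cid => y /= Eky; apply: (le_trans (enorm_le_sum _)).
  apply: (@le_trans _ _ (\sum_(i < n) M^-1)); last first.
    by rewrite sumr_const card_ord mulr_natl.
  apply: ler_sum => i _; rewrite !mxE.
  move: Ekx Eky; rewrite /E; case: insub => // k' [_ /(_ i)/andP[a1 a2]] [_ /(_ i)/andP[b1 b2]].
  rewrite -[leRHS]mul1r ler_pdivlMr// -[X in _ * X](gtr0_norm M0) -normrM.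
  by rewrite -!natr1 in a2 b2; rewrite ler_norml; apply/andP; split; lra.
pose g x := \sum_(k < K) (\1_(E k) x : R) *: v k.
have gE k x : (k < K)%N -> E k x -> g x = v k.
  move=> kK Ekx; rewrite /g (bigD1 (Ordinal kK))//= indicE mem_set// scale1r big1 ?addr0// => j jk.
  rewrite indicE memNset ?scale0r// => Ejx.
  by case/eqP: jk; apply/val_inj => /=; apply: tE => //; exists x.
have EK k x : E k x -> (k < K)%N by rewrite /E; case: insubP.
have gA x : ~ A x -> g x = 0.
  move=> Ax; rewrite /g big1// => k _; rewrite indicE memNset ?scale0r// => Ekx.
  by apply: Ax; rewrite -UE; exists k.
have dist x : enorm (psi x - g x) <= n%:R / M.
  have [Ax|Ax] := pselect (A x); last by rewrite psiA// gA// subr0 enorm0 divr_ge0// ltW.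
  have [k _ Ekx] : (\bigcup_k E k) x by rewrite UE.
  by rewrite (gE _ _ (EK _ _ Ekx) Ekx); exact: vE.
have g1 x : enorm (g x) <= 1.
  have [Ax|Ax] := pselect (A x); last by rewrite gA// enorm0 ler01.
  have [k _ Ekx] : (\bigcup_k E k) x by rewrite UE.
  by rewrite (gE _ _ (EK _ _ Ekx) Ekx); exact: v1.
have mg : measurable_fun setT g.
  apply: measurable_fun_rV => i.
  under eq_fun do rewrite summxE.
  apply: measurable_sum => k; under eq_fun do rewrite mxE.
  by apply: measurable_funM => //; exact: measurable_indic.
have nM : 0 <= n%:R / M by rewrite divr_ge0// ltW.
have := @vector_pairing_dist R n D mu psi g (fun=> n%:R / M) (1 + n%:R / M) Hmu mpsi mg.
move=> /(_ (measurable_cst _)); rewrite Rintegral_cst// => H.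
have {}H : `|vector_pairing D psi - vector_pairing D g| <= n%:R / M * fine (mu setT).
  apply: H => x.
  - by rewrite (le_trans (psi1 x))// lerDl.
  - by rewrite (le_trans (g1 x))// lerDl.
  - by rewrite dist lerDr ler01.
apply: (@le_trans _ _ ((vector_pairing D g)%:E + e%:E)%E).
  rewrite -EFinD lee_fin -lerBlDl; apply: le_trans em; apply: le_trans H; exact: ler_norm.
apply: leeD => //; apply: le_trans (vector_variation_ge_sum D K mE tE UE).
rewrite lee_fin /g vector_pairing_simple//; apply: ler_sum => k _.
by rewrite (le_trans (edot_le _ _))// ler_piMl// enorm_ge0.
Qed.

(** Outside A the field costs at most eta times the total mass of the dominating measure, a constant
    that depends on D only. *)
Lemma vector_pairing_le D : exists C : R, forall (psi : Rn -> Rn) (A : set Rn) (eta : R),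
  measurable A -> 0 <= eta ->
  measurable_fun setT psi -> (forall x, enorm (psi x) <= 1) ->
  (forall x, ~ A x -> enorm (psi x) <= eta) ->
  ((vector_pairing D psi)%:E <= vector_variation D A + (eta * C)%:E)%E.
Proof.
have [mu Hmu] := vector_dominating_measure D.
have mT : mu setT \is a fin_num by exact: fin_num_measure.
exists (fine (mu setT)) => psi A eta mA eta0 mpsi psi1 psieta.
pose g x := (\1_A x : R) *: psi x.
have mg : measurable_fun setT g.
  apply: measurable_fun_rV => i; under eq_fun do rewrite mxE.
  apply: measurable_funM; first exact: measurable_indic.
  exact: (measurableT_comp (measurable_coord i)).
have gA x : A x -> g x = psi x by move=> Ax; rewrite /g indicE mem_set// scale1r.
have gN x : ~ A x -> g x = 0 by move=> Ax; rewrite /g indicE memNset// scale0r.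
have g1 x : enorm (g x) <= 1.
  by have [Ax|Ax] := pselect (A x); rewrite ?(gA _ Ax)// (gN _ Ax) enorm0.
have := @vector_pairing_dist R n D mu psi g (fun=> eta) (1 + eta) Hmu mpsi mg.
move=> /(_ (measurable_cst _)); rewrite Rintegral_cst// => H.
have {}H : `|vector_pairing D psi - vector_pairing D g| <= eta * fine (mu setT).
  apply: H => x.
  - by rewrite (le_trans (psi1 x))// lerDl.
  - by rewrite (le_trans (g1 x))// lerDl.
  - rewrite lerDr ler01 andbT; have [Ax|Ax] := pselect (A x).
      by rewrite gA// subrr enorm0.
    by rewrite gN// subr0; exact: psieta.
apply: (@le_trans _ _ ((vector_pairing D g)%:E + (eta * fine (mu setT))%:E)%E).
  by rewrite -EFinD lee_fin -lerBlDl; apply: le_trans H; exact: ler_norm.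
by apply: leeD => //; exact: vector_pairing_le_inside.
Qed.

(** Covers the default value of [frac_variation]. *)
Lemma vector_variation_zero (A : set Rn) :
  (vector_variation (fun=> czero : {charge set Rn -> \bar R}) A <= 0)%E.
Proof.
apply: ge_ereal_sup => _ [E [mE tE UE] <-].
rewrite eseries0// => k _ _.
rewrite (_ : \row_i _ = 0) ?enorm0//; by apply/rowP => i; rewrite !mxE.
Qed.

(** Each piece of a partition of B is cut along A; the parts inside A form a partition of A, and
    those outside are charged to mu. Continuity from above is then needed only for the finite
    measure mu. *)
Lemma vector_variation_le_setD D (mu : {finite_measure set Rn -> \bar R}) (A B : set Rn) :
  (forall f : Rn -> R, measurable_fun setT f -> (forall x, 0 <= f x) ->
    (exists C, forall x, f x <= C) ->
    \sum_i (\int[charge_pos (D i)]_x f x + \int[charge_neg (D i)]_x f x) = \int[mu]_x f x) ->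
  measurable A -> measurable B -> A `<=` B ->
  (vector_variation D B <= vector_variation D A + mu (B `\` A))%E.
Proof.
move=> Hmu mA mB AB; apply: ge_ereal_sup => _ [E [mE tE UE] <-].
apply: lime_le.
  by apply: is_cvg_nneseries => k _ _; rewrite lee_fin enorm_ge0.
apply: nearW => N; rewrite sumEFin big_mkord.
have mEA k : measurable (E k `&` A) by exact: measurableI.
have mED k : measurable (E k `\` A) by exact: measurableD.
have EB k : E k `<=` B by rewrite -UE; exact: bigcup_sup.
have muE k : enorm (vector_value D (E k `\` A)) <= fine (mu (E k `\` A)).
  rewrite -Rintegral_indic// -Hmu//; last first.
    exists 1 => x; rewrite indicE; case: (_ \in _) => //; exact: ler01.
  apply: (le_trans (enorm_le_sum _)); apply: ler_sum => i _.
  rewrite mxE charge_fineE// !Rintegral_indic// (le_trans (ler_normB _ _))//.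
  by rewrite !ger0_norm// fine_ge0.
have le k : enorm (vector_value D (E k)) <=
    enorm (vector_value D (E k `&` A)) + fine (mu (E k `\` A)).
  rewrite (le_trans _ (lerD (lexx _) (muE k)))// (le_trans _ (enormD _ _))//.
  rewrite (_ : vector_value D (E k) = vector_value D (E k `&` A) + vector_value D (E k `\` A))//.
  apply/rowP => i; rewrite !mxE (chargeDI (D i) (mE k) mA) addeC.
  by rewrite fineD// fin_num_measure.
apply: (@le_trans _ _ ((\sum_(k < N) enorm (vector_value D (E k `&` A)))%:E +
    \sum_(k < N) mu (E k `\` A))%E).
  have -> : (\sum_(k < N) mu (E k `\` A) = (\sum_(k < N) fine (mu (E k `\` A)))%:E)%E.
    by rewrite -sumEFin; apply: eq_bigr => k _; apply/esym/fineK; exact: fin_num_measure.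
  by rewrite -EFinD lee_fin -big_split/=; apply: ler_sum => k _; exact: le.
apply: leeD.
  apply: (@vector_variation_ge_sum D A (fun k => E k `&` A)) => //.
    by apply/trivIsetP => i j _ _ ij; rewrite setIACA; move/trivIsetP: tE => -> //; rewrite set0I.
  by rewrite -setI_bigcupl UE setIidr.
have tEA : trivIset setT (fun k => E k `\` A).
  apply/trivIsetP => i j _ _ ij; apply/seteqP; split => // x [[Ei _] [Ej _]].
  by move/trivIsetP: tE => /(_ i j I I ij) <-; split.
rewrite -(big_mkord xpredT (fun k => mu (E k `\` A))).
apply: (@le_trans _ _ (\sum_(k <oo) mu (E k `\` A))%E); first exact: nneseries_lim_ge.
rewrite -measure_semi_bigcup//; last by apply: bigcup_measurable => k _; exact: mED.
by rewrite -setD_bigcupl UE.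
Qed.

Definition neighborhood (U : set Rn) (delta : R) : set Rn :=
  [set x | exists2 y, U y & `|x - y| < delta].

Lemma open_neighborhood U delta : open (neighborhood U delta).
Proof.
rewrite openE => x [y Uy xy]; apply/nbhs_ballP; exists (delta - `|x - y|) => /=.
  by rewrite subr_gt0.
move=> z; rewrite mx_norm_ball /ball_/= => xz; exists y => //.
rewrite -(subrKA x) (le_lt_trans (ler_normD _ _))// distrC.
by rewrite -ltrBrDr.
Qed.

Lemma neighborhood_closure U : \bigcap_k neighborhood U (k.+1%:R^-1) = closure U.
Proof.
apply/seteqP; split => [x H|x H k _].
  move=> B /nbhs_ballP[e /= e0 eB].
  have [k ke] : exists k : nat, k.+1%:R^-1 < e.
    exists (Num.truncn e^-1); rewrite invf_plt ?posrE//; exact: truncnS_gt.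
  have [y Uy xy] := H k I; exists y; split => //; apply: eB.
  by rewrite mx_norm_ball /ball_/= (lt_trans xy).
have [//|y [Uy xy]] := H (ball x k.+1%:R^-1).
  by apply: nbhsx_ballx; rewrite invr_gt0.
by exists y => //; move: xy; rewrite mx_norm_ball.
Qed.

(** The neighbourhoods of radius 1/(k+1), minus the closure, decrease to the empty set, so their
    mass for the dominating measure tends to 0. *)
Lemma vector_variation_neighborhood D (U : set Rn) (e : R) : 0 < e ->
  exists2 delta : R, 0 < delta &
    (vector_variation D (neighborhood U delta) <= vector_variation D (closure U) + e%:E)%E.
Proof.
move=> e0; have [mu Hmu] := vector_dominating_measure D.
pose F k := neighborhood U (k.+1%:R^-1) `\` closure U.
have mN delta : measurable (neighborhood U delta).
  by apply: sub_sigma_algebra; exact: open_neighborhood.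
have mC : measurable (closure U).
  by rewrite -neighborhood_closure; apply: bigcapT_measurable => k; exact: mN.
have mF k : measurable (F k) by exact: measurableD.
have F0 : \bigcap_k F k = set0.
  apply/seteqP; split => // x H; have [_ nc] := H 0%N I; apply: nc.
  by rewrite -neighborhood_closure => k _; have [] := H k I.
have : mu (F k) @[k --> \oo] --> mu (\bigcap_k F k).
  apply: nonincreasing_cvg_mu => //.
  - by rewrite -ge0_fin_numE// fin_num_measure.
  - by rewrite F0.
  - move=> j k jk; apply/subsetPset; apply: setSD => x [y Uy xy]; exists y => //.
    by rewrite (lt_le_trans xy)// lef_pV2 ?posrE// ler_nat ltnS.
rewrite F0 measure0 => /fine_cvgP[_] /cvgrPdist_lt /(_ _ e0)[N _ /(_ N (leqnn N))].
rewrite /= sub0r normrN ger0_norm ?fine_ge0// => lt.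
exists (N.+1%:R^-1); first by rewrite invr_gt0.
have sub : closure U `<=` neighborhood U (N.+1%:R^-1).
  by rewrite -neighborhood_closure; exact: bigcap_inf.
apply: (le_trans (vector_variation_le_setD Hmu mC (mN _) sub)).
apply: leeD => //; apply: (@le_trans _ _ (fine (mu (F N)))%:E).
  by rewrite fineK// fin_num_measure.
by rewrite lee_fin ltW.
Qed.

End vector_variations.

(** * The Riesz representation theorem *)

Section generalized_limits.
Context {R : realType}.

Definition bounded_function (T : Type) (f : T -> R) : Prop :=
  exists C, forall x, `|f x| <= C.

Lemma bounded_function_indic (T : Type) (A : set T) : bounded_function (\1_A : T -> R).
Proof. by exists 1 => x; rewrite indicE; case: (_ \in _); rewrite ?normr1 ?normr0. Qed.

Definition positive_functional (T : Type) (F : (T -> R) -> R) : Prop :=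
  [/\ forall f g, bounded_function f -> bounded_function g ->
        F (fun x => f x + g x) = F f + F g,
      forall c f, bounded_function f -> F (fun x => c * f x) = c * F f &
      forall f, bounded_function f -> (forall x, 0 <= f x) -> 0 <= F f].

(** A bounded sequence stays in a compact segment, hence converges along an ultrafilter. As the
    ultrafilter contains all tails, its limit extends the ordinary one. *)
Lemma generalized_limit : exists F : (nat -> R) -> R, positive_functional F /\
  forall u l, bounded_function u -> u N @[N --> \oo] --> l -> F u = l.
Proof.
have [G [UG ooG]] := ultraFilterLemma (@eventually_filter).
have cv (u : nat -> R) : bounded_function u -> exists l : R, u @ G --> l.
  move=> [C uC].
  have GC : (u @ G) [set` `[- C, C]].
    apply: (@filterS _ G _ setT); last exact: filterT.
    by move=> N _; rewrite /= in_itv/= -ler_norml uC.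
  have [l [_ cl]] := @segment_compact R (- C) C (u @ G) _ GC.
  exists l => B Bl; have [//|GB] := in_ultra_setVsetC (u @^-1` B) UG.
  by have [x []] := cl (~` B) B GB Bl.
exists (fun u => lim (u @ G)); split; last first.
  by move=> u l _ ul; apply: cvg_lim => //; apply: cvg_trans ul; exact: cvg_app.
split.
- by move=> u v /cv[l ul] /cv[m vm]; rewrite limD//; [exact: cvgP ul|exact: cvgP vm].
- by move=> c u /cv[l ul]; rewrite limZr//; exact: cvgP ul.
- move=> u /cv[l ul] u0; apply: limr_ge; first exact: cvgP ul.
  exact: nearW.
Qed.

End generalized_limits.

Section positive_functionals.
Context {R : realType} {n : nat}.
Local Notation Rn := 'rV[R]_n.
Variable F : (Rn -> R) -> R.
Hypothesis F_pos : positive_functional F.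

Let content (A : set Rn) : R := F (\1_A).

Let indic_bounded (A : set Rn) : bounded_function (\1_A : Rn -> R).
Proof. exact: bounded_function_indic. Qed.

Lemma bounded_functionD (T : Type) (f g : T -> R) :
  bounded_function f -> bounded_function g -> bounded_function (fun x => f x + g x).
Proof. by move=> [C fC] [D gD]; exists (C + D) => x; rewrite (le_trans (ler_normD _ _))// lerD. Qed.

Lemma bounded_functionZ (T : Type) c (f : T -> R) :
  bounded_function f -> bounded_function (fun x => c * f x).
Proof. by move=> [C fC]; exists (`|c| * C) => x; rewrite normrM ler_wpM2l. Qed.

Lemma positive_functional_le (f g : Rn -> R) : bounded_function f -> bounded_function g ->
  (forall x, f x <= g x) -> F f <= F g.
Proof.
have [FD FZ F0] := F_pos; move=> bf bg fg.
have bN := bounded_functionZ (-1) bf.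
have := F0 _ (bounded_functionD bg bN); rewrite FD// FZ// mulN1r subr_ge0; apply.
by move=> x; rewrite mulN1r subr_ge0.
Qed.

Lemma positive_functional_sum (I : Type) (s : seq I) (f : I -> Rn -> R) :
  (forall i, bounded_function (f i)) ->
  F (fun x => \sum_(i <- s) f i x) = \sum_(i <- s) F (f i).
Proof.
have [FD FZ F0] := F_pos; move=> bf.
have b0 : bounded_function (fun _ : Rn => 0 : R) by exists 0 => x; rewrite normr0.
suff : bounded_function (fun x => \sum_(i <- s) f i x) /\
  F (fun x => \sum_(i <- s) f i x) = \sum_(i <- s) F (f i) by case.
elim: s => [|i s [bs IH]].
  under eq_fun do rewrite big_nil; split => //.
  rewrite big_nil -[RHS](mul0r (F (fun=> 0))) -FZ//; congr F.
  by apply/funext => x; rewrite mul0r.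
under eq_fun do rewrite big_cons; split; first exact: bounded_functionD.
by rewrite FD// IH big_cons.
Qed.

Let content_ge0 A : 0 <= content A.
Proof.
by have [_ _ F0] := F_pos; apply: F0.
Qed.

Let content_le A B : A `<=` B -> content A <= content B.
Proof.
move=> AB; apply: positive_functional_le => // x; rewrite !indicE.
case: (boolP (x \in A)) => [/set_mem/AB/mem_set ->//|_].
by case: (x \in B).
Qed.

Let contentU A B : content (A `|` B) <= content A + content B.
Proof.
have [FD _ _] := F_pos; rewrite /content -FD//.
apply: positive_functional_le => //; first exact: bounded_functionD.
by move=> x; rewrite !indicE in_setU; case: (_ \in _); case: (_ \in _) => /=; rewrite ?mulr1n ?mulr0n; lra.
Qed.

Let contentDU A B : A `&` B = set0 -> content A + content B <= content (A `|` B).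
Proof.
have [FD _ _] := F_pos; move=> AB; rewrite /content -FD//.
apply: positive_functional_le => //; first exact: bounded_functionD.
move=> x; rewrite !indicE in_setU.
have : x \notin (A `&` B) by rewrite AB in_set0.
by rewrite in_setI; case: (_ \in _); case: (_ \in _) => //= _; rewrite ?mulr1n ?mulr0n; lra.
Qed.

Let content0 : content set0 = 0.
Proof.
have [_ FZ _] := F_pos; rewrite -[RHS](mul0r (F \1_set0)) -FZ//; congr F.
by apply/funext => x; rewrite indicE in_set0 mulr0.
Qed.

(* For [U] open, a compact exhaustion of [U]. *)
Let erode (k : nat) (U : set Rn) : set Rn :=
  [set x | (forall y, `|x - y| < k.+1%:R^-1 -> U y) /\ `|x| <= k.+1%:R].

Let erode_sub k U : erode k U `<=` U.
Proof. by move=> x [H _]; apply: H; rewrite subrr normr0 invr_gt0. Qed.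

Let erode_leq j k U : (j <= k)%N -> erode j U `<=` erode k U.
Proof.
move=> jk x [H xj]; split; last by rewrite (le_trans xj)// ler_nat ltnS.
by move=> y xy; apply: H; rewrite (lt_le_trans xy)// lef_pV2 ?posrE// ler_nat ltnS.
Qed.

Let erode_subset k U W : U `<=` W -> erode k U `<=` erode k W.
Proof. by move=> UW x [H xk]; split => // y xy; apply: UW; exact: H. Qed.

Let closed_erode k U : closed (erode k U).
Proof.
have -> : erode k U = \bigcap_(y in ~` U) ~` [set x | `|x - y| < k.+1%:R^-1] `&`
    [set x | `|x| <= k.+1%:R].
  apply/seteqP; split => x [H xk]; split => //.
    by move=> y /= Uy xy; apply: Uy; exact: H.
  by move=> y xy; apply: contrapT => Uy; apply: (H y).
apply: closedI.
  apply: closed_bigI => y _; apply: open_closedC.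
  have -> : [set x | `|x - y| < k.+1%:R^-1] = ball y (k.+1%:R^-1 : R).
    by apply/seteqP; split => x; rewrite mx_norm_ball /ball_/= distrC.
  exact: ball_open.
have -> : [set x : Rn | `|x| <= k.+1%:R] = (fun x : Rn => `|x|) @^-1` [set r | r <= k.+1%:R] by [].
by apply: (closed_comp _ (@closed_le R _)) => x _; exact: norm_continuous.
Qed.

Let compact_erode k U : compact (erode k U).
Proof.
have -> : erode k U = closure (erode k U) by exact/closure_id/closed_erode.
by apply/compact_closure_rVP; exists k.+1%:R => x [].
Qed.

(** F is only finitely additive and may place mass near the boundary of U or at infinity. The
    supremum over the compact exhaustion discards that mass, which makes countable subadditivity
    possible. *)
Let inner (U : set Rn) : \bar R := ereal_sup [set (content (erode k U))%:E | k in setT].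

Let inner_ge k U : ((content (erode k U))%:E <= inner U)%E.
Proof. by apply: ereal_sup_ubound; exists k. Qed.

Let inner_ge0 U : (0 <= inner U)%E.
Proof. by apply: le_trans (inner_ge 0 U); rewrite lee_fin. Qed.

Let inner_le_content U : (inner U <= (content U)%:E)%E.
Proof.
apply: ge_ereal_sup => _ [k _ <-]; rewrite lee_fin; apply: content_le.
exact: erode_sub.
Qed.

Let inner_le U W : U `<=` W -> (inner U <= inner W)%E.
Proof.
move=> UW; apply: ge_ereal_sup => _ [k _ <-]; apply: le_trans (inner_ge k W).
by rewrite lee_fin; apply: content_le; exact: erode_subset.
Qed.

Let content_bigcup (N : nat) (A : nat -> set Rn) :
  content (\bigcup_(j < N) A j) <= \sum_(j < N) content (A j).
Proof.
rewrite bigcup_mkord; elim: N => [|N IH]; first by rewrite !big_ord0 content0.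
by rewrite !big_ord_recr/= (le_trans (contentU _ _))// lerD2r.
Qed.

(** The sets [W N] increase and their interiors cover the compact set [erode k], so a single N
    suffices. This turns finite subadditivity of the content into countable subadditivity of
    [inner]. *)
Let erode_bigcup k (U : nat -> set Rn) : (forall j, open (U j)) ->
  exists N, erode k (\bigcup_j U j) `<=` \bigcup_(j < N) erode N (U j).
Proof.
move=> oU; pose W N := \bigcup_(j < N) erode N (U j).
have WW M N : (M <= N)%N -> W M `<=` W N.
  move=> MN x [j /= jM Ej]; exists j => /=; first exact: leq_trans MN.
  exact: erode_leq Ej.
have cK : compact (erode k (\bigcup_j U j)) by exact: compact_erode.
move: cK; rewrite compact_cover => /(_ nat setT (fun N => (W N)^°)).
case=> [N _|x /erode_sub[j _ Ujx]|D _ KD]; first exact: open_interior.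
  have /nbhs_ballP[e /= e0 eU] : nbhs x (U j) by exact: open_nbhs_nbhs.
  (* With 1/(N+1) <= e/2, every point within e/2 of x still has its ball of radius 1/(N+1) inside U
     j. *)
  have [N [jN aN bN]] : exists N : nat, [/\ (j < N)%N, 2 / e <= N.+1%:R & `|x| + e / 2 <= N.+1%:R].
    exists (maxn j.+1 (maxn (Num.truncn (2 / e)) (Num.truncn (`|x| + e / 2)))).
    rewrite leq_max leqnn; split => //.
      by rewrite (le_trans (ltW (truncnS_gt _)))// ler_nat ltnS !leq_max leqnn orbT.
    by rewrite (le_trans (ltW (truncnS_gt _)))// ler_nat ltnS !leq_max leqnn !orbT.
  have Ne : N.+1%:R^-1 <= e / 2 :> R.
    by rewrite -[e / 2]invrK lef_pV2 ?posrE ?invr_gt0 ?divr_gt0// invf_div.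
  exists N => //; apply/nbhs_ballP; exists (e / 2) => /=; first by rewrite divr_gt0.
  move=> y; rewrite mx_norm_ball /ball_/= => xy.
  exists j => //=.
  split => [z yz|].
    apply: eU; rewrite mx_norm_ball /ball_/= -(subrKA y) [e]splitr.
    by rewrite (le_lt_trans (ler_normD _ _))// ltrD// (lt_le_trans yz).
  rewrite -[y](subrK x) (le_trans (ler_normD _ _))// distrC.
  apply: (@le_trans _ _ (`|x| + e / 2)); last exact: bN.
  by rewrite addrC lerD2l ltW.
exists (\max_(i <- finmap.enum_fset D) i)%N => x /KD[N /= ND].
move=> /interior_subset; apply: WW.
exact: (@leq_bigmax_seq _ _ xpredT id).
Qed.

Let inner_bigcup (U : nat -> set Rn) : (forall j, open (U j)) ->
  (inner (\bigcup_j U j) <= \sum_(j <oo) inner (U j))%E.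
Proof.
move=> oU; apply: ge_ereal_sup => _ [k _ <-].
have [N HN] := erode_bigcup k oU.
apply: (@le_trans _ _ (\sum_(j < N) inner (U j))%E); last first.
  rewrite -(big_mkord xpredT (fun j => inner (U j))).
  exact: nneseries_lim_ge.
apply: (@le_trans _ _ (\sum_(j < N) content (erode N (U j)))%:E).
  by rewrite lee_fin (le_trans (content_le HN)).
by rewrite -sumEFin; apply: lee_sum => j _; exact: inner_ge.
Qed.

Let outer (A : set Rn) : \bar R := ereal_inf [set inner U | U in [set U | open U /\ A `<=` U]].

Let outer_open U : open U -> outer U = inner U.
Proof.
move=> oU; apply/eqP; rewrite eq_le; apply/andP; split.
  by apply: ereal_inf_lbound; exists U => //; split.
by apply: le_ereal_inf_tmp => _ [W [oW UW] <-]; exact: inner_le.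
Qed.

Let outer_ge0 A : (0 <= outer A)%E.
Proof. by apply: le_ereal_inf_tmp => _ [U _ <-]; exact: inner_ge0. Qed.

Let outer_le : {homo outer : A B / A `<=` B >-> (A <= B)%E}.
Proof.
move=> A B AB; apply: le_ereal_inf_tmp => _ [U [oU BU] <-].
by apply: ereal_inf_lbound; exists U => //; split => //; exact: subset_trans BU.
Qed.

Let outer0 : outer set0 = 0%E.
Proof.
apply/eqP; rewrite eq_le outer_ge0 andbT outer_open; last exact: open0.
by apply: le_trans (inner_le_content _) _; rewrite content0.
Qed.

Let outer_fin A : outer A \is a fin_num.
Proof.
rewrite ge0_fin_numE//; apply: (@le_lt_trans _ _ (content setT)%:E); last exact: ltry.
apply: le_trans (outer_le (@subsetT _ A)) _; rewrite outer_open ?inner_le_content//.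
exact: openT.
Qed.

Let outer_adherent A (e : R) : 0 < e -> exists U, [/\ open U, A `<=` U &
  (inner U <= outer A + e%:E)%E].
Proof.
move=> e0; have [_ [U [oU AU] <-] /ltW UA] := lb_ereal_inf_adherent e0 (outer_fin A).
by exists U.
Qed.

Let outer_sigma_subadditive : sigma_subadditive outer.
Proof.
move=> A; apply/lee_addgt0Pr => e e0.
apply: (le_trans _ (epsilon_trick _ (fun k => outer_ge0 (A k)) (ltW e0))).
have H k : exists U, [/\ open U, A k `<=` U & (inner U <= outer (A k) + (e / (2 ^ k.+1)%:R)%:E)%E].
  by apply: outer_adherent; rewrite divr_gt0// ltr0n expn_gt0.
pose U k := projT1 (cid (H k)).
have oU k : open (U k) by rewrite /U; case: cid => ? [].
apply: (@le_trans _ _ (inner (\bigcup_k U k))).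
  apply: ereal_inf_lbound; exists (\bigcup_k U k) => //; split.
    exact: bigcup_open.
  by move=> x [k _ Ak]; exists k => //; rewrite /U; case: cid => ? /= [_ + _]; apply.
apply: (le_trans (inner_bigcup oU)); apply: lee_nneseries => [k _ _|k _]; first exact: inner_ge0.
by rewrite /U; case: cid => ? [].
Qed.

Let outer_measure_outer := isOuterMeasure.Build R Rn outer
  outer0 outer_ge0 outer_le outer_sigma_subadditive.

Let om : {outer_measure set Rn -> \bar R} := HB.pack outer outer_measure_outer.

(** For open U containing X, let K be an erosion of U [&] W. Then U minus K is open and contains U
    minus W. Any erosion of it is disjoint from K, and both lie in a common erosion of U, where the
    content is superadditive. *)
Let open_caratheodory W : open W -> caratheodory_measurable om W.
Proof.
move=> oW; apply: le_caratheodory_measurable => X; rewrite /om/=.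
apply: le_ereal_inf_tmp => _ [U [oU XU] <-].
apply: (@le_trans _ _ (inner (U `&` W) + outer (U `&` ~` W))%E).
  apply: leeD; last by apply: outer_le; exact: setSI.
  apply: ereal_inf_lbound; exists (U `&` W) => //; split; first exact: openI.
  exact: setSI.
rewrite -leeBrDr ?outer_fin//; apply: ge_ereal_sup => _ [k _ <-].
rewrite leeBrDr ?outer_fin//.
pose V := U `&` ~` erode k (U `&` W).
have oV : open V by apply: openI => //; rewrite openC; exact: closed_erode.
apply: (@le_trans _ _ ((content (erode k (U `&` W)))%:E + inner V)%E).
  rewrite leeD2l// -outer_open//; apply: outer_le => x [Ux Wx]; split => //.
  by move=> /erode_sub[].
rewrite addeC -leeBrDr//; apply: ge_ereal_sup => _ [j _ <-].
rewrite leeBrDr// -EFinD.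
apply: le_trans (inner_ge (maxn j k) U); rewrite lee_fin.
apply: le_trans (contentDU _) _.
  by apply/seteqP; split => // x [/erode_sub[_ h] /h].
apply: content_le => x [Ex|Ex].
  apply: (erode_leq (leq_maxl j k)); apply: erode_subset Ex; exact: subIsetl.
by apply: (erode_leq (leq_maxr j k)); apply: erode_subset Ex; exact: subIsetl.
Qed.

Let borel_caratheodory (A : set Rn) : measurable A -> caratheodory_measurable om A.
Proof.
have : @measurable _ Rn `<=` [set A | caratheodory_measurable om A].
  rewrite measurable_rVE; apply: smallest_sub; last exact: open_caratheodory.
  exact: (@sigma_algebra_measurable _ (caratheodory_type om)).
by apply.
Qed.

Let outer_semi_sigma_additive : semi_sigma_additive (outer : set Rn -> \bar R).
Proof.
move=> A mA tA mUA.
apply: (@caratheodory_measure_sigma_additive R Rn om A _ tA).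
  by move=> k; exact: borel_caratheodory.
exact: borel_caratheodory.
Qed.

(** The comparison is two-sided but not an equality: part of what F sees on U may escape to the
    boundary or to infinity. The reverse inequality is stated for sets W that are bounded and
    uniformly inside U. *)
Lemma positive_functional_measure : exists mu : {finite_measure set Rn -> \bar R},
  [/\ forall U, open U -> fine (mu U) <= F \1_U &
   forall U W, open U -> (exists k : nat, forall x, W x -> `|x| <= k%:R /\
       forall y, `|x - y| < k.+1%:R^-1 -> U y) -> F \1_W <= fine (mu U)].
Proof.
pose mu1 := isMeasure.Build _ Rn R outer outer0 outer_ge0 outer_semi_sigma_additive.
pose mu0 : {measure set Rn -> \bar R} := HB.pack outer mu1.
have fm : fin_num_fun mu0 by move=> A _; exact: outer_fin.
pose mu : {finite_measure set Rn -> \bar R} :=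
  HB.pack outer mu1 (Measure_isFinite.Build _ _ _ mu0 fm).
exists mu; split => [U oU|U W oU [k H]].
  rewrite -lee_fin fineK; last exact: outer_fin.
  by rewrite /mu/= outer_open// inner_le_content.
rewrite -lee_fin fineK; last exact: outer_fin.
rewrite /mu/= outer_open//; apply: le_trans (inner_ge k U).
rewrite lee_fin; apply: content_le => x /H[xk Hx]; split => //.
by rewrite (le_trans xk)// ler_nat.
Qed.

End positive_functionals.

Section riesz_integral.
Context {R : realType} {n : nat}.
Local Notation Rn := 'rV[R]_n.

(** A discrete layer-cake formula: u is compared with the number of integer levels below it, counted
    from 1 and from 0. *)
Lemma level_sum (u : R) (K : nat) : 0 <= u -> u <= K%:R ->
  \sum_(k < K) ((k.+1%:R < u)%R%:R) <= u <= \sum_(k < K) ((k%:R < u)%R%:R).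
Proof.
move=> u0; elim: K => [|K IH] uK.
  by rewrite !big_ord0 u0 uK.
rewrite !big_ord_recr/= [K.+1%:R < u]ltNge uK addr0.
have [uK'|Ku] := leP u K%:R.
  by have := IH uK'; rewrite addr0.
have le1 (b : nat -> bool) : \sum_(k < K) ((b k)%:R : R) <= K%:R.
  apply: (@le_trans _ _ (\sum_(k < K) 1)); last by rewrite sumr_const card_ord.
  by apply: ler_sum => k _; case: (b k); rewrite ?lexx ?ler01.
rewrite (le_trans (le1 (fun k => k.+1%:R < u)) (ltW Ku))/=.
apply: (le_trans uK); rewrite -natr1 lerD2r.
apply: (@le_trans _ _ (\sum_(k < K) 1)); first by rewrite sumr_const card_ord.
by apply: ler_sum => k _; rewrite (lt_trans _ Ku)// ltr_nat.
Qed.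

Variable F : (Rn -> R) -> R.
Hypothesis F_pos : positive_functional F.

(** Let U_k = {k < N g}. Then N g lies between the sums of the indicators of U_(k+1) and of U_k.
    With a_k = F(1_(U_k)) and b_k = mu(U_k), the bounds a_(k+1) <= b_k <= a_k confine N F(g) and N
    int g to a common range, up to 2V. Dividing by N and letting N grow gives equality. *)
Lemma riesz_lipschitz : exists mu : {finite_measure set Rn -> \bar R},
  forall (g : Rn -> R) (C L M : R), continuous g -> (forall x, 0 <= g x <= C) ->
    (forall x y, `|g x - g y| <= L * `|x - y|) -> (forall x, g x != 0 -> `|x| <= M) ->
    \int[mu]_x g x = F g.
Proof.
have [mu [muU muW]] := positive_functional_measure F_pos.
have [FD FZ F0] := F_pos.
exists mu => g C L M cg gC gL gM.
have mg : measurable_fun setT g by exact: continuous_measurable_rV.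
pose V := F \1_setT.
have V0 : 0 <= V by apply: F0 => //; exact: bounded_function_indic.
have ib (A : set Rn) : bounded_function (\1_A : Rn -> R) by exact: bounded_function_indic.
have bg : bounded_function g.
  by exists C => x; have /andP[? ?] := gC x; rewrite ger0_norm.
have jg : mu.-integrable setT (EFin \o g).
  by apply: (@integrable_bounded _ _ _ mu g C mg) => x; have /andP[? ?] := gC x; rewrite ger0_norm.
suff H (N : nat) : (0 < N)%N -> `|\int[mu]_x g x - F g| * N%:R <= V + V.
  apply/eqP; rewrite -subr_eq0 -normr_le0 leNgt; apply/negP => d0.
  set d := `|_| in d0 H.
  have := H (Num.truncn ((V + V) / d)).+1 isT.
  by rewrite leNgt => /negP; apply; rewrite mulrC -ltr_pdivrMr// truncnS_gt.
move=> N0; have N0' : 0 < N%:R :> R by rewrite ltr0n.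
pose u x := N%:R * g x.
have cu : continuous u by move=> x; apply: (@continuousM _ _ (fun=> N%:R) g); [exact: cst_continuous|exact: cg].
pose U k : set Rn := [set x | k%:R < u x].
have oU k : open (U k) by apply: (@open_comp _ _ u [set r | k%:R < r]) => [x _|]; [exact: cu|exact: open_gt].
have mU k : measurable (U k) by exact: sub_sigma_algebra.
pose K := (Num.truncn (N%:R * C)).+1.
have u0 x : 0 <= u x by rewrite mulr_ge0//; have /andP[] := gC x.
have uK x : u x <= K%:R.
  rewrite (@le_trans _ _ (N%:R * C))//; last by rewrite ltW// truncnS_gt.
  by rewrite ler_wpM2l//; have /andP[] := gC x.
pose a k := F (\1_(U k)); pose b k := fine (mu (U k)).
have lev x : \sum_(k < K) (\1_(U k.+1) x : R) <= u x <= \sum_(k < K) (\1_(U k) x : R).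
  have E k : \1_(U k) x = (k%:R < u x)%R%:R :> R.
    by rewrite indicE; congr ((_ : bool)%:R); apply/idP/idP => [/set_mem//|/mem_set].
  have EK (c : nat -> nat) : \sum_(k < K) (\1_(U (c k)) x : R) = \sum_(k < K) ((c k)%:R < u x)%R%:R.
    by apply: eq_bigr => k _; exact: E.
  by rewrite (EK S) (EK id) level_sum.
have sb (c : nat -> nat) : bounded_function (fun x => \sum_(k < K) (\1_(U (c k)) x : R)).
  exists K%:R => x; rewrite ger0_norm ?sumr_ge0//.
  apply: (@le_trans _ _ (\sum_(k < K) 1)); last by rewrite sumr_const card_ord.
  by apply: ler_sum => k _; rewrite indicE; case: (_ \in _); rewrite ?lexx ?ler01.
have ms (c : nat -> nat) : measurable_fun setT (fun x => \sum_(k < K) (\1_(U (c k)) x : R)).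
  by apply: measurable_sum => k; exact: measurable_indic.
have js (c : nat -> nat) : mu.-integrable setT (EFin \o (fun x => \sum_(k < K) (\1_(U (c k)) x : R))).
  by have [C' HC'] := sb c; exact: integrable_bounded HC'.
have Es (c : nat -> nat) : F (fun x => \sum_(k < K) (\1_(U (c k)) x : R)) = \sum_(k < K) a (c k).
  by rewrite (positive_functional_sum F_pos (index_enum 'I_K) (f := fun k x => \1_(U (c k)) x)).
have Is (c : nat -> nat) : \int[mu]_x (\sum_(k < K) (\1_(U (c k)) x : R)) = \sum_(k < K) b (c k).
  rewrite (@Rintegral_sum _ _ _ mu _ (index_enum 'I_K) (fun k x => \1_(U (c k)) x)).
    by apply: eq_bigr => k _; rewrite Rintegral_indic.
  by move=> k; exact: integrable_indicator.
have bu : bounded_function u by exact: bounded_functionZ.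
have Fu : F u = N%:R * F g by rewrite FZ.
have ju : mu.-integrable setT (EFin \o u) by exact: integrable_Zl.
have Iu : \int[mu]_x u x = N%:R * \int[mu]_x g x by rewrite RintegralZ.
have Fle : \sum_(k < K) a k.+1 <= N%:R * F g <= \sum_(k < K) a k.
  rewrite -Fu; apply/andP; split.
    have <- := Es S; apply: (positive_functional_le F_pos (sb S) bu) => x.
    by have /andP[] := lev x.
  have <- := Es id; apply: (positive_functional_le F_pos bu (sb id)) => x.
  by have /andP[] := lev x.
have Ile : \sum_(k < K) b k.+1 <= N%:R * \int[mu]_x g x <= \sum_(k < K) b k.
  rewrite -Iu; apply/andP; split.
    have <- := Is S; apply: (le_Rintegral_mu (js S) ju) => x.
    by have /andP[] := lev x.
  have <- := Is id; apply: (le_Rintegral_mu ju (js id)) => x.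
  by have /andP[] := lev x.
have ba k : b k <= a k by exact: muU.
(* The Lipschitz bound and the bounded support are used here: they place {k + 1 < u} uniformly
   inside {k < u}. *)
have ab k : a k.+1 <= b k.
  apply: muW => //.
  exists (maxn (Num.truncn M).+1 (Num.truncn (N%:R * L)).+1) => x Ux; split.
    rewrite (@le_trans _ _ M)//.
      apply: gM; apply: contraTneq Ux => gx0.
      by apply/negP; rewrite /U/= /u gx0 mulr0 ltNge ler0n.
    by rewrite (le_trans (ltW (truncnS_gt _)))// ler_nat leq_maxl.
  move=> y xy; rewrite /U/=.
  have h1 : u x - u y <= 1.
    rewrite /u -mulrBr (le_trans (ler_wpM2l (ltW N0') (le_trans (ler_norm _) (gL x y))))//.
    rewrite mulrA; set T := N%:R * L in xy *.
    have [T0|T0] := leP T 0; first by rewrite (le_trans _ ler01)// mulr_le0_ge0.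
    rewrite (le_trans (ler_wpM2l (ltW T0) (ltW xy)))// ler_pdivrMr// mul1r.
    by rewrite (le_trans (ltW (truncnS_gt _)))// ler_nat leqW// leq_maxr.
  by move: Ux; rewrite /U/= -natr1 => ?; lra.
have bV k : b k <= V.
  rewrite (le_trans (ba k))//; apply: (positive_functional_le F_pos) => // x.
  by rewrite !indicE in_setT; case: (_ \in _).
have aV k : a k <= V.
  apply: (positive_functional_le F_pos) => // x.
  by rewrite !indicE in_setT; case: (_ \in _).
have a0 k : 0 <= a k by apply: F0 => // x; rewrite indicE.
have b0 k : 0 <= b k by exact: fine_ge0.
(* Moving the index by one costs a single term, at most V, independently of N. *)
have shift (c : nat -> R) J : (forall k, 0 <= c k) -> c 0%N <= V ->
    \sum_(k < J) c k <= V + \sum_(k < J) c k.+1.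
  move=> c0 cV; case: J => [|J]; first by rewrite !big_ord0 addr0.
  by rewrite big_ord_recl lerD// [leRHS]big_ord_recr/= lerDl.
have s1 := shift a K a0 (aV 0%N); have s2 := shift b K b0 (bV 0%N).
have t1 : \sum_(k < K) a k.+1 <= \sum_(k < K) b k by apply: ler_sum.
have t2 : \sum_(k < K) b k <= \sum_(k < K) a k by apply: ler_sum.
have /andP[f1 f2] := Fle; have /andP[i1 i2] := Ile.
rewrite -[X in _ * X](gtr0_norm N0') -normrM ler_norml; apply/andP; split; nra.
Qed.

End riesz_integral.

Section riesz.
Context {R : realType} {n : nat}.
Local Notation Rn := 'rV[R]_n.

Let center (k : nat) : Rn := if unpickle k is Some q then map_mx ratr (q : 'rV[rat]_n) else 0.

Let center_dense (r : R) (x : Rn) : 0 < r -> exists k, `|x - center k| < r.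
Proof.
move=> r0.
have H i : exists q : rat, `|x ord0 i - ratr q| < r.
  have [q /itvP qi] : exists q : rat, ratr q \in `](x ord0 i - r), (x ord0 i + r)[.
    by apply: rat_in_itvoo; rewrite ltrBlDr -addrA ltrDl addr_gt0.
  exists q; have h1 : x ord0 i - r < ratr q by rewrite qi.
  have h2 : ratr q < x ord0 i + r by rewrite qi.
  by rewrite ltr_norml; apply/andP; split; lra.
exists (pickle (\row_i projT1 (cid (H i)) : 'rV[rat]_n)); rewrite /center pickleK.
rewrite [`|_|]mx_normrE; apply: bigmax_lt => // -[i j] _ /=.
by rewrite !mxE ord1; case: cid.
Qed.

(** The products prod_{j<k} (1 - b_j)^m (1 - (1 - b_k)^m) telescope: their sum over k < m is 1 -
    prod_{j<m} (1 - b_j)^m. By density of the centres and compactness of the ball, the last product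
    drops below 1/(N+1) there for some m, so no division by a sum of bumps occurs. *)
Lemma approximate_partition (N : nat) : exists m (c : nat -> Rn) (e : nat -> Rn -> R),
  [/\ forall k, test01 (e k), forall k y, e k y != 0 -> `|y - c k| < N.+1%:R^-1,
    forall y, \sum_(k < m) e k y <= 1 &
    forall y, `|y| <= N%:R -> 1 - N.+1%:R^-1 <= \sum_(k < m) e k y].
Proof.
have r0 : 0 < N.+1%:R^-1 :> R by rewrite invr_gt0.
pose b k := cube_bump (center k) (N.+1%:R^-1).
have tb k : test01 (b k) by exact: test01_bump.
pose e m k y := (\prod_(j < k) (1 - b j y) ^+ m) * (1 - (1 - b k y) ^+ m).
have P01 m k y : 0 <= \prod_(j < k) (1 - b j y) ^+ m <= 1.
  have := (test01_union k m tb).2 y; set p := \prod_(j < k) _ => /andP[? ?].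
  by apply/andP; split; lra.
have sP m k : smooth (fun y => \prod_(j < k) (1 - b j y) ^+ m).
  have [[+ _] _] := test01_union k m tb => /smooth_onem.
  by congr smooth; apply/funext => y; rewrite subKr.
have te m k : test01 (e m k).
  apply: test01_mull => //.
  have := test01_union 1 m (fun _ => tb k).
  by congr test01; apply/funext => y; rewrite big_ord1.
have Ee m M y : \sum_(k < M) e m k y = 1 - \prod_(j < M) (1 - b j y) ^+ m.
  elim: M => [|M IH]; first by rewrite !big_ord0 subrr.
  rewrite !big_ord_recr/= IH /e; ring.
pose h m y := \prod_(j < m) (1 - b j y) ^+ m.
have b01 j y : 0 <= 1 - b j y <= 1.
  by have /andP[? ?] := (tb j).2 y; apply/andP; split; lra.
have hle m m' y : (m <= m')%N -> h m' y <= h m y.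
  move=> mm; rewrite /h -(subnKC mm) big_split_ord/=.
  rewrite -[leRHS]mulr1 ler_pM//.
  - by apply: prodr_ge0 => j _; have /andP[? ?] := b01 j y; exact: exprn_ge0.
  - by apply: prodr_ge0 => j _; have /andP[? ?] := b01 (m + j)%N y; exact: exprn_ge0.
  - apply: ler_prod => j _; have /andP[? ?] := b01 j y.
    by rewrite exprn_ge0//= exprD ler_piMr ?exprn_ge0// exprn_ile1.
  - apply: prodr_ile1 => j _; have /andP[? ?] := b01 (m + j)%N y.
    by rewrite exprn_ge0//= exprn_ile1.
pose O m : set Rn := [set y | h m y < N.+1%:R^-1].
have oO m : open (O m).
  apply: (@open_comp _ _ (h m) [set r | r < N.+1%:R^-1]) => [y _|]; last exact: open_lt.
  exact: (Ck_continuous (sP m m 0%N)).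
have cK : compact (closure [set y : Rn | `|y| <= N%:R]) by apply/compact_closure_rVP; exists N%:R.
have [m Hm] : exists m, [set y : Rn | `|y| <= N%:R] `<=` O m.
  move: cK; rewrite compact_cover => /(_ nat setT O); case=> //.
    move=> y _; have [k bk] := center_dense y r0.
    rewrite -bump_gt0// -/(b k y) in bk.
    have /andP[q0 q1] := b01 k y.
    have bk0 : 0 < b k y by rewrite lt_neqAle eq_sym bk; have /andP[] := (tb k).2 y.
    have q1' : `|1 - b k y| < 1 by rewrite ger0_norm// ltrBlDr ltrDl.
    have /cvgrPdist_lt /(_ _ r0)[M _ HM] := cvg_expr q1'.
    exists (maxn k.+1 M) => //; rewrite /O/=.
    have {}HM := HM (maxn k.+1 M) (leq_maxr _ _).
    apply: le_lt_trans HM; rewrite sub0r normrN.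
    have kM : (k < maxn k.+1 M)%N by rewrite leq_max leqnn.
    apply: le_trans (ler_norm _).
    rewrite /h (bigD1 (Ordinal kM))//= ler_piMr ?exprn_ge0//.
    apply: prodr_ile1 => j _; have /andP[? ?] := b01 j y.
    by rewrite exprn_ge0//= exprn_ile1.
  move=> D _ HD; exists (\max_(i <- finmap.enum_fset D) i)%N => y /subset_closure/HD[k /= kD].
  rewrite /O/=; apply: le_lt_trans; apply: hle.
  exact: (@leq_bigmax_seq _ _ xpredT id).
exists m, center, (e m); split.
- exact: te.
- move=> k y; rewrite /e mulf_eq0 negb_or => /andP[_].
  rewrite -bump_gt0// -/(b k y); apply: contraNneq => ->.
  by rewrite subr0 expr1n subrr.
- by move=> y; rewrite Ee gerBl; have /andP[] := P01 m m y.
- move=> y /Hm; rewrite /O/= /h Ee; set p := \prod_(j < m) _ => ?.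
  by rewrite lerD2l lerN2 ltW.
Qed.

End riesz.

Section riesz_representation.
Context {R : realType} {n : nat}.
Local Notation Rn := 'rV[R]_n.

Lemma test_functionD (f g : Rn -> R) :
  test_function f -> test_function g -> test_function (fun x => f x + g x).
Proof.
move=> [sf [M H]] [sg [N K]]; split; first exact: smoothD.
exists (Num.max M N) => x xj; rewrite le_max.
have [p0|/H ->//] := eqVneq (f x) 0.
by rewrite K ?orbT//; apply: contra xj => /eqP ->; rewrite p0 addr0.
Qed.

Lemma test_functionZ c (f : Rn -> R) :
  test_function f -> test_function (fun x => c * f x).
Proof.
move=> [sf [M H]]; split; first by apply: smoothM => //; exact: smooth_cst.
by exists M => x xj; apply: H; apply: contra xj => /eqP ->; rewrite mulr0.
Qed.

Lemma test_function_sum (I : Type) (s : seq I) (F : I -> Rn -> R) :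
  (forall i, test_function (F i)) -> test_function (fun x => \sum_(i <- s) F i x).
Proof.
move=> H; elim: s => [|a s IH].
  under eq_fun do rewrite big_nil; split; first exact: smooth_cst.
  by exists 0 => x; rewrite eqxx.
by under eq_fun do rewrite big_cons; exact: test_functionD.
Qed.

Lemma test_function_lipschitz (g : Rn -> R) : test_function g ->
  exists2 l : R, 0 <= l & forall x y, `|g x - g y| <= l * `|x - y|.
Proof.
move=> tg; have [n0|n0] := posnP n.
  exists 0 => // x y; rewrite (_ : x = y) ?subrr ?normr0 ?mul0r//.
  apply/rowP => i; suff: false by [].
  by move: (ltn_ord i); move: (nat_of_ord i) => k; rewrite n0.
have [l l0 Hl] := test_field_lipschitz (test_function_vec (const_mx 1) tg).
exists (l * n%:R); first by rewrite mulr_ge0.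
move=> x y; rewrite -mulrA; apply: le_trans (ler_wpM2l l0 (enorm_le_norm _)).
apply: le_trans (Hl y x).
have := normr_coord_le_enorm (g x *: (const_mx 1 : Rn) - g y *: const_mx 1) (Ordinal n0).
by rewrite !mxE !mulr1.
Qed.

Lemma max0_dist (a b : R) : `|Num.max a 0 - Num.max b 0| <= `|a - b|.
Proof.
have h1 := ler_norm (a - b); have h2 := ler_norm (b - a); rewrite distrC in h2.
by rewrite ler_norml !maxElt; case: ltP => ?; case: ltP => ?; apply/andP; split; lra.
Qed.

Lemma max0_split (a : R) : Num.max (1 * a) 0 + -1 * Num.max (-1 * a) 0 = a.
Proof.
rewrite !maxElt mul1r !mulN1r oppr_lt0.
by case: (ltgtP a 0) => [a0|a0|->]; rewrite ?oppr0 ?addr0 ?opprK ?add0r.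
Qed.

Variables (L : (Rn -> R) -> R) (V : R).
Hypothesis LD : forall f g, test_function f -> test_function g ->
  L (fun x => f x + g x) = L f + L g.
Hypothesis LZ : forall c f, test_function f -> L (fun x => c * f x) = c * L f.
Hypothesis LV : forall f C, test_function f -> (forall x, `|f x| <= C) -> `|L f| <= V * C.

Let test_function0 : test_function (fun _ : Rn => 0 : R).
Proof. by have [] := @test01_0 R n. Qed.

Let V0 : 0 <= V.
Proof.
have := @LV _ 1 test_function0; rewrite mulr1 => H; apply: le_trans (H _); first exact: normr_ge0.
by move=> x; rewrite normr0.
Qed.

Let L_sum (m : nat) (a : nat -> R) (e : nat -> Rn -> R) : (forall k, test_function (e k)) ->
  L (fun x => \sum_(k < m) a k * e k x) = \sum_(k < m) a k * L (e k).
Proof.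
move=> te; elim: m => [|m IH].
  under eq_fun do rewrite big_ord0; rewrite big_ord0 -[RHS](mul0r (L (fun=> 0))) -LZ//.
  by congr L; apply/funext => x; rewrite mul0r.
under eq_fun do rewrite big_ord_recr/=; rewrite big_ord_recr/= LD.
- by rewrite IH LZ.
- by apply: (@test_function_sum _ (index_enum 'I_m) (fun k x => a k * e k x)) => k; exact: test_functionZ.
- exact: test_functionZ.
Qed.

(** Testing L on the sum of the functions sg(L e_k) e_k, which is bounded by 1, controls all the
    masses at once. *)
Let sum_masses (m : nat) (e : nat -> Rn -> R) : (forall k, test01 (e k)) ->
  (forall y, \sum_(k < m) e k y <= 1) -> \sum_(k < m) `|L (e k)| <= V.
Proof.
move=> te e1.
have -> : \sum_(k < m) `|L (e k)| = L (fun x => \sum_(k < m) Num.sg (L (e k)) * e k x).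
  rewrite (@L_sum _ (fun k => Num.sg (L (e k)))); last by move=> k; case: (te k).
  by apply: eq_bigr => k _; rewrite normrEsg.
apply: le_trans (ler_norm _) _; rewrite -[V]mulr1; apply: LV.
  apply: (@test_function_sum _ (index_enum 'I_m) (fun k x => Num.sg (L (e k)) * e k x)) => k.
  by apply: test_functionZ; case: (te k).
move=> x; apply: (le_trans (ler_norm_sum _ _ _)); apply: le_trans (e1 x).
apply: ler_sum => k _; have /andP[? ?] := (te k).2 x.
by rewrite normrM (ger0_norm (x := e k x))// ler_piMl// normr_sg; case: (_ != 0); rewrite ?ler01 ?lexx.
Qed.

(** The function g - sum g(c_k) e_k splits as g (1 - sum e_k) + sum (g - g(c_k)) e_k. The first term
    is small because the partition is almost complete where g lives, the second because e_k lives
    within 1/(N+1) of c_k. *)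
Let sampling (N m : nat) (c : nat -> Rn) (e : nat -> Rn -> R) (g : Rn -> R) (C l : R) :
  (forall k, test01 (e k)) -> (forall k y, e k y != 0 -> `|y - c k| < N.+1%:R^-1) ->
  (forall y, \sum_(k < m) e k y <= 1) ->
  (forall y, `|y| <= N%:R -> 1 - N.+1%:R^-1 <= \sum_(k < m) e k y) ->
  test_function g -> (forall x, `|g x| <= C) -> 0 <= l -> (forall x y, `|g x - g y| <= l * `|x - y|) ->
  (forall x, g x != 0 -> `|x| <= N%:R) ->
  `|L g - \sum_(k < m) L (e k) * g (c k)| <= V * (C + l) / N.+1%:R.
Proof.
move=> te ec e1 eN tg gC l0 gl gN.
have -> : \sum_(k < m) L (e k) * g (c k) = L (fun x => \sum_(k < m) g (c k) * e k x).
  rewrite (@L_sum _ (fun k => g (c k))); last by move=> k; case: (te k).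
  by apply: eq_bigr => k _; rewrite mulrC.
have ts : test_function (fun x => \sum_(k < m) g (c k) * e k x).
  apply: (@test_function_sum _ (index_enum 'I_m) (fun k x => g (c k) * e k x)) => k.
  by apply: test_functionZ; case: (te k).
rewrite -mulN1r -LZ// -LD//; last exact: test_functionZ.
rewrite -mulrA; apply: LV; first by apply: test_functionD => //; exact: test_functionZ.
move=> x.
have e0 k : 0 <= e k x by have /andP[] := (te k).2 x.
have -> : g x + -1 * (\sum_(k < m) g (c k) * e k x) =
    g x * (1 - \sum_(k < m) e k x) + \sum_(k < m) (g x - g (c k)) * e k x.
  rewrite mulrBr mulr1 mulN1r -addrA; congr (_ + _).
  by rewrite mulr_sumr addrC -sumrB -sumrN; apply: eq_bigr => k _; ring.
apply: (le_trans (ler_normD _ _)); rewrite mulrDl lerD//.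
  have [->|gx] := eqVneq (g x) 0.
    by rewrite mul0r normr0 divr_ge0// (le_trans (normr_ge0 (g x))).
  rewrite normrM ler_pM// ger0_norm ?subr_ge0//.
  by rewrite lerBlDr -lerBlDl; apply: eN; exact: gN.
apply: (le_trans (ler_norm_sum _ _ _)).
apply: (@le_trans _ _ (\sum_(k < m) (l / N.+1%:R) * e k x)); last first.
  by rewrite -mulr_sumr ler_piMr// divr_ge0.
apply: ler_sum => k _; have [->|ek] := eqVneq (e k x) 0; first by rewrite !mulr0 normr0.
rewrite normrM (ger0_norm (e0 k)) ler_wpM2r//.
by rewrite (le_trans (gl _ _))// ler_wpM2l// ltW// ec.
Qed.

Lemma riesz_representation : exists p q : {finite_measure set Rn -> \bar R},
  forall g, test_function g -> L g = \int[p]_x g x - \int[q]_x g x.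
Proof.
have [lim [limP lim_cvg]] := @generalized_limit R.
have [limD limZ lim0] := limP.
have /choice[m Hm] := @approximate_partition R n.
have /choice[c Hc] := Hm; have /choice[e He] := Hc.
(* For s = 1 and s = -1, the positive and negative parts of the discrete signed measure with mass
   L(e_k) at c_k. *)
pose S (s : R) (N : nat) (g : Rn -> R) : R :=
  \sum_(k < m N) Num.max (s * L (e N k)) 0 * g (c N k).
have mass s N : `|s| <= 1 -> \sum_(k < m N) Num.max (s * L (e N k)) 0 <= V.
  move=> s1; have [te _ e1 _] := He N; apply: le_trans (sum_masses te e1).
  apply: ler_sum => k _; rewrite ge_max normr_ge0 andbT (le_trans (ler_norm _))//.
  by rewrite normrM ler_piMl.
have Sb s g : `|s| <= 1 -> bounded_function g -> bounded_function (fun N => S s N g).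
  move=> s1 [C gC]; exists (V * C) => N; apply: (le_trans (ler_norm_sum _ _ _)).
  apply: (@le_trans _ _ (\sum_(k < m N) Num.max (s * L (e N k)) 0 * C)).
    apply: ler_sum => k _; rewrite normrM ger0_norm ?le_max ?lexx ?orbT//.
    by rewrite ler_wpM2l// le_max lexx orbT.
  rewrite -mulr_suml ler_wpM2r//; last exact: mass.
  by rewrite (le_trans (normr_ge0 (g 0))).
pose F s (g : Rn -> R) := lim (fun N => S s N g).
have F_pos s : `|s| <= 1 -> positive_functional (F s).
  move=> s1; split.
  - move=> f g bf bg; rewrite /F -limD; [|exact: Sb|exact: Sb].
    by congr lim; apply/funext => N; rewrite /S -big_split/=; apply: eq_bigr => k _; rewrite mulrDr.
  - move=> r f bf; rewrite /F -limZ; last exact: Sb.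
    by congr lim; apply/funext => N; rewrite /S mulr_sumr; apply: eq_bigr => k _; rewrite mulrCA.
  - move=> f bf f0; apply: lim0; first exact: Sb.
    by move=> N; apply: sumr_ge0 => k _; rewrite mulr_ge0// le_max lexx orbT.
have rep s : `|s| <= 1 -> exists mu : {finite_measure set Rn -> \bar R},
    forall g, test_function g -> \int[mu]_x g x = F s g.
  move=> s1; have Fs := F_pos s s1; have [mu Hmu] := riesz_lipschitz Fs.
  have [FD FZ F0] := Fs.
  exists mu => g tg; have [l l0 gl] := test_function_lipschitz tg.
  have [sg [M gM]] := tg.
  have cg := Ck_continuous (sg 0%N).
  have [C C0 gC] := compact_support_bounded cg gM.
  have gM0 x : ~~ (`|x| <= M) -> g x = 0 by move=> xM; apply/eqP; apply: contraNT xM => /gM.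
  (* [riesz_lipschitz] applies to nonnegative functions, and the positive and negative parts of g
     are Lipschitz but need not be smooth; this is why that lemma is stated for Lipschitz
     functions. *)
  have HF (t : R) : `|t| = 1 -> \int[mu]_x (Num.max (t * g x) 0) = F s (fun x => Num.max (t * g x) 0).
    move=> t1; apply: (Hmu _ C l M).
    - move=> x; apply: (@continuous_max _ _ (fun x => t * g x) (fun=> 0)); last exact: cst_continuous.
      by apply: continuousM; [exact: cst_continuous|exact: cg].
    - move=> x; rewrite le_max lexx orbT/= ge_max C0 andbT (le_trans (ler_norm _))//.
      by rewrite normrM t1 mul1r.
    - move=> x y; apply: le_trans (gl x y).
      rewrite (_ : `|g x - g y| = `|t * g x - t * g y|); last by rewrite -mulrBr normrM t1 mul1r.
      exact: max0_dist.
    - by move=> x; apply: contraNT => xM; rewrite (gM0 x xM) mulr0 maxxx.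
  have bm (t : R) : `|t| = 1 -> bounded_function (fun x => Num.max (t * g x) 0).
    move=> t1; exists C => x; rewrite ger0_norm ?le_max ?lexx ?orbT// ge_max C0 andbT.
    by rewrite (le_trans (ler_norm _))// normrM t1 mul1r.
  have mm (t : R) : measurable_fun setT (fun x => Num.max (t * g x) 0).
    apply: measurable_maxr => //; apply: measurable_funM => //.
    exact: continuous_measurable_rV.
  have jm (t : R) : `|t| = 1 -> mu.-integrable setT (EFin \o (fun x => Num.max (t * g x) 0)).
    by move=> t1; have [D HD] := bm t t1; exact: integrable_bounded HD.
  have gE x : g x = Num.max (1 * g x) 0 + -1 * Num.max (-1 * g x) 0.
    by rewrite max0_split.
  have n1 : `|1 : R| = 1 by rewrite normr1.
  have nN1 : `|-1 : R| = 1 by rewrite normrN1.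
  have b1 := bm 1 n1; have bN1 := bm (-1) nN1.
  rewrite (_ : g = fun x => Num.max (1 * g x) 0 + -1 * Num.max (-1 * g x) 0); last exact/funext.
  rewrite FD//; last exact: bounded_functionZ.
  rewrite FZ// -!HF// RintegralD//; first by rewrite RintegralZ//; exact: jm.
    exact: jm.
  by apply: integrable_Zl; exact: jm.
have [p Hp] := rep 1 ltac:(by rewrite normr1).
have [q Hq] := rep (-1) ltac:(by rewrite normrN1).
exists p, q => g tg; rewrite Hp// Hq//.
have [l l0 gl] := test_function_lipschitz tg.
have [sg [M gM]] := tg.
have [C C0 gC] := compact_support_bounded (Ck_continuous (sg 0%N)) gM.
have bg : bounded_function g by exists C.
have b1 : bounded_function (fun N => S 1 N g) by apply: Sb => //; rewrite normr1.
have bN1 : bounded_function (fun N => S (-1) N g) by apply: Sb => //; rewrite normrN1.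
rewrite /F -[X in _ - X]mul1r -mulNr -limZ// -limD//; last exact: bounded_functionZ.
have SE N : S 1 N g + -1 * S (-1) N g = \sum_(k < m N) L (e N k) * g (c N k).
  rewrite /S mulr_sumr -big_split/=; apply: eq_bigr => k _.
  rewrite mulrA -mulrDl; congr (_ * _).
  exact: max0_split.
apply/esym/lim_cvg.
  by apply: bounded_functionD => //; exact: bounded_functionZ.
under eq_fun do rewrite SE.
apply/cvgrPdist_le => r r0.
exists (maxn (Num.truncn M).+1 (Num.truncn (V * (C + l) / r)).+1) => // N /=.
rewrite geq_max => /andP[MN rN].
have [te ec e1 eN] := He N.
apply: (le_trans (sampling te ec e1 eN tg gC l0 gl _)).
  move=> x /gM xM; apply: (le_trans xM); apply: (le_trans (ltW (truncnS_gt _))).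
  by rewrite ler_nat.
rewrite ler_pdivrMr// [leRHS]mulrC -ler_pdivrMr//.
by rewrite (le_trans (ltW (truncnS_gt _)))// ler_nat leqW.
Qed.

End riesz_representation.

(** * Existence of the fractional variation *)

Section bounded_multiples.
Context d (T : measurableType d) {R : realType} (mu : {measure set T -> \bar R}).

Lemma integrable_mul_bounded (f h : T -> R) (C : R) :
  mu.-integrable setT (EFin \o f) -> measurable_fun setT h -> (forall x, `|h x| <= C) ->
  mu.-integrable setT (EFin \o (fun x => f x * h x)).
Proof.
move=> jf mh hC.
have mf : measurable_fun setT f by apply/measurable_EFinP; exact: measurable_int jf.
have jC : mu.-integrable setT (EFin \o (fun x => C * `|f x|)).
  apply: integrable_Zl; have := integrable_abse jf.
  by apply: eq_integrable.
apply: (integrable_le (measurable_funM mf mh) jC) => x.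
by rewrite normrM mulrC ler_wpM2r.
Qed.

End bounded_multiples.

Section frac_div_linear.
Context {R : realType} {n : nat}.
Local Notation leb := (@lebesgue_rV R n).
Local Notation lam := (@lebesgue_measure R).
Local Notation Rn := 'rV[R]_n.

(** Linearity is read off the heat representation, where the integrals are known to converge
    absolutely. *)
Lemma frac_divD (alpha M L M' L' : R) (phi psi : Rn -> Rn) : 0 < alpha < 1 ->
  bounded_lipschitz phi M L -> bounded_lipschitz psi M' L' ->
  forall x, frac_div alpha (fun x => phi x + psi x) x = frac_div alpha phi x + frac_div alpha psi x.
Proof.
move=> a01 bphi bpsi x.
have [mphi L0 phiM phiL] := bphi; have [mpsi L0' psiM psiL] := bpsi.
have mD : measurable_fun setT (fun x => phi x + psi x : Rn) by exact: measurable_rVD.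
have bD : bounded_lipschitz (fun x => phi x + psi x) (M + M') (L + L').
  split => //; first exact: addr_ge0.
    by move=> y; rewrite (le_trans (enormD _ _))// lerD.
  move=> y z; rewrite mulrDl opprD addrACA (le_trans (enormD _ _))// lerD//.
have [i1 ->] := frac_div_heat x a01 bphi; have [i2 ->] := frac_div_heat x a01 bpsi.
have [_ ->] := frac_div_heat x a01 bD.
rewrite -mulrDr; congr (_ * _); rewrite -RintegralD//; apply: eq_Rintegral => t _.
have [t0|t0] := leP t 0; first by rewrite hpow_le0// !mul0r addr0.
rewrite -mulrDr; congr (_ * _); rewrite /heat_div -mulrDr; congr (_ * _).
have ms (g : Rn -> Rn) : measurable_fun setT g -> measurable_fun setT (fun z => g (x + z)).
  by move=> mg; apply: (measurableT_comp mg); exact: measurable_rVD.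
have [j1 _] := integrable_edot_heat t0 (ms _ mphi) (fun z => phiM (x + z)).
have [j2 _] := integrable_edot_heat t0 (ms _ mpsi) (fun z => psiM (x + z)).
by rewrite -RintegralD//; apply: eq_Rintegral => z _; rewrite edotDr mulrDl.
Qed.

Lemma frac_divZ (alpha M L c : R) (phi : Rn -> Rn) : 0 < alpha < 1 ->
  bounded_lipschitz phi M L ->
  forall x, frac_div alpha (fun x => c *: phi x) x = c * frac_div alpha phi x.
Proof.
move=> a01 bphi x; have [mphi L0 phiM phiL] := bphi.
have mZ : measurable_fun setT (fun x => c *: phi x : Rn).
  apply: measurable_fun_rV => i; under eq_fun do rewrite mxE.
  by apply: measurable_funM => //; exact: (measurableT_comp (measurable_coord i)).
have bZ : bounded_lipschitz (fun x => c *: phi x) (`|c| * M) (`|c| * L).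
  split => //; first exact: mulr_ge0.
    by move=> y; rewrite enormZ ler_wpM2l.
  by move=> y z; rewrite -scalerBr enormZ -mulrA ler_wpM2l.
have [i1 ->] := frac_div_heat x a01 bphi; have [_ ->] := frac_div_heat x a01 bZ.
rewrite mulrCA; congr (_ * _); rewrite -RintegralZ//; apply: eq_Rintegral => t _.
have [t0|t0] := leP t 0; first by rewrite hpow_le0// !mul0r mulr0.
rewrite [RHS]mulrCA; congr (_ * _); rewrite /heat_div [RHS]mulrCA; congr (_ * _).
have ms (g : Rn -> Rn) : measurable_fun setT g -> measurable_fun setT (fun z => g (x + z)).
  by move=> mg; apply: (measurableT_comp mg); exact: measurable_rVD.
have [j1 _] := integrable_edot_heat t0 (ms _ mphi) (fun z => phiM (x + z)).
by rewrite -RintegralZ//; apply: eq_Rintegral => z _; rewrite edotZr mulrA.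
Qed.

End frac_div_linear.

Section charge_of_difference.
Context d (T : measurableType d) {R : realType}.

(** Cross-adding gives the identity nu^+ + q = p + nu^- of positive measures. It is integrated
    against the nonnegative function g + |C| and against |C|, and the two results are subtracted. *)
Lemma Rcharge_integral_unique (nu : {charge set T -> \bar R})
    (p q : {finite_measure set T -> \bar R}) (g : T -> R) (C : R) :
  (forall A, measurable A -> nu A = (p A - q A)%E) -> measurable_fun setT g ->
  (forall x, `|g x| <= C) ->
  Rcharge_integral nu g = \int[p]_x g x - \int[q]_x g x.
Proof.
move=> nuE mg gC.
have H (h : T -> R) (K : R) : measurable_fun setT h -> (forall x, 0 <= h x <= K) ->
    \int[charge_pos nu]_x h x + \int[q]_x h x = \int[p]_x h x + \int[charge_neg nu]_x h x.
  move=> mh hK.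
  have j (m : {finite_measure set T -> \bar R}) : m.-integrable setT (EFin \o h).
    by apply: (@integrable_bounded _ _ _ m h K mh) => x; have /andP[? ?] := hK x; rewrite ger0_norm.
  apply: EFin_inj; rewrite !EFinD -!(integral_fineK (j _)).
  have h0 x : setT x -> (0 <= (h x)%:E)%E by move=> _; rewrite lee_fin; have /andP[] := hK x.
  have mE : measurable_fun setT (EFin \o h) by exact/measurable_EFinP.
  rewrite -!ge0_integral_measure_add//; apply: eq_measure_integral => A mA _.
  transitivity (charge_pos nu A + q A)%E; first exact: measure_addE.
  transitivity (p A + charge_neg nu A)%E; last exact/esym/measure_addE.
  have f1 : charge_pos nu A \is a fin_num by exact: fin_num_measure.
  have f2 : charge_neg nu A \is a fin_num by exact: fin_num_measure.
  have f3 : p A \is a fin_num by exact: fin_num_measure.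
  have f4 : q A \is a fin_num by exact: fin_num_measure.
  have := charge_fineE nu mA; rewrite nuE// fineB//.
  rewrite -(fineK f1) -(fineK f2) -(fineK f3) -(fineK f4) -!EFinD => e.
  by congr EFin; move: e; rewrite !fineK//=; lra.
have C0 (x : T) : 0 <= C := le_trans (normr_ge0 _) (gC x).
have jg (m : {finite_measure set T -> \bar R}) : m.-integrable setT (EFin \o g) by exact: integrable_bounded gC.
have h1 := H (fun x => g x + `|C|) (`|C| + `|C|) (measurable_funD mg (measurable_cst _)).
have h2 := H (fun=> `|C|) (`|C|) (measurable_cst _).
have {}h1 : \int[charge_pos nu]_x (g x + `|C|) + \int[q]_x (g x + `|C|) =
    \int[p]_x (g x + `|C|) + \int[charge_neg nu]_x (g x + `|C|).
  apply: h1 => x; have := gC x; rewrite ler_norml (ger0_norm (C0 x)) => /andP[? ?].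
  by rewrite -lerBlDr sub0r lerD2r; apply/andP.
have {}h2 := h2 (fun x => introT andP (conj (normr_ge0 _) (lexx _))).
have jc (m : {finite_measure set T -> \bar R}) : m.-integrable setT (EFin \o (fun=> `|C|)).
  exact: finite_measure_integrable_cst.
have E (m : {finite_measure set T -> \bar R}) :
    \int[m]_x (g x + `|C|) = \int[m]_x g x + \int[m]_x `|C|.
  by rewrite RintegralD//; [exact: jg|exact: jc].
rewrite !E in h1; clear C0 H; rewrite /Rcharge_integral; lra.
Qed.

Lemma charge_of_difference (p q : {finite_measure set T -> \bar R}) :
  exists nu : {charge set T -> \bar R}, forall (g : T -> R) (C : R),
    measurable_fun setT g -> (forall x, `|g x| <= C) ->
    Rcharge_integral nu g = \int[p]_x g x - \int[q]_x g x.
Proof.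
exists (cadd (charge_of_finite_measure p) (copp (charge_of_finite_measure q))).
by move=> g C mg gC; apply: Rcharge_integral_unique gC.
Qed.

End charge_of_difference.

Section fractional_variation_existence.
Context {R : realType} {n : nat}.
Local Notation leb := (@lebesgue_rV R n).
Local Notation Rn := 'rV[R]_n.
Local Notation e_ j := (delta_mx ord0 j : Rn).

Lemma test_fieldZ c (phi : Rn -> Rn) : test_field phi -> test_field (fun x => c *: phi x).
Proof.
move=> tphi; rewrite (test_fieldE phi).
rewrite (_ : (fun x => _) = fun x => \sum_(j <- enum 'I_n) (c * phi x ord0 j) *: e_ j); last first.
  by apply/funext => x; rewrite scaler_sumr; apply: eq_bigr => j _; rewrite scalerA.
apply: test_field_sum => j; apply: test_function_vec; apply: test_functionZ.
exact: test_field_coord.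
Qed.

Lemma enorm_delta j : enorm (e_ j) = 1.
Proof.
rewrite /enorm /edot (bigD1 j)//= !mxE !eqxx/= mulr1n mulr1 big1 ?addr0 ?sqrtr1// => i ij.
by rewrite !mxE (negbTE ij) andbF mulr0.
Qed.

Variables (alpha : R) (f : Rn -> R).
Hypothesis alpha01 : 0 < alpha < 1.
Hypothesis jf : leb.-integrable setT (EFin \o f).

Lemma integrable_frac_div_test (phi : Rn -> Rn) : test_field phi ->
  leb.-integrable setT (EFin \o (fun x => f x * frac_div alpha phi x)).
Proof.
move=> tphi; have [M M0 pM] := test_field_bounded tphi.
have [L bl] := test_field_bounded_lipschitz tphi pM.
have [mT [C C0 TC]] := frac_div_bounded alpha01 bl.
exact: integrable_mul_bounded TC.
Qed.

Let pair (phi : Rn -> Rn) : R := \int[leb]_x (f x * frac_div alpha phi x).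

Let pairD (phi psi : Rn -> Rn) : test_field phi -> test_field psi ->
  pair (fun x => phi x + psi x) = pair phi + pair psi.
Proof.
move=> tphi tpsi; have [M M0 pM] := test_field_bounded tphi.
have [L bl] := test_field_bounded_lipschitz tphi pM.
have [M' M0' pM'] := test_field_bounded tpsi.
have [L' bl'] := test_field_bounded_lipschitz tpsi pM'.
rewrite /pair -RintegralD//; [|exact: integrable_frac_div_test|exact: integrable_frac_div_test].
by apply: eq_Rintegral => x _; rewrite (frac_divD alpha01 bl bl') mulrDr.
Qed.

Let pairZ c (phi : Rn -> Rn) : test_field phi -> pair (fun x => c *: phi x) = c * pair phi.
Proof.
move=> tphi; have [M M0 pM] := test_field_bounded tphi.
have [L bl] := test_field_bounded_lipschitz tphi pM.
rewrite /pair -RintegralZ//; last exact: integrable_frac_div_test.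
by apply: eq_Rintegral => x _; rewrite (frac_divZ c alpha01 bl) mulrCA.
Qed.

Let pair_sum (I : Type) (s : seq I) (F : I -> Rn -> Rn) : (forall i, test_field (F i)) ->
  pair (fun x => \sum_(i <- s) F i x) = \sum_(i <- s) pair (F i).
Proof.
move=> tF; elim: s => [|i s IH].
  under eq_fun do rewrite big_nil; rewrite big_nil -[RHS](mul0r (pair (fun=> 0))) -pairZ.
    by congr pair; apply/funext => x; rewrite scale0r.
  exact: test_field0.
under eq_fun do rewrite big_cons; rewrite big_cons pairD ?IH//.
exact: test_field_sum.
Qed.

Lemma Rintegral_frac_div_test (D : @vector_measure R n) (phi : Rn -> Rn) : test_field phi ->
  (\int[leb]_x (f x * frac_div alpha phi x)%:E =
     - \sum_(i < n) charge_integral (D i) (fun x => (phi x ord0 i)%:E))%E <->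
  \int[leb]_x (f x * frac_div alpha phi x) = - vector_pairing D phi.
Proof.
move=> tphi; rewrite (integral_fineK (integrable_frac_div_test tphi)).
have [M M0 pM] := test_field_bounded tphi.
have mphi := measurable_continuous (test_field_continuous tphi).
have -> : (\sum_(i < n) charge_integral (D i) (fun x => (phi x ord0 i)%:E) =
    (vector_pairing D phi)%:E)%E.
  rewrite /vector_pairing -sumEFin; apply: eq_bigr => i _.
  rewrite (@charge_integralE _ _ _ _ _ M)//.
    exact: (measurableT_comp (measurable_coord i)).
  by move=> x; apply: le_trans (pM x); exact: normr_coord_le_enorm.
rewrite -EFinN; split => [[]|->] //.
Qed.

Hypothesis BVf : BVfrac alpha f.

Let variation_bound : exists2 V : R, 0 <= V &
  forall phi C, test_field phi -> (forall x, enorm (phi x) <= C) -> `|pair phi| <= V * C.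
Proof.
have [_ Voo] := BVf; set S := ereal_sup _ in Voo.
have inS phi : test_field phi -> (forall x, enorm (phi x) <= 1) -> ((pair phi)%:E <= S)%E.
  move=> tphi p1; apply: ereal_sup_ubound; exists phi.
    split => //; rewrite unlock /Lnorm; case: ifPn => _; last by rewrite lee_fin ler01.
    apply/ess_sup_inf.ess_supP; apply: nearW => x /=.
    by rewrite lee_fin ger0_norm ?enorm_ge0.
  by rewrite (integral_fineK (integrable_frac_div_test tphi)).
have S0 : (0 <= S)%E.
  have := inS _ test_field0; rewrite (_ : pair _ = 0).
    by apply=> x; rewrite enorm0 ler01.
  rewrite -[RHS](mul0r (pair (fun=> 0))) -pairZ; last exact: test_field0.
  by congr pair; apply/funext => x; rewrite scale0r.
have Sf : S \is a fin_num by rewrite ge0_fin_numE.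
exists (fine S); first exact: fine_ge0.
have H phi C : 0 < C -> test_field phi -> (forall x, enorm (phi x) <= C) -> pair phi <= fine S * C.
  move=> C0 tphi pC; rewrite -ler_pdivrMr// mulrC -pairZ// -lee_fin (fineK Sf).
  apply: inS => [|x]; first exact: test_fieldZ.
  by rewrite enormZ ger0_norm ?invr_ge0 ?(ltW C0)// mulrC ler_pdivrMr// mul1r.
have H' phi C : 0 < C -> test_field phi -> (forall x, enorm (phi x) <= C) -> `|pair phi| <= fine S * C.
  move=> C0 tphi pC; rewrite ler_norml H// andbT lerNl.
  rewrite -mulN1r -pairZ//; apply: H => //; first exact: test_fieldZ.
  by move=> x; rewrite scaleN1r enormN.
move=> phi C tphi pC; apply/ler_addgt0Pr => e e0.
have C0 : 0 <= C by apply: le_trans (pC 0); exact: enorm_ge0.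
(* C may be 0, so homogeneity is applied with C + d; this choice gives [fine S * d <= e]. *)
pose d := e / (fine S + 1).
have S1 : 0 < fine S + 1 by rewrite ltr_wpDl// fine_ge0.
have d0 : 0 < d by rewrite divr_gt0.
have := H' phi (C + d) (ltr_wpDl C0 d0) tphi (fun x => le_trans (pC x) _).
rewrite lerDl (ltW d0) => /(_ isT) h; apply: (le_trans h).
rewrite mulrDr lerD2l /d mulrCA ler_piMr ?(ltW e0)// ler_pdivrMr// mul1r.
by rewrite lerDl.
Qed.

Lemma frac_variation_exists : exists D : @vector_measure R n, is_frac_variation alpha f D.
Proof.
have [V V0 HV] := variation_bound.
pose L (j : 'I_n) (g : Rn -> R) := pair (fun x => g x *: e_ j).
have H j : exists p q : {finite_measure set Rn -> \bar R},
    forall g, test_function g -> L j g = \int[p]_x g x - \int[q]_x g x.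
  apply: (@riesz_representation R n (L j) V).
  - move=> g h tg th; rewrite /L -pairD; [|exact: test_function_vec|exact: test_function_vec].
    by congr pair; apply/funext => x; rewrite scalerDl.
  - move=> c g tg; rewrite /L -pairZ; last exact: test_function_vec.
    by congr pair; apply/funext => x; rewrite scalerA.
  - move=> g C tg gC; apply: HV; first exact: test_function_vec.
    by move=> x; rewrite enormZ enorm_delta mulr1.
have HD j : exists nu : {charge set Rn -> \bar R}, forall g, test_function g ->
    Rcharge_integral nu g = - L j g.
  (* The order q, p is reversed because of the minus sign in [is_frac_variation]. *)
  have [p [q pq]] := H j; have [nu Hnu] := charge_of_difference q p.
  exists nu => g tg; rewrite pq// opprB; have [sg [M gM]] := tg.
  have [C C0 gC] := compact_support_bounded (Ck_continuous (sg 0%N)) gM.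
  by rewrite (Hnu g C)//; exact: measurable_smooth.
exists (fun j => projT1 (cid (HD j))) => phi tphi.
apply/(Rintegral_frac_div_test _ tphi).
rewrite /vector_pairing -sumrN.
rewrite -/(pair phi) {1}(test_fieldE phi) pair_sum; last first.
  by move=> j; apply: test_function_vec; exact: test_field_coord.
rewrite big_enum/=; apply: eq_bigr => j _; case: cid => nu /= ->; last exact: test_field_coord.
by rewrite opprK.
Qed.

Lemma frac_variationP : is_frac_variation alpha f (frac_variation alpha f).
Proof.
rewrite /frac_variation; case: pselect => [H|[]]; last exact: frac_variation_exists.
by case: cid.
Qed.

End fractional_variation_existence.

(** * Bessel averages *)

Section averages.
Context {R : realType} {n : nat}.
Local Notation leb := (@lebesgue_rV R n).
Local Notation Rn := 'rV[R]_n.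
Context d (T : measurableType d) (m : {sigma_finite_measure set T -> \bar R}).
Variables (K : T -> R) (Z : T -> Rn).
Hypothesis K0 : forall p, 0 <= K p.
Hypothesis jK : m.-integrable setT (EFin \o K).
Hypothesis mZ : measurable_fun setT Z.

(** Kernel and displacement live on an abstract space, so that averages over pairs (r, w) with
    displacement w require no formula for the density of the mixture on R^n. *)
Definition average (h : Rn -> R) (x : Rn) : R := \int[m]_p (K p * h (x + Z p)).

Let mK : measurable_fun setT K.
Proof. by apply/measurable_EFinP; exact: measurable_int jK. Qed.

Let measurable_translate (h : Rn -> R) : measurable_fun setT h ->
  measurable_fun setT (fun q : Rn * T => h (q.1 + Z q.2)).
Proof.
move=> mh; apply: (measurableT_comp mh); apply: measurable_rVD => //.
exact: (measurableT_comp mZ).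
Qed.

Let measurable_kernel (h : Rn -> R) : measurable_fun setT h ->
  measurable_fun setT (fun q : Rn * T => K q.2 * h (q.1 + Z q.2)).
Proof.
move=> mh; apply: measurable_funM; last exact: measurable_translate.
exact: (measurableT_comp mK).
Qed.

Let measurable_translate1 (h : Rn -> R) x : measurable_fun setT h ->
  measurable_fun setT (fun p => h (x + Z p)).
Proof. by move=> mh; apply: (measurableT_comp mh); exact: measurable_rVD. Qed.

Let integrable_kernel (h : Rn -> R) (C : R) x : measurable_fun setT h ->
  (forall x, `|h x| <= C) -> m.-integrable setT (EFin \o (fun p => K p * h (x + Z p))).
Proof. by move=> mh hC; apply: integrable_mul_bounded (measurable_translate1 x mh) _. Qed.

Lemma measurable_average (h : Rn -> R) : measurable_fun setT h ->
  measurable_fun setT (average h).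
Proof. by move=> mh; exact: (measurable_Rintegral2 m (measurable_kernel mh)). Qed.

Lemma normr_average (h : Rn -> R) (C : R) x : measurable_fun setT h ->
  (forall x, `|h x| <= C) -> `|average h x| <= C * \int[m]_p K p.
Proof.
move=> mh hC; rewrite -RintegralZ//; apply: Rintegral_le_bound.
- by apply: measurable_funM => //; exact: measurable_translate1.
- exact: integrable_Zl.
- by move=> p; rewrite normrM (ger0_norm (K0 p)) mulrC ler_wpM2r.
Qed.

Lemma Rintegral_average (mu : {sigma_finite_measure set Rn -> \bar R}) (f h : Rn -> R) (C : R) :
  mu.-integrable setT (EFin \o f) -> measurable_fun setT h -> (forall x, `|h x| <= C) ->
  \int[mu]_x (f x * average h x) = \int[m]_p (K p * \int[mu]_x (f x * h (x + Z p))).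
Proof.
move=> jf mh hC; have mf : measurable_fun setT f by apply/measurable_EFinP; exact: measurable_int jf.
pose F (q : Rn * T) := f q.1 * (K q.2 * h (q.1 + Z q.2)).
have mF : measurable_fun setT F.
  apply: measurable_funM; last exact: measurable_kernel.
  exact: (measurableT_comp mf).
have mFx x : measurable_fun setT (fun p => F (x, p)).
  by apply: (measurableT_comp mF); exact: measurable_pair1.
have jg : mu.-integrable setT (EFin \o (fun x => (C * \int[m]_p K p) * `|f x|)).
  by apply: integrable_Zl; have := integrable_abse jf; apply: eq_integrable.
have jF : (mu \x m)%E.-integrable setT (EFin \o F).
  refine (integrable_prodl (m1 := mu) (m2 := m) (F := F) mF jg _) => x.
  apply: (@le_trans _ _ (\int[m]_p ((`|f x| * C) * K p)%:E)%E).
    apply: ge0_le_integral => //.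
    - by apply/measurable_EFinP; apply: measurableT_comp.
    - exact: measurable_int (integrable_Zl _ jK).
    - move=> p _; rewrite lee_fin /F/= normrM -mulrA ler_wpM2l// normrM (ger0_norm (K0 p)).
      by rewrite mulrC ler_wpM2r.
  rewrite (integral_fineK (integrable_Zl _ jK)) lee_fin RintegralZ//.
  by rewrite le_eqVlt; apply/orP; left; apply/eqP; ring.
transitivity (\int[mu]_x (\int[m]_p F (x, p))).
  apply: eq_Rintegral => x _; rewrite /F/= /average RintegralZ//.
  exact: integrable_kernel hC.
rewrite (Rfubini jF); apply: eq_Rintegral => p _.
rewrite -RintegralZ//; last first.
  apply: integrable_mul_bounded jf _ _; last by move=> x; exact: hC.
  by apply: (measurableT_comp mh); exact: measurable_rVD.
by apply: eq_Rintegral => x _; rewrite /F/=; ring.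
Qed.

Lemma Rintegral_average1 (nu : {finite_measure set Rn -> \bar R}) (h : Rn -> R) (C : R) :
  measurable_fun setT h -> (forall x, `|h x| <= C) ->
  \int[nu]_x average h x = \int[m]_p (K p * \int[nu]_x h (x + Z p)) /\
  m.-integrable setT (EFin \o (fun p => K p * \int[nu]_x h (x + Z p))).
Proof.
move=> mh hC; have j1 : nu.-integrable setT (EFin \o (fun _ : Rn => 1 : R)).
  exact: finite_measure_integrable_cst.
have := Rintegral_average j1 mh hC.
under eq_Rintegral do rewrite mul1r; under [X in _ = X -> _]eq_Rintegral do under eq_Rintegral do rewrite mul1r.
move=> ->; split => //.
have mI : measurable_fun setT (fun p => \int[nu]_x h (x + Z p)).
  exact: (measurable_Rintegral1 nu (measurable_translate mh)).
apply: (@integrable_mul_bounded _ _ _ m _ _ (C * fine (nu setT)) jK mI) => p.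
rewrite -[leRHS](Rintegral_cst nu measurableT); apply: Rintegral_le_bound => //.
- by apply: (measurableT_comp mh); exact: measurable_rVD.
- exact: finite_measure_integrable_cst.
Qed.

Definition vector_average (phi : Rn -> Rn) (x : Rn) : Rn :=
  \row_i average (fun y => phi y ord0 i) x.

Lemma measurable_vector_average phi : measurable_fun setT phi ->
  measurable_fun setT (vector_average phi).
Proof.
move=> mphi; apply: measurable_fun_rV => i; under eq_fun do rewrite mxE.
by apply: measurable_average; exact: (measurableT_comp (measurable_coord i)).
Qed.

(** Minkowski's integral inequality, by duality: a scalar product with a fixed unit vector passes
    under the integral. The majorant [b] is free, since the mass of the kernel and its second moment
    are both used. *)
Lemma enorm_vector_average (phi : Rn -> Rn) (C : R) (b : T -> R) x :
  measurable_fun setT phi -> (forall x, enorm (phi x) <= C) ->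
  m.-integrable setT (EFin \o b) -> (forall p, K p * enorm (phi (x + Z p)) <= b p) ->
  enorm (vector_average phi x) <= \int[m]_p b p.
Proof.
move=> mphi phiC jb le.
have mi i : measurable_fun setT (fun y => phi y ord0 i) by exact: (measurableT_comp (measurable_coord i)).
have ci i y : `|phi y ord0 i| <= C by apply: le_trans (phiC y); exact: normr_coord_le_enorm.
have jk i : m.-integrable setT (EFin \o (fun p => K p * phi (x + Z p) ord0 i)).
  exact: (integrable_kernel x (mi i) (ci i)).
apply: enorm_le_dot => [|e e1].
  apply: Rintegral_ge0 => p _; apply: le_trans (le p).
  by rewrite mulr_ge0 ?enorm_ge0.
rewrite edotC.
have -> : edot (vector_average phi x) e = \int[m]_p (K p * edot (phi (x + Z p)) e).
  rewrite /edot.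
  transitivity (\sum_i \int[m]_p (e ord0 i * (K p * phi (x + Z p) ord0 i))).
    by apply: eq_bigr => i _; rewrite mxE RintegralZ// mulrC.
  rewrite -(@Rintegral_sum _ _ _ m _ (index_enum 'I_n) (fun i p => e ord0 i * (K p * phi (x + Z p) ord0 i))).
    by apply: eq_Rintegral => p _; rewrite mulr_sumr; apply: eq_bigr => i _; ring.
  by move=> i; exact: integrable_Zl.
have mxp : measurable_fun setT (fun p => phi (x + Z p)).
  by apply: (measurableT_comp mphi); exact: measurable_rVD.
apply: le_trans (ler_norm _) _; apply: Rintegral_le_bound => //.
  by apply: measurable_funM => //; apply: measurable_edot.
move=> p; apply: le_trans (le p); rewrite normrM (ger0_norm (K0 p)) ler_wpM2l//.
by rewrite (le_trans (normr_edot_le _ _))// ler_piMr// enorm_ge0.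
Qed.

End averages.

(* The library's instance is shadowed by the one for subprobabilities. *)
Lemma product_sigma_finite (R : realType) d1 d2 (T1 : measurableType d1) (T2 : measurableType d2)
    (m1 : {sigma_finite_measure set T1 -> \bar R}) (m2 : {sigma_finite_measure set T2 -> \bar R}) :
  sigma_finite setT (m1 \x m2)%E.
Proof.
have /sigma_finiteP[F [TF ndF Foo]] := sigma_finiteT m1.
have /sigma_finiteP[G [TG ndG Goo]] := sigma_finiteT m2.
exists (fun k => F k `*` G k).
  apply/esym/seteqP; split => // -[x y] _.
  have [k _ Fk] : (\bigcup_k F k) x by rewrite -TF.
  have [l _ Gl] : (\bigcup_k G k) y by rewrite -TG.
  exists (maxn k l) => //; split.
  - by move: Fk; exact/subsetPset/ndF/leq_maxl.
  - by move: Gl; exact/subsetPset/ndG/leq_maxr.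
move=> k; have [mF Fk] := Foo k; have [mG Gk] := Goo k.
split; first exact: measurableX.
by rewrite product_measure1E// lte_mul_pinfty// ge0_fin_numE.
Qed.

Definition product_sigma_finite_measure (R : realType) d1 d2 (T1 : measurableType d1) (T2 : measurableType d2)
    (m1 : {sigma_finite_measure set T1 -> \bar R}) (m2 : {sigma_finite_measure set T2 -> \bar R}) :
  {sigma_finite_measure set (T1 * T2)%type -> \bar R} :=
  HB.pack (product_measure1 m1 m2) (Measure.on (product_measure1 m1 m2))
    (Measure_isSigmaFinite.Build _ _ _ (product_measure1 m1 m2) (product_sigma_finite m1 m2)).

Section bessel_kernel.
Context {R : realType} {n : nat}.
Local Notation leb := (@lebesgue_rV R n).
Local Notation lam := (@lebesgue_measure R).
Local Notation Rn := 'rV[R]_n.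

(** Heat kernels have mass 1, so the mixture has the mass of its weight. The factor c is 1 for the
    kernel itself and 2 for its second moment, where the time is doubled. *)
Lemma heat_mixture (u : R -> R) (c : R) : 0 < c -> lam.-integrable setT (EFin \o u) ->
  (forall r, r <= 0 -> u r = 0) ->
  (lam \x leb)%E.-integrable setT (EFin \o (fun p => u p.1 * heat (c * p.1) p.2)) /\
  \int[(lam \x leb)%E]_p (u p.1 * heat (c * p.1) p.2) = \int[lam]_r u r.
Proof.
move=> c0 ju u0.
have mu : measurable_fun setT u by apply/measurable_EFinP; exact: measurable_int ju.
pose F (p : R * Rn) := u p.1 * heat (c * p.1) p.2.
have mF : measurable_fun setT F.
  apply: measurable_funM; first by apply: (measurableT_comp mu).
  by apply: measurable_heat => //; exact: measurable_funM.
have jabs : lam.-integrable setT (EFin \o (fun r => `|u r|)).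
  by have := integrable_abse ju; apply: eq_integrable.
have jF : (lam \x leb)%E.-integrable setT (EFin \o F).
  refine (integrable_prodl (m1 := lam) (m2 := leb) (F := F) mF jabs _) => r.
  have [r0|r0] := leP r 0.
    under eq_integral do rewrite /F/= u0// mul0r normr0.
    by rewrite integral0 lee_fin.
  have cr : 0 < c * r by rewrite mulr_gt0.
  under eq_integral do rewrite /F/= normrM [`|heat _ _|]ger0_norm ?heat_ge0//.
  by rewrite (integral_fineK (integrable_cst_heat _ cr)) Rintegral_cst_heat.
split=> //; rewrite -(proj2 (integrable_Rintegral2 jF)).
apply: eq_Rintegral => r _; rewrite /F/=.
have [r0|r0] := leP r 0; last by rewrite Rintegral_cst_heat// mulr_gt0.
under eq_Rintegral do rewrite u0// mul0r.
by rewrite Rintegral_cst// mul0r u0.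
Qed.

Definition bessel_kernel (s : R) (p : R * Rn) : R := bessel_weight s p.1 * heat p.1 p.2.

Lemma bessel_weight_le0 (s r : R) : r <= 0 -> bessel_weight s r = 0.
Proof. by move=> r0; rewrite /bessel_weight hpow_le0// mul0r mulr0. Qed.

Lemma bessel_kernel_ge0 s p : 0 < s -> 0 <= bessel_kernel s p.
Proof. by move=> s0; rewrite mulr_ge0 ?heat_ge0 ?bessel_weight_ge0. Qed.

Lemma integrable_bessel_kernel s : 0 < s ->
  (lam \x leb)%E.-integrable setT (EFin \o bessel_kernel s) /\
  \int[(lam \x leb)%E]_p bessel_kernel s p = 1.
Proof.
move=> s0.
have [j e] := heat_mixture ltr01 (integrable_bessel_weight s0) (@bessel_weight_le0 s).
rewrite Rintegral_bessel_weight// in e.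
have E : bessel_kernel s = (fun p => bessel_weight s p.1 * heat (1 * p.1) p.2).
  by apply/funext => p; rewrite mul1r.
by rewrite E.
Qed.

Lemma average_bessel_kernel s (h : Rn -> R) (C : R) x : 0 < s ->
  measurable_fun setT h -> (forall x, `|h x| <= C) ->
  average (product_sigma_finite_measure lam leb) (bessel_kernel s) snd h x =
  \int[lam]_r (bessel_weight s r * \int[leb]_w (heat r w * h (x + w))).
Proof.
move=> s0 mh hC; have [jK _] := integrable_bessel_kernel s0.
have mhx : measurable_fun setT (fun p : R * Rn => h (x + p.2)).
  by apply: (measurableT_comp mh); exact: measurable_rVD.
have j := integrable_mul_bounded jK mhx (fun p => hC (x + p.2)).
rewrite /average -(proj2 (integrable_Rintegral2 j)); apply: eq_Rintegral => r _ /=.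
have [r0|r0] := leP r 0.
  rewrite bessel_weight_le0// mul0r /bessel_kernel/=.
  under eq_Rintegral do rewrite bessel_weight_le0// !mul0r.
  by rewrite Rintegral_cst// mul0r.
rewrite -RintegralZ; first by apply: eq_Rintegral => w _; rewrite /bessel_kernel/= mulrA.
apply: (integrable_mul_bounded (integrable_heat r0) _ (fun w => hC (x + w))).
by apply: (measurableT_comp mh); exact: measurable_rVD.
Qed.

(** From t^s <= 1 + t under the integral; the point is uniformity in s. *)
Lemma Gamma_S_le (s : R) : 0 < s <= 1 -> Gamma (s + 1) <= Gamma 1 + Gamma 2.
Proof.
move=> /andP[s0 s1]; have s10 : 0 < s + 1 by rewrite addr_gt0.
have j1 := @integrable_Gamma R 1 ltr01; have j2 := @integrable_Gamma R 2 ltac:(by []).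
rewrite !GammaE -RintegralD//; apply: le_Rintegral => //.
- exact: integrable_Gamma.
- exact: integrable_Radd.
move=> t _; rewrite -mulrDl ler_wpM2r ?expR_ge0//.
have [t0|t0] := leP t 0; first by rewrite !hpow_le0// addr0.
rewrite !hpow_gt0E// subrr powRr0 addrK.
have -> : 2 - 1 = 1 :> R by ring.
rewrite powRr1 ?(ltW t0)//; have [t1|t1] := leP t 1.
  apply: (@le_trans _ _ 1); last by rewrite lerDl ltW.
  by rewrite -[leRHS](powRr0 t); apply: ger_powR; rewrite ?t0// ltW.
apply: (@le_trans _ _ t); last by rewrite lerDr.
by rewrite -[leRHS](powRr1 (ltW t0)); apply: ler_powR => //; exact: ltW.
Qed.

(** [enorm2_heat] trades |w|^2 for a factor r, which raises the weight from r^(s-1) to r^s. The mass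
    becomes a multiple of Gamma(s+1) / Gamma(s), with Gamma(s+1) bounded and 1/Gamma(s) = O(s). *)
Lemma bessel_kernel_moment : exists C : R, forall s, 0 < s <= 1 ->
  exists G : R * Rn -> R, [/\ (lam \x leb)%E.-integrable setT (EFin \o G),
    forall p, bessel_kernel s p * enorm p.2 ^+ 2 <= G p &
    \int[(lam \x leb)%E]_p G p <= C * s].
Proof.
pose c : R := 8 * 2 `^ (n%:R / 2); have c0 : 0 <= c by rewrite mulr_ge0 ?powR_ge0.
exists (c * (expR 2 * (Gamma 1 + Gamma 2))) => s s01; have /andP[s0 s1] := s01.
have s10 : 0 < s + 1 by rewrite addr_gt0.
pose u r := (c * (Gamma s)^-1) * (hpow (s + 1) r * expR (- r)).
have ju : lam.-integrable setT (EFin \o u) by apply: integrable_Zl; exact: integrable_Gamma.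
have u0 r : r <= 0 -> u r = 0 by move=> r0; rewrite /u hpow_le0// mul0r mulr0.
have [jG eG] := heat_mixture (@ltr0n R 2) ju u0.
exists (fun p => u p.1 * heat (2 * p.1) p.2); split => //.
  move=> [r w]/=; rewrite /bessel_kernel/=.
  have [r0|r0] := leP r 0; first by rewrite u0// bessel_weight_le0// !mul0r.
  rewrite -mulrA [heat r w * _]mulrC.
  apply: (le_trans (ler_wpM2l (bessel_weight_ge0 r s0) (enorm2_heat w r0))).
  rewrite /u /bessel_weight !hpow_gt0E// addrK.
  have -> : r `^ s = r `^ (s - 1) * r.
    by rewrite -{3}(powRr1 (ltW r0)) -powRD ?subrK// (gt_eqF r0) implybT.
  by rewrite le_eqVlt; apply/orP; left; apply/eqP; rewrite /c; ring.
rewrite eG RintegralZ; last exact: integrable_Gamma.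
rewrite -GammaE.
rewrite (_ : c / Gamma s * _ = c * ((Gamma s)^-1 * Gamma (s + 1))); last by ring.
rewrite (_ : c * _ * s = c * ((expR 2 * s) * (Gamma 1 + Gamma 2))); last by ring.
apply: ler_wpM2l => //; rewrite ler_pM//.
- by rewrite invr_ge0 ltW// Gamma_gt0.
- by rewrite ltW// Gamma_gt0.
- exact: Gamma_inv_le.
- exact: Gamma_S_le.
Qed.

End bessel_kernel.

(** * The variation estimate *)

Section variation_estimate.
Context {R : realType} {n : nat}.
Local Notation leb := (@lebesgue_rV R n).
Local Notation lam := (@lebesgue_measure R).
Local Notation Rn := 'rV[R]_n.

Lemma frac_div_shift (alpha : R) (phi : Rn -> Rn) (z x : Rn) : measurable_fun setT phi ->
  frac_div alpha (fun y => phi (y + z)) x = frac_div alpha phi (x + z).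
Proof.
move=> mphi.
pose h (y : Rn) := edot (y - (x + z)) (phi y - phi (x + z)) /
  enorm (y - (x + z)) `^ (n%:R + alpha + 1).
have md : measurable_fun setT (fun y : Rn => y - (x + z)).
  by apply: measurable_rVD => //; exact: measurable_cst.
have mh : measurable_fun setT h.
  apply: measurable_funM.
    apply: measurable_edot => //; apply: measurable_rVD => //.
  apply: measurable_funV; apply: (measurableT_comp (measurable_powR _)).
  exact: measurable_enorm.
rewrite [RHS]/frac_div -(Rintegral_lebD z mh) /frac_div.
apply: (f_equal (fun u => frac_const alpha * u)).
by apply: eq_Rintegral => y _; rewrite /h opprD addrACA subrr addr0.
Qed.

Section averaged_pairing.
Variables (alpha : R) (f : Rn -> R) (D : @vector_measure R n).
Hypothesis alpha01 : 0 < alpha < 1.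
Hypothesis jf : leb.-integrable setT (EFin \o f).
Hypothesis HD : is_frac_variation alpha f D.

(** On the right-hand side Fubini is applied separately to the positive and negative part of each
    component of D, which are finite measures. *)
Lemma Rintegral_average_frac_div d (T : measurableType d)
    (m : {sigma_finite_measure set T -> \bar R}) (K : T -> R) (Z : T -> Rn) (phi : Rn -> Rn) :
  (forall p, 0 <= K p) -> m.-integrable setT (EFin \o K) -> measurable_fun setT Z ->
  test_field phi ->
  \int[leb]_x (f x * average m K Z (frac_div alpha phi) x) =
  - vector_pairing D (vector_average m K Z phi).
Proof.
move=> K0 jK mZ tphi.
have [M M0 pM] := test_field_bounded tphi.
have [L bl] := test_field_bounded_lipschitz tphi pM.
have [mT [C C0 TC]] := frac_div_bounded alpha01 bl.
have mphi := measurable_continuous (test_field_continuous tphi).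
have mi i : measurable_fun setT (fun y => phi y ord0 i) by exact: (measurableT_comp (measurable_coord i)).
have ci i y : `|phi y ord0 i| <= M by apply: le_trans (pM y); exact: normr_coord_le_enorm.
rewrite (Rintegral_average K0 jK mZ jf mT TC).
pose I (nu : {finite_measure set Rn -> \bar R}) i p := K p * \int[nu]_x phi (x + Z p) ord0 i.
have H (nu : {finite_measure set Rn -> \bar R}) i : \int[nu]_x average m K Z (fun y => phi y ord0 i) x = \int[m]_p I nu i p /\
    m.-integrable setT (EFin \o I nu i).
  exact: (Rintegral_average1 K0 jK mZ nu (mi i) (ci i)).
have jI i : m.-integrable setT (EFin \o (fun p => I (charge_pos (D i)) i p + -1 * I (charge_neg (D i)) i p)).
  apply: integrable_Radd; first exact: (H _ i).2.
  by apply: integrable_Zl; exact: (H _ i).2.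
transitivity (\int[m]_p (-1 * \sum_i (I (charge_pos (D i)) i p + -1 * I (charge_neg (D i)) i p))).
  apply: eq_Rintegral => p _.
  have ts := test_field_shift (Z p) tphi.
  under eq_Rintegral do rewrite -(frac_div_shift alpha (Z p) _ mphi).
  rewrite ((Rintegral_frac_div_test alpha01 jf D ts).1 (HD ts)) mulrN mulN1r; congr (- _).
  rewrite /vector_pairing mulr_sumr; apply: eq_bigr => i _.
  by rewrite mulN1r /I -mulrBr.
rewrite RintegralZ; last exact: (@integrable_Rsum _ _ _ m _ (index_enum 'I_n)
  (fun i p => I (charge_pos (D i)) i p + -1 * I (charge_neg (D i)) i p)).
rewrite (@Rintegral_sum _ _ _ m _ (index_enum 'I_n)
  (fun i p => I (charge_pos (D i)) i p + -1 * I (charge_neg (D i)) i p))// mulN1r; congr (- _).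
apply: eq_bigr => i _; rewrite RintegralD//; [|exact: (H _ i).2|by apply: integrable_Zl; exact: (H _ i).2].
rewrite RintegralZ; last exact: (H _ i).2.
rewrite mulN1r -(H _ i).1 -(H _ i).1 /Rcharge_integral.
by congr (_ - _); apply: eq_Rintegral => x _; rewrite mxE.
Qed.

End averaged_pairing.

Variables (alpha : R) (f : Rn -> R) (D : @vector_measure R n).
Hypothesis alpha01 : 0 < alpha < 1.
Hypothesis jf : leb.-integrable setT (EFin \o f).
Hypothesis HD : is_frac_variation alpha f D.

(** The constant is chosen before Omega, delta and beta, so that delta can later be fixed while beta
    tends to alpha. Two errors add up: the L^1 norm of f times the uniform error of
    [bessel_frac_div], and what D picks up outside the neighbourhood, where the averaged field is at
    most [eta]. *)
Lemma variation_estimate : exists2 C : R, 0 <= C & forall (Omega : set Rn) (delta beta : R) Db,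
  open Omega -> 0 < delta -> alpha * (3 / 4) <= beta < alpha ->
  is_frac_variation beta f Db ->
  (vector_variation Db Omega <= vector_variation D (neighborhood Omega delta) +
    (C * (1 + delta ^- 2) * (alpha - beta))%:E)%E.
Proof.
have [CD HCD] := vector_pairing_le D.
have [CM HCM] := @bessel_kernel_moment R n.
pose N1 := \int[leb]_x `|f x|; have N10 : 0 <= N1 by exact: Rintegral_ge0.
(* The factor e^2 comes from [Gamma_inv_le]; the absolute value avoids a discussion of the sign of
   [far_cst]. *)
pose B := N1 * (`|@far_cst R n alpha| * expR 2).
have B0 : 0 <= B by rewrite !mulr_ge0 ?expR_ge0.
exists (`|CM| * `|CD| + B); first by rewrite addr_ge0// mulr_ge0.
move=> Omega delta beta Db oO d0 b_range HDb; have /andP[b1 b2] := b_range.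
have /andP[a0 a1] := alpha01.
pose s := (alpha - beta) / 2; have s0 : 0 < s by rewrite divr_gt0// subr_gt0.
have beta0 : 0 < beta by apply: lt_le_trans b1; rewrite mulr_gt0.
have s01 : 0 < s <= 1 by rewrite s0/= /s; lra.
have beta01 : 0 < beta < 1 by rewrite beta0 (lt_trans b2).
pose A := neighborhood Omega delta.
have mA : measurable A by apply: sub_sigma_algebra; exact: open_neighborhood.
have VA0 := vector_variation_ge0 D mA.
pose eta := `|CM| * s * delta ^- 2.
have dd : 0 <= delta ^- 2 by rewrite invr_ge0 sqr_ge0.
have eta0 : 0 <= eta by rewrite /eta mulr_ge0// mulr_ge0// ltW.
rewrite -/A.
(* An infinite right-hand side makes the bound trivial; otherwise it is a real number, as
   [vector_variation_le] requires. *)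
have [->|VAfin] := eqVneq (vector_variation D A) +oo%E; first by rewrite addye// leey.
have VAf : vector_variation D A \is a fin_num by rewrite ge0_fin_numE// ltey.
rewrite -(fineK VAf) -EFinD; apply: vector_variation_le => // phi tphi phi1 phiO.
have [L bl] := test_field_bounded_lipschitz tphi phi1.
have mphi := measurable_continuous (test_field_continuous tphi).
have [mT [C C0 TC]] := frac_div_bounded alpha01 bl.
have [mTb [Cb Cb0 TCb]] := frac_div_bounded beta01 bl.
pose m := product_sigma_finite_measure lam leb.
pose K : (measurableTypeR R * Rn)%type -> R := @bessel_kernel R n s.
have K0 (p : (measurableTypeR R * Rn)%type) : 0 <= K p by exact: bessel_kernel_ge0.
have [jK' iK] := @integrable_bessel_kernel R n s s0.
have jK : m.-integrable setT (EFin \o K) := jK'.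
have mZ : measurable_fun setT (snd : (measurableTypeR R * Rn)%type -> Rn) by exact: measurable_snd.
pose psi := vector_average m K snd phi.
pose aT := average m K snd (frac_div alpha phi).
have maT : measurable_fun setT aT by exact: (measurable_average jK mZ mT).
have aTC x : `|aT x| <= C.
  have := normr_average K0 jK mZ x mT TC; rewrite -/aT.
  by rewrite (_ : \int[m]_p K p = 1) ?mulr1.
have near_avg x : `|frac_div beta phi x - aT x| <= `|@far_cst R n alpha| * (expR 2 * s).
  rewrite /aT (average_bessel_kernel x s0 mT TC).
  have := bessel_frac_div x alpha01 beta0 b_range bl erefl; rewrite mul1r => h.
  have G0 : 0 <= (Gamma s)^-1 by rewrite invr_ge0 (ltW (Gamma_gt0 s0)).
  apply: (le_trans h); apply: (le_trans (ler_wpM2r G0 (ler_norm _))).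
  by apply: ler_wpM2l => //; exact: Gamma_inv_le.
have pairb : vector_pairing Db phi = - \int[leb]_x (f x * frac_div beta phi x).
  by rewrite ((Rintegral_frac_div_test beta01 jf Db tphi).1 (HDb _ tphi)) opprK.
have paira : vector_pairing D psi = - \int[leb]_x (f x * aT x).
  by rewrite (Rintegral_average_frac_div alpha01 jf HD K0 jK mZ tphi) opprK.
have j1 := integrable_mul_bounded jf mTb TCb.
have j2 := integrable_mul_bounded jf maT aTC.
have jabs : leb.-integrable setT (EFin \o (fun x => `|f x|)).
  by have := integrable_abse jf; apply: eq_integrable.
have mf : measurable_fun setT f by apply/measurable_EFinP; exact: measurable_int jf.
have dist : vector_pairing Db phi - vector_pairing D psi <= B * s.
  rewrite pairb paira opprK addrC -RintegralB//.
  apply: le_trans (ler_norm _) _.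
  have -> : B * s = \int[leb]_x ((`|@far_cst R n alpha| * (expR 2 * s)) * `|f x|).
    by rewrite RintegralZ// -/N1 /B; ring.
  apply: Rintegral_le_bound; [|exact: integrable_Zl|].
    by apply: measurable_funB; exact: measurable_funM.
  move=> x; rewrite -mulrBr normrM mulrC ler_wpM2r// distrC.
  exact: near_avg.
have psi1 x : enorm (psi x) <= 1.
  rewrite -iK; apply: (enorm_vector_average K0 jK mZ mphi phi1 jK) => p.
  by rewrite ler_piMr.
have psieta x : ~ A x -> enorm (psi x) <= eta.
  move=> Ax; have [G [jG GK iG]] := HCM s s01.
  have jG' : m.-integrable setT (EFin \o (fun p => delta ^- 2 * G p)) by exact: integrable_Zl.
  apply: (@le_trans _ _ (\int[m]_p (delta ^- 2 * G p))); last first.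
    rewrite RintegralZ// /eta mulrC ler_wpM2r//; apply: (le_trans iG).
    by rewrite ler_wpM2r ?ler_norm// ltW.
  apply: (enorm_vector_average K0 jK mZ mphi phi1 jG') => p.
  have G0 : 0 <= G p by apply: le_trans (GK p); rewrite mulr_ge0 ?sqr_ge0//; exact: bessel_kernel_ge0.
  (* Chebyshev: a displacement from x outside [A] into Omega has sup norm, hence Euclidean norm, at
     least delta, so the kernel there is at most delta^(-2) times the majorant of its second
     moment. *)
  have [Op|Op] := pselect (Omega (x + p.2)); last by rewrite phiO// enorm0 mulr0 mulr_ge0.
  have dp : delta <= enorm p.2.
    apply: le_trans (norm_le_enorm _); rewrite leNgt; apply/negP => h; apply: Ax.
    by exists (x + p.2) => //; rewrite opprD addNKr normrN.
  apply: (@le_trans _ _ (K p)); first by rewrite ler_piMr.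
  rewrite mulrC ler_pdivlMr ?exprn_gt0//; apply: le_trans (GK p).
  by rewrite ler_wpM2l// lerXn2r ?nnegrE ?(ltW d0)// enorm_ge0.
have mpsi : measurable_fun setT psi by exact: (measurable_vector_average jK mZ mphi).
have := HCD psi A eta mA eta0 mpsi psi1 psieta.
rewrite -(fineK VAf) -EFinD lee_fin => h.
rewrite -[leLHS](subrK (vector_pairing D psi)).
apply: (le_trans (lerD dist h)); rewrite addrCA lerD2l.
have -> : alpha - beta = 2 * s by rewrite /s mulrCA mulfV ?mulr1.
have e1 : eta * CD <= `|CM| * `|CD| * delta ^- 2 * s.
  apply: (le_trans (ler_wpM2l eta0 (ler_norm CD))).
  by rewrite le_eqVlt; apply/orP; left; apply/eqP; rewrite /eta; ring.
apply: (le_trans (lerD (lexx _) e1)).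
set c := `|CM| * `|CD|; have c0 : 0 <= c by rewrite mulr_ge0.
set q := delta ^- 2 in dd *.
rewrite mulrA -mulrDl ler_wpM2r ?(ltW s0)//.
rewrite -subr_ge0 (_ : _ - _ = 2 * c + c * q + (B + 2 * (B * q))); last by ring.
by rewrite !addr_ge0// !mulr_ge0.
Qed.

End variation_estimate.

(** * The limit as beta tends to alpha from the left *)

Theorem theorem5p6 (R : realType) (n : nat) (alpha : R)
    (Omega : set 'rV[R]_n) (f : 'rV[R]_n -> R) :
  (1 <= n)%N -> 0 < alpha < 1 -> open Omega -> BVfrac alpha f ->
  bounded_set Omega \/ Omega = [set: 'rV[R]_n] ->
  (limf_esup (fun beta => vector_variation (frac_variation beta f) Omega)
     alpha^'- <=
   vector_variation (frac_variation alpha f) (closure Omega))%E.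
Proof.
move=> _ alpha01 oO BVf _; have [jf _] := BVf; have /andP[a0 a1] := alpha01.
have HD := frac_variationP alpha01 jf BVf; set D := frac_variation alpha f in HD *.
have [C C0 HC] := variation_estimate alpha01 jf HD.
apply/lee_addgt0Pr => e e0; have e20 : 0 < e / 2 by rewrite divr_gt0.
(* Half of the error e pays for replacing the closure by a neighbourhood. The width delta is now
   fixed, and the other half pays for alpha - beta. *)
have [delta d0 Hd] := vector_variation_neighborhood D Omega e20.
have dd : 0 <= delta ^- 2 by rewrite invr_ge0 sqr_ge0.
have q0 : 0 <= C * (1 + delta ^- 2) by rewrite mulr_ge0// addr_ge0.
set q := C * (1 + delta ^- 2) in q0.
(* q may be 0, hence the denominator q + 1; still q * r <= e / 2. *)
pose r := e / 2 / (q + 1).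
have q10 : 0 < q + 1 by rewrite ltr_wpDl.
have r0 : 0 < r by rewrite divr_gt0.
(* A left neighbourhood of alpha. The upper limit is an infimum of suprema over such sets, so the
   supremum over W bounds it; the two conditions are the range of [variation_estimate] and the
   smallness of its error. *)
pose W := [set beta : R | alpha * (3 / 4) <= beta < alpha /\ alpha - beta <= r].
have WF : alpha^'- W.
  exists (Num.min r (alpha / 4)) => /=; first by rewrite lt_min r0 divr_gt0.
  move=> beta /=; rewrite lt_min => /andP[h1 h2] ba.
  rewrite gtr0_norm ?subr_gt0// in h1 h2.
  by split; [apply/andP; split => //; lra|exact: ltW].
apply: (@le_trans _ _ (ereal_sup ((fun beta => vector_variation (frac_variation beta f) Omega) @` W))).
  by apply: ereal_inf_lbound; exists W.
have VC0 : (0 <= vector_variation D (closure Omega))%E.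
  apply: vector_variation_ge0; rewrite -[closure _]setCK; apply: measurableC.
  by apply: sub_sigma_algebra; rewrite openC; exact: closed_closure.
apply: ge_ereal_sup => _ [beta [b_range br] <-].
(* If no measure represents the beta-variation, [frac_variation] is the zero measure by definition
   and the bound holds trivially. *)
rewrite {1}/frac_variation; case: pselect => [Hb|_]; last first.
  apply: (le_trans (vector_variation_zero _)); apply: adde_ge0 => //.
  by rewrite lee_fin ltW.
case: cid => Db /= HDb.
apply: (le_trans (HC Omega delta beta Db oO d0 b_range HDb)).
apply: (le_trans (leeD2r _ Hd)); rewrite -addeA leeD2l// -EFinD lee_fin.
rewrite -/q [leRHS]splitr lerD2l; apply: (le_trans (ler_wpM2l q0 br)).
by rewrite /r mulrCA ler_piMr ?(ltW e20)// ler_pdivrMr// mul1r lerDl.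
Qed.
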